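(* Under the sine-process let $$\xi^N_t=\frac{\#_{[0,tN]}-\mathbf E\,\#_{[0,tN]}}{\pi^{-1}\sqrt{\ln N}},\quad 0\le t\le1.$$ Let $\eta_t$, $0\le t\le 1$, be a family of independent identically distributed Gaussian random variables with $\eta_t\sim\mathcal N(0,1/2)$. Then for any $d\ge1$ and any $0\le t_1<\dots<t_d\le1$ we have the weak convergence $$\mathcal D(\xi^N_{t_1},\dots,\xi^N_{t_d})\rightharpoonup\mathcal D(\eta_0-\eta_{t_1},\dots,\eta_0-\eta_{t_d})\quad\text{as }N\to\infty.$$
   Context: The sine-process is the determinantal point process on $\mathbb R$ (a probability measure on the space of locally finite configurations of particles in $\mathbb R$) with $n$-point correlation functions $\rho_n(x_1,\dots,x_n)=\det(\mathcal K(x_i,x_j))_{1\le i,j\le n}$, where $\mathcal K(x,y)=\frac{\sin(x-y)}{\pi(x-y)}$ for $x\ne y$ and $\mathcal K(x,x)=\frac1\pi$. $\#_B$ is the number of particles of the random configuration in $B$. $\mathcal D$ denotes the distribution of a random vector. *)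

(* Defs.v *)
From HB Require Import structures.
From mathcomp Require Import all_boot all_order all_algebra finmap.
From mathcomp Require Import all_classical all_reals all_analysis.
From mathcomp Require Import measurable_realfun.

Set Implicit Arguments.
Unset Strict Implicit.
Unset Printing Implicit Defensive.

Import Order.TTheory GRing.Theory Num.Theory.
Import numFieldNormedType.Exports.

Local Open Scope classical_set_scope.
Local Open Scope ring_scope.

Section configurations.
Variable R : realType.

Definition locally_finite (X : set R) : Prop :=
  forall a b : R, finite_set (X `&` `[a, b]).

(* Particles are distinct: a configuration is a set, without multiplicities. *)
Record config := Config {
  particles : set R;
  config_locally_finite : locally_finite particles }.

Definition bounded_subset (B : set R) : Prop :=
  exists M : R, B `<=` `[- M, M].

(* fset_set sends infinite sets to the empty one, so this is the number of
   particles in B only for bounded B. *)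
Definition npart (B : set R) (X : config) : nat :=
  #|` fset_set (particles X `&` B)|.

Lemma locally_finite0 : locally_finite set0.
Proof. by move=> a b; rewrite set0I; exact: finite_set0. Qed.

HB.instance Definition _ := gen_eqMixin config.
HB.instance Definition _ := gen_choiceMixin config.
HB.instance Definition _ := isPointed.Build config (Config locally_finite0).

Definition npart_events : set (set config) :=
  [set A | exists B k, [/\ measurable B, bounded_subset B &
                           A = [set X | npart B X = k]]].

(* Locally finite configurations, with the sigma-algebra generated by the
   particle counts in bounded Borel sets. *)
Definition configs := g_sigma_algebraType npart_events.

HB.instance Definition _ := Measurable.on configs.

Definition npartR (B : set R) : configs -> R := fun X => (npart B X)%:R.

Lemma measurable_npartR (B : set R) : measurable B -> bounded_subset B ->
  measurable_fun [set: configs] (npartR B).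
Proof.
move=> mB bB _ Y mY; rewrite setTI.
have -> : npartR B @^-1` Y =
    \bigcup_(k in [set k : nat | Y k%:R]) [set X | npart B X = k].
  apply/seteqP; split => [X /= YX|X [k /= Yk Xk]]; first by exists (npart B X).
  by rewrite /npartR Xk.
apply: bigcup_measurable => k _.
by apply: sub_sigma_algebra; exists B, k.
Qed.

End configurations.

Section correlation_functions.
Variable R : realType.

(* Iterated Lebesgue integral; by Tonelli it is the integral over R^n with
   respect to n-dimensional Lebesgue measure when f is measurable and
   nonnegative. *)
Fixpoint lebesgue_integral_tuple (n : nat) :
    (n.-tuple R -> \bar R) -> \bar R :=
  match n return (n.-tuple R -> \bar R) -> \bar R with
  | 0 => fun f => f [tuple]
  | m.+1 => fun f => (\int[lebesgue_measure]_x
      lebesgue_integral_tuple (fun y : m.-tuple R => f [tuple of x :: y]))%E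
  end.

Definition distinct_tuples (X : config R) (n : nat) : set (n.-tuple R) :=
  [set x : n.-tuple R | uniq x /\ forall i, particles X (tnth x i)].

Arguments distinct_tuples : clear implicits.

Definition is_correlation_function (P : probability (configs R) R) (n : nat)
    (rho : n.-tuple R -> R) : Prop :=
  forall f : n.-tuple R -> R, measurable_fun setT f ->
    (forall x, 0 <= f x) ->
    (\int[P]_X \esum_(x in distinct_tuples X n) (f x)%:E)%E =
    lebesgue_integral_tuple (fun x => (f x * rho x)%:E).

Definition determinantal (K : R -> R -> R) (P : probability (configs R) R) :
    Prop :=
  forall n : nat, is_correlation_function P
    (fun x : n.-tuple R =>
       \det (\matrix_(i < n, j < n) K (tnth x i) (tnth x j))).

Definition sine_kernel (x y : R) : R :=
  if x == y then pi^-1 else sin (x - y) / (pi * (x - y)).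

Definition is_sine_process (P : probability (configs R) R) : Prop :=
  determinantal sine_kernel P.

End correlation_functions.

Section normalized_counts.
Variables (R : realType) (P : probability (configs R) R).

Definition xi (N t : R) (X : configs R) : R :=
  (npartR `[0, t * N] X - fine 'E_P[npartR `[0, t * N]]) /
  (pi^-1 * Num.sqrt (ln N)).

Lemma measurable_xi (N t : R) : measurable_fun setT (xi N t).
Proof.
apply: measurable_funM => //; apply: measurable_funB => //.
apply: measurable_npartR => //; exists (t * N) => x /=.
rewrite !in_itv/= => /andP[x0 xtN]; rewrite xtN andbT.
by rewrite (le_trans _ x0)// oppr_le0 (le_trans x0).
Qed.

Definition xi_vector (d : nat) (t : 'I_d -> R) (N : R) (X : configs R) :
  d.-tuple R := [tuple xi N (t i) X | i < d].

Lemma measurable_xi_vector d (t : 'I_d -> R) N :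
  measurable_fun setT (xi_vector t N).
Proof.
apply/measurable_fun_tnthP => i; rewrite (_ : _ \o _ = xi N (t i)).
  exact: measurable_xi.
by apply/funext => X /=; rewrite tnth_mktuple.
Qed.

HB.instance Definition _ d (t : 'I_d -> R) (N : R) :=
  isMeasurableFun.Build _ _ _ _ (xi_vector t N) (@measurable_xi_vector d t N).

End normalized_counts.

Section limit_vector.
Context {dT : measure_display} {T : measurableType dT} {R : realType}.
Variable Q : probability T R.

Definition mutually_independent (I : choiceType) (D : set I)
    (Y : I -> {RV Q >-> R}) : Prop :=
  forall (J : {fset I}) (A : I -> set R), [set` J] `<=` D ->
    (forall i, measurable (A i)) ->
    Q (\bigcap_(i in [set` J]) (Y i @^-1` A i)) =
    (\prod_(i <- J) Q (Y i @^-1` A i))%E.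

Definition increment_vector (eta : R -> {RV Q >-> R}) (d : nat)
    (t : 'I_d -> R) (w : T) : d.-tuple R :=
  [tuple eta 0 w - eta (t i) w | i < d].

Lemma measurable_increment_vector eta d (t : 'I_d -> R) :
  measurable_fun setT (increment_vector eta t).
Proof.
apply/measurable_fun_tnthP => i.
rewrite (_ : _ \o _ = fun w => eta 0 w - eta (t i) w).
  exact: measurable_funB.
by apply/funext => w /=; rewrite tnth_mktuple.
Qed.

HB.instance Definition _ eta d (t : 'I_d -> R) :=
  isMeasurableFun.Build _ _ _ _ (increment_vector eta t)
    (@measurable_increment_vector eta d t).

End limit_vector.

(* The Borel sets of R^d live on d.-tuple R, its topology on 'rV[R]_d. *)
Definition tuple_of_row (R : realType) (d : nat) (v : 'rV[R]_d) : d.-tuple R :=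
  [tuple v ord0 i | i < d].

(* Weak convergence of mu N to nu as N tends to +oo along the reals. *)
Definition weak_cvg (R : realType) (d : nat)
    (mu : R -> probability (d.-tuple R) R) (nu : probability (d.-tuple R) R) :
    Prop :=
  forall f : d.-tuple R -> R, continuous (f \o @tuple_of_row R d) ->
    (exists M : R, forall x, `|f x| <= M) ->
    (\int[mu N]_x (f x)%:E)%E @[N --> +oo] --> (\int[nu]_x (f x)%:E)%E.

(* Main.v *)
Require Import Defs.
From HB Require Import structures.
From mathcomp Require Import all_boot all_order all_algebra perm finmap.
From mathcomp Require Import all_classical all_reals all_analysis.
From mathcomp Require Import measurable_realfun.
From mathcomp Require Import ring lra zify.

Set Implicit Arguments.
Unset Strict Implicit.
Unset Printing Implicit Defensive.

Import Order.TTheory GRing.Theory Num.Theory.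
Import numFieldNormedType.Exports HBNNSimple.

Local Open Scope classical_set_scope.
Local Open Scope ring_scope.

(** The proof computes Laplace transforms of linear combinations of counts with
    explicit two-sided bounds, using real symmetric matrices only.

    Let [S] be the sum over [j] of [s j] times the number of particles in
    [0, n j), with integers [n j]. By the correlation functions, [E (exp (t S))]
    is a series of iterated integrals of determinants of the sine kernel; by
    Hadamard's inequality this series converges absolutely, and it is the limit
    of the determinants [det (1 + (D - 1) k)] of the kernel sampled on the grid
    of mesh [1 / q], with [D] diagonal (lemmas [grid_det_expansion] and
    [multiplicative_functional_bounds]). So bounds uniform in [q] on these
    determinants carry over to the sine process.

    The sampled kernel [k] has its spectrum in [0, 1]: its quadratic form
    increases with the parameter [h] of [sin (h (a - b)) / (pi (a - b))], from [0]
    at [h = 0] to the identity at [h = pi]. For such [k] the second derivative in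
    [t] of the logarithm of the determinant is a trace of a product of two
    positive semidefinite matrices, and the third derivative is bounded by the
    second one times [c], twice the sum of the [|s j|], whatever the size;
    integrating gives [t mean + t^2 variance / 2] up to a factor between
    [exp (- c t)] and [exp (c t)] in front of the variance
    ([log_tilt_bounds]). The variance of one count is
    [pi^-2 ln n + O(1)], uniformly in the mesh: the second derivative in [h] of
    the variance is minus a multiple of a Fejer kernel ([fejer_var_log]). Polarization
    gives the covariances, because the difference of two nested counts is again
    a count over an interval.

    With [t = 1 / (pi^-1 sqrt (ln N))] and [n j] close to [t j * N], the logarithms
    [ln (n j)] and [ln |n i - n j|] are equivalent to [ln N] unless [t j = 0],
    respectively [t i = t j]. This is where the limit covariance of the
    [eta 0 - eta (t i)] comes from ([laplace_lattice_xi], [laplace_increments]).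

    Convergence of Laplace transforms gives convergence of expectations for all
    limits of exponential sums with one exponential weight, in particular for
    trigonometric polynomials; a bounded continuous function is approximated by
    Bernstein polynomials in the variables [sin (x i / A)], up to
    [2 M |x|_1 / A], and first moments are bounded ([weak_cvg_of_laplace]).
    Rounding [t j * N] to an integer changes the normalized counts by a quantity
    of order [1 / sqrt (ln N)] in mean ([cvg_xi_lattice_error]). *)

(** * Positive semidefinite matrices and principal minors *)

Section positive_semidefinite.
Variable R : rcfType.

Definition quad n (M : 'M[R]_n) (v : 'cV[R]_n) : R := (v^T *m M *m v) 0 0.

Definition psd n (M : 'M[R]_n) : Prop :=
  M^T = M /\ forall v : 'cV[R]_n, 0 <= quad M v.

Lemma quadE n (M : 'M[R]_n) v :
  quad M v = \sum_i \sum_j v i 0 * M i j * v j 0.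
Proof.
rewrite /quad mxE exchange_big /=; apply: eq_bigr => j _.
by rewrite mxE mulr_suml; apply: eq_bigr => i _; rewrite !mxE.
Qed.

Lemma quadD n (M N : 'M[R]_n) v : quad (M + N) v = quad M v + quad N v.
Proof. by rewrite /quad mulmxDr mulmxDl mxE. Qed.

Lemma quadN n (M : 'M[R]_n) v : quad (- M) v = - quad M v.
Proof. by rewrite /quad mulmxN mulNmx mxE. Qed.

Lemma quadZ n (a : R) (M : 'M[R]_n) v : quad (a *: M) v = a * quad M v.
Proof. by rewrite /quad -scalemxAr -scalemxAl mxE. Qed.

Lemma quad_congr n m (M : 'M[R]_n) (N : 'M[R]_(n, m)) v :
  quad (N^T *m M *m N) v = quad M (N *m v).
Proof. by rewrite /quad trmx_mul !mulmxA. Qed.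

Lemma psdD n (M N : 'M[R]_n) : psd M -> psd N -> psd (M + N).
Proof.
move=> [sM pM] [sN pN]; split; first by rewrite linearD /= sM sN.
by move=> v; rewrite quadD addr_ge0.
Qed.

Lemma psd_congr n m (M : 'M[R]_n) (N : 'M[R]_(n, m)) :
  psd M -> psd (N^T *m M *m N).
Proof.
move=> [sM pM]; split; first by rewrite !trmx_mul trmxK sM mulmxA.
by move=> v; rewrite quad_congr.
Qed.

Lemma quad_block n (M : 'M[R]_(1 + n)) (x : R) (w : 'cV[R]_n) :
  M^T = M ->
  quad M (col_mx x%:M w) =
  M 0 0 * x ^+ 2 + x * ((dlsubmx M)^T *m w) 0 0 *+ 2 + quad (drsubmx M) w.
Proof.
move=> sM; rewrite /quad -{1}(submxK M) tr_col_mx mul_row_block mul_row_col.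
have ->: ursubmx M = (dlsubmx M)^T by rewrite trmx_dlsub sM.
have ->: ulsubmx M = (M 0 0)%:M.
  by apply/matrixP => i j; rewrite !ord1 !mxE lshift0.
rewrite tr_scalar_mx mulmxDl -scalar_mxM mul_scalar_mx mul_mx_scalar.
rewrite mulmxDl -mulmxA mul_scalar_mx.
have -> : (w^T *m dlsubmx M) = ((dlsubmx M)^T *m w)^T.
  by rewrite trmx_mul trmxK.
move: (dlsubmx M)^T (drsubmx M) => b B.
rewrite scale_scalar_mx.
do 3!rewrite [(_ + _ : matrix _ _ _) 0 0]mxE.
rewrite [_%:M 0 0]mxE eqxx mulr1n [(x *: (b *m w)) 0 0]mxE [(x *: trmx _) 0 0]mxE.
by rewrite [(trmx _) 0 0]mxE; ring.
Qed.

(** A vanishing pivot forces its column to vanish, so dividing by the pivot is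
    harmless with the convention 0^-1 = 0, and the usual elimination step
    applies in all cases. *)
Lemma cholesky n (M : 'M[R]_n) : psd M ->
  exists2 L : 'M[R]_n, is_trig_mx L & M = L *m L^T.
Proof.
elim: n M => [M _|n IHn].
  exists 0; last by apply/matrixP => -[].
  by apply/is_trig_mxP => -[].
rewrite -[n.+1]/(1 + n)%N => M [sM pM].
pose c := M 0 0; pose b := dlsubmx M.
have eE x (w : 'cV[R]_n) : 0 <=
    c * x ^+ 2 + x * (b^T *m w) 0 0 *+ 2 + quad (drsubmx M) w.
  by rewrite -quad_block.
have c0 : 0 <= c.
  have := eE 1 0; rewrite mulmx0 /quad mulmx0 !mxE.
  by rewrite mulr0 mul0rn !addr0 expr1n mulr1.
have b0 : c = 0 -> b = 0.
  move=> cz; apply/matrixP => j k; rewrite ord1 [RHS]mxE.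
  apply/eqP; apply: contraT => bj.
  pose B := quad (drsubmx M) (delta_mx j 0).
  have bE : (b^T *m (delta_mx j 0 : 'cV[R]_n)) 0 0 = b j 0.
    by rewrite -colE !mxE.
  have := eE (- (B + 1) / (b j 0 *+ 2)) (delta_mx j 0).
  rewrite cz mul0r add0r bE -/B.
  have -> : - (B + 1) / (b j 0 *+ 2) * b j 0 *+ 2 = - (B + 1).
    by rewrite -mulrnAr mulfVK// mulrn_eq0.
  lra.
have cV : c * c^-1 *: b = b.
  have [/eqP cz|cz] := boolP (c == 0); first by rewrite b0// scaler0.
  by rewrite mulfV// scale1r.
pose B' := drsubmx M - c^-1 *: (b *m b^T).
have [L' trigL' B'E] : exists2 L : 'M[R]_n, is_trig_mx L & B' = L *m L^T.
  apply: IHn; split.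
    rewrite /B' linearB/= linearZ/= trmx_mul trmxK; congr (_ - _).
    by rewrite trmx_drsub sM.
  move=> w; rewrite /B' quadD quadN quadZ.
  have := eE (- c^-1 * (b^T *m w) 0 0) w.
  have -> : quad (b *m b^T) w = ((b^T *m w) 0 0) ^+ 2.
    rewrite /quad mulmxA -[_ *m b^T *m w]mulmxA [w^T *m b](_ : _ = (b^T *m w)^T).
      by rewrite mxE big_ord1 mxE expr2.
    by rewrite trmx_mul trmxK.
  have [/eqP cz|cz] := boolP (c == 0).
    by rewrite cz invr0; lra.
  set y := (b^T *m w) 0 0.
  have -> : c * (- c^-1 * y) ^+ 2 = c^-1 * y ^+ 2.
    by field.
  lra.
exists (block_mx (Num.sqrt c)%:M 0 ((Num.sqrt c)^-1 *: b) L' : 'M[R]_(1 + n)).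
  by rewrite is_trig_block_mx// eqxx trigL' andbT; apply/is_trig_mxP => i j;
    rewrite !ord1.
rewrite (tr_block_mx (Num.sqrt c)%:M) mulmx_block.
rewrite trmx0 !mul0mx !mulmx0 !addr0 -B'E linearZ/= tr_scalar_mx.
rewrite -scalar_mxM -expr2 sqr_sqrtr// mul_mx_scalar mul_scalar_mx.
rewrite -scalemxAl -scalemxAr !scalerA -expr2 exprVn sqr_sqrtr//.
have sV : (Num.sqrt c * (Num.sqrt c)^-1) *: b = b.
  have [/eqP cz|cz] := boolP (c == 0); first by rewrite b0// scaler0.
  by rewrite mulfV ?scale1r// sqrtr_eq0 -ltNge lt_def cz.
rewrite -linearZ/= sV /B' addrC subrK.
rewrite -[LHS]submxK; congr block_mx.
  by apply/matrixP => i j; rewrite !ord1 !mxE lshift0.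
by rewrite trmx_dlsub sM.
Qed.

(** With [Y = L L^T] the trace is [tr (L^T X L)], and the diagonal entries of
    [L^T X L] are values of the quadratic form of [X]. *)
Lemma psd_trace_mul n (X Y : 'M[R]_n) : psd X -> psd Y -> 0 <= \tr (X *m Y).
Proof.
move=> [_ pX] /cholesky[L _ ->].
rewrite mulmxA mxtrace_mulC mulmxA; apply: sumr_ge0 => i _.
have := pX (L *m delta_mx i 0); rewrite -quad_congr quadE.
rewrite (bigD1 i)//= [X in _ + X]big1 ?addr0; last first.
  by move=> j ji; rewrite big1// => k _; rewrite !mxE (negbTE ji) !mul0r.
rewrite (bigD1 i)//= [X in _ + X]big1 ?addr0; last first.
  by move=> j ji; rewrite !mxE (negbTE ji) mulr0.
by rewrite !mxE !eqxx mul1r mulr1.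
Qed.

Lemma psd_det_ge0 n (M : 'M[R]_n) : psd M -> 0 <= \det M.
Proof.
by move=> /cholesky[L _ ->]; rewrite det_mulmx det_tr -expr2 sqr_ge0.
Qed.

(** With [M = L L^T], the determinant is the product of the squared pivots, and
    [M i i] is the squared norm of row [i] of [L], which contains the pivot. *)
Lemma hadamard n (M : 'M[R]_n) : psd M -> \det M <= \prod_i M i i.
Proof.
move=> /cholesky[L trigL ->]; rewrite det_mulmx det_tr det_trig// -big_split/=.
apply: ler_prod => i _; rewrite -expr2 sqr_ge0/= mxE (bigD1 i)//= mxE -expr2.
by rewrite lerDl sumr_ge0// => j _; rewrite mxE -expr2 sqr_ge0.
Qed.

End positive_semidefinite.

Section minors.
Variable R : comUnitRingType.

(** Sylvester's identity: eliminating either diagonal block of one block matrix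
    gives the two determinants. *)
Lemma det_1D_mulmxC n m (U : 'M[R]_(n, m)) (V : 'M[R]_(m, n)) :
  \det (1%:M + U *m V) = \det (1%:M + V *m U).
Proof.
have E1 : block_mx 1%:M (- U) V 1%:M =
   block_mx 1%:M 0 V 1%:M *m block_mx 1%:M (- U) 0 (1%:M + V *m U).
  rewrite mulmx_block !mul0mx !mulmx0 !mul1mx !mulmx1 !addr0 mulmxN.
  by rewrite addrCA addNr addr0.
have E2 : block_mx 1%:M (- U) V 1%:M =
   block_mx (1%:M + U *m V) (- U) 0 1%:M *m block_mx 1%:M 0 V 1%:M.
  rewrite mulmx_block !mul0mx !mulmx0 !mul1mx !mulmx1 !add0r mulNmx.
  by rewrite addrK.
have := congr1 determinant E1; rewrite [in LHS]E2 !det_mulmx.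
by rewrite !det_ublock !det_lblock !det1 !mulr1 !mul1r.
Qed.

(** The matrix that takes the rows in [J] from [M] and the others from the
    identity: the terms of the expansion of [\det (1 + M)] by multilinearity in
    the rows. *)
Definition rows_from N (M : 'M[R]_N) (J : {set 'I_N}) : 'M[R]_N :=
  \matrix_(i, j) (if i \in J then M i j else (i == j)%:R).

Lemma det_1D_sum N (M : 'M[R]_N) :
  \det (1%:M + M) = \sum_(J : {set 'I_N}) \det (rows_from M J).
Proof.
rewrite exchange_big /=; apply: eq_bigr => s _; rewrite -mulr_sumr; congr (_ * _).
transitivity (\prod_i (M i (fun_of_perm s i) + (i == fun_of_perm s i)%:R)).
  by apply: eq_bigr => i _; rewrite !mxE addrC.
rewrite bigA_distr; apply: eq_bigr => J _; apply: eq_bigr => i _.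
by rewrite mxE.
Qed.

(** Written as [1 + E^T (E (M - 1))], where [E] selects the rows [a], the left
    matrix has the determinant of the small matrix [1 + E (M - 1) E^T]. *)
Lemma det_rows_from N (M : 'M[R]_N) n (a : n.-tuple 'I_N) : uniq a ->
  \det (rows_from M [set x in a]) =
  \det (\matrix_(i < n, j < n) M (tnth a i) (tnth a j)).
Proof.
move=> ua.
pose E : 'M[R]_(n, N) := \matrix_(i, j) (tnth a i == j)%:R.
have EM p (A : 'M[R]_(N, p)) : E *m A = \matrix_(i, j) A (tnth a i) j.
  apply/matrixP => i j; rewrite !mxE (bigD1 (tnth a i))//= !mxE eqxx mul1r.
  by rewrite big1 ?addr0// => k /negPf ki; rewrite mxE eq_sym ki mul0r.
have -> : rows_from M [set x in a] = 1%:M + E^T *m (E *m (M - 1%:M)).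
  apply/matrixP => i j; rewrite EM !mxE inE.
  case: ifPn => [/tnthP[k ->]|ia].
    rewrite (bigD1 k)//= !mxE eqxx mul1r big1 ?addr0.
      by rewrite addrCA subrr addr0.
    move=> l lk; rewrite !mxE (inj_eq (tuple_uniqP _ ua)).
    by rewrite (negbTE lk) mul0r.
  rewrite big1 ?addr0// => k _; rewrite !mxE (_ : _ == _ = false) ?mul0r//.
  by apply: contraNF ia => /eqP <-; exact: mem_tnth.
rewrite det_1D_mulmxC; congr determinant.
rewrite EM; apply/matrixP => i j; rewrite !mxE (bigD1 (tnth a j))//= !mxE eqxx.
rewrite mulr1 big1 ?addr0.
  by rewrite (inj_eq (tuple_uniqP _ ua)) addrCA subrr addr0.
move=> k /negPf kj.
by have -> : E^T k j = 0; [rewrite !mxE eq_sym kj|rewrite mulr0].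
Qed.

Lemma det_minor_dup N (M : 'M[R]_N) n (a : n.-tuple 'I_N) : ~~ uniq a ->
  \det (\matrix_(i < n, j < n) M (tnth a i) (tnth a j)) = 0.
Proof.
move=> ua.
have [/injectiveP/tuple_uniqP ia|/injectivePn[i [j ij aij]]] :=
  boolP (injectiveb (tnth a)); first by rewrite ia in ua.
by apply: (determinant_alternate ij) => k; rewrite !mxE aij.
Qed.

End minors.

Section sums_over_tuples.
Variable R : fieldType.

Lemma sum_uniq_tuples (T : finType) n (w : {set T} -> R) :
  \sum_(a : n.-tuple T | uniq a) w [set x in a] =
  n`!%:R * \sum_(J : {set T} | #|J| == n) w J.
Proof.
rewrite (partition_big (fun a : n.-tuple T => [set x in a])
  (fun J : {set T} => #|J| == n)) /=; last first.
  by move=> a ua; rewrite cardsE (card_uniqP ua) size_tuple.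
rewrite mulr_sumr; apply: eq_bigr => J /eqP cJ.
under eq_bigr => a /andP[_ /eqP ->] do rewrite -[w J]mul1r.
rewrite -mulr_suml; congr (_ * _).
have -> : n`! = #|[set t : n.-tuple T | all (mem J) t & uniq t]|.
  by rewrite card_uniq_tuples cJ ffactnn.
rewrite sumr_const; congr (_ *+ _); apply: eq_card => a.
rewrite !inE; apply/andP/andP => -[].
  move=> ua /eqP <-; split=> //; apply/allP => x xa.
  by rewrite /= inE.
move=> /allP aJ ua; split=> //; rewrite eqEcard cardsE (card_uniqP ua).
rewrite size_tuple cJ leqnn andbT; apply/fintype.subsetP => x; rewrite inE.
exact: aJ.
Qed.

End sums_over_tuples.

(** * Derivatives of matrix-valued functions *)

Section matrix_derivative.
Variable R : realType.

(** Entrywise, so that matrix identities reduce to the scalar calculus. *)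
Definition mx_derive m n (A : R -> 'M[R]_(m, n)) (t : R) (A' : 'M[R]_(m, n)) :=
  forall i j, is_derive t (1 : R) (fun u => A u i j) (A' i j).

Lemma mx_derive_eq m n (A : R -> 'M[R]_(m, n)) t A' B' :
  mx_derive A t A' -> A' = B' -> mx_derive A t B'.
Proof. by move=> + <-. Qed.

Lemma is_derive_bigsum (I : finType) (f : I -> R -> R) (df : I -> R) (t : R) :
  (forall i, is_derive t (1 : R) (f i) (df i)) ->
  is_derive t (1 : R) (fun u => \sum_i f i u) (\sum_i df i).
Proof.
move=> H.
have -> : (fun u => \sum_i f i u) = \sum_i f i by apply/funext => u; rewrite fct_sumE.
elim/big_ind2 : _ => // [|g dg h dh]; [exact: is_derive_cst|exact: is_deriveD].
Qed.

Lemma is_derive_bigprod (I : finType) (f : I -> R -> R) (df : I -> R) (t : R) :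
  (forall i, is_derive t (1 : R) (f i) (df i)) ->
  is_derive t (1 : R) (fun u => \prod_i f i u)
    (\sum_i df i * \prod_(j | j != i) f j t).
Proof.
move=> H; have := index_enum_uniq I; elim: (index_enum I) => [_|i r IH] /=.
  rewrite big_nil (_ : (fun _ => _) = cst 1); first exact: is_derive_cst.
  by apply/funext => u; rewrite big_nil.
move=> /andP[ir ur].
have -> : (fun u => \prod_(j <- i :: r) f j u) =
    f i * (fun u => \prod_(j <- r) f j u).
  by apply/funext => u; rewrite big_cons.
apply: is_derive_eq (is_deriveM (H i) (IH ur)) _.
rewrite big_cons addrC; congr (_ + _).
  rewrite mulrC big_cons eqxx /=; congr (_ * _).
  rewrite big_seq [RHS]big_seq_cond; apply: eq_bigl => j.
  by case: (boolP (j \in r)) => //= jr; apply/esym; apply: contraNneq ir => <-.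
rewrite -[LHS]/(_ * _) mulr_sumr big_seq [RHS]big_seq; apply: eq_bigr => j jr.
have ij : i != j by apply: contraNneq ir => ->.
by rewrite big_cons ij mulrCA.
Qed.

Lemma mx_derive_cst m n (A : 'M[R]_(m, n)) t : mx_derive (fun=> A) t 0.
Proof. by move=> i j; rewrite mxE; exact: is_derive_cst. Qed.

Lemma mx_deriveD m n (A B : R -> 'M[R]_(m, n)) t A' B' :
  mx_derive A t A' -> mx_derive B t B' ->
  mx_derive (fun u => A u + B u) t (A' + B').
Proof.
move=> dA dB i j; rewrite mxE.
have -> : (fun u => (A u + B u) i j) = (fun u => A u i j) + (fun u => B u i j).
  by apply/funext => u; rewrite mxE.
exact: is_deriveD.
Qed.

Lemma mx_deriveM m n p (A : R -> 'M[R]_(m, n)) (B : R -> 'M[R]_(n, p)) t A' B' :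
  mx_derive A t A' -> mx_derive B t B' ->
  mx_derive (fun u => A u *m B u) t (A' *m B t + A t *m B').
Proof.
move=> dA dB i j; rewrite !mxE -big_split/=.
have -> : (fun u => (A u *m B u) i j) = (fun u => \sum_k A u i k * B u k j).
  by apply/funext => u; rewrite mxE.
apply: is_derive_bigsum => k.
have -> : (fun u => A u i k * B u k j) = (fun u => A u i k) * (fun u => B u k j).
  by [].
apply: is_derive_eq (is_deriveM (dA i k) (dB k j)) _.
by rewrite addrC; congr (_ + _); rewrite -[LHS]/(_ * _) mulrC.
Qed.

Lemma is_derive_trace n (A : R -> 'M[R]_n) t A' :
  mx_derive A t A' -> is_derive t (1 : R) (fun u => \tr (A u)) (\tr A').
Proof. by move=> dA; apply: is_derive_bigsum => i; exact: dA. Qed.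

(** Jacobi's formula: differentiating one row at a time gives determinants with
    one row replaced, which expand along that row into cofactors. *)
Lemma is_derive_det n (A : R -> 'M[R]_n) t A' :
  mx_derive A t A' ->
  is_derive t (1 : R) (fun u => \det (A u)) (\tr (\adj (A t) *m A')).
Proof.
move=> dA.
have -> : \tr (\adj (A t) *m A') = \sum_(s : 'S_n)
    (-1) ^+ s * \sum_i A' i (s i) * \prod_(j | j != i) A t j (s j).
  rewrite mxtrace_mulC.
  transitivity (\sum_i \det (\matrix_(j, k) if j == i then A' j k else A t j k)).
    apply: eq_bigr => i _; rewrite mxE (expand_det_row _ i).
    apply: eq_bigr => j _; rewrite !mxE eqxx; congr (_ * (_ * \det _)).
    by apply/matrixP => k l; rewrite !mxE eq_sym (negbTE (neq_lift _ _)).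
  rewrite exchange_big/=; apply: eq_bigr => s _; rewrite -mulr_sumr.
  congr (_ * _); apply: eq_bigr => i _; rewrite (bigD1 i)//= mxE eqxx.
  by congr (_ * _); apply: eq_bigr => j /negbTE ji; rewrite mxE ji.
apply: is_derive_bigsum => s.
have -> : (fun u => (-1) ^+ s * \prod_i A u i (s i)) =
   ((-1) ^+ s : R) \*: (fun u => \prod_i A u i (s i)) by [].
apply: is_deriveZ; apply: (@is_derive_bigprod _ (fun i u => A u i (s i))) => i.
exact: dA.
Qed.

(** Only differentiability matters here: once the inverse is known to be
    differentiable, its derivative is read off from [A^-1 A = 1]. *)
Lemma mx_derive_adj n (A : R -> 'M[R]_n) t A' :
  mx_derive A t A' -> exists B, mx_derive (fun u => \adj (A u)) t B.
Proof.
move=> dA.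
exists (\matrix_(i, j) ((-1) ^+ (j + i) *
   \tr (\adj (row' j (col' i (A t))) *m row' j (col' i A')))) => i j.
rewrite mxE.
have -> : (fun u => (\adj (A u)) i j) =
   ((-1) ^+ (j + i) : R) \*: (fun u => \det (row' j (col' i (A u)))).
  by apply/funext => u; rewrite mxE.
apply: is_deriveZ; apply: is_derive_det => k l; rewrite !mxE.
have -> : (fun u => row' j (col' i (A u)) k l) = fun u => A u (lift j k) (lift i l).
  by apply/funext => u; rewrite !mxE.
exact: dA.
Qed.

Lemma mx_derive_inv n (A : R -> 'M[R]_n) t A' :
  (forall u, A u \in unitmx) -> mx_derive A t A' ->
  mx_derive (fun u => invmx (A u)) t (- (invmx (A t) *m A' *m invmx (A t))).
Proof.
move=> uA dA; have [B dB] := mx_derive_adj dA.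
have [C dC] : exists C, mx_derive (fun u => invmx (A u)) t C.
  exists (\matrix_(i, j) ((\det (A t))^-1 *: B i j + (\adj (A t)) i j *:
    (- (\det (A t)) ^- 2 *: \tr (\adj (A t) *m A')))) => i j.
  have -> : (fun u => invmx (A u) i j) =
      (fun u => (\det (A u))^-1) * (fun u => (\adj (A u)) i j).
    by apply/funext => u; rewrite /invmx uA mxE.
  rewrite mxE; apply: is_deriveM.
    have d0 : \det (A t) != 0 by have := uA t; rewrite unitmxE unitfE.
    have [dd <-] := is_derive_det dA; apply: DeriveDef; first exact: derivableV.
    exact: deriveV.
  exact: dB.
apply: (mx_derive_eq dC).
have H := mx_deriveM dA dC.
have : A' *m invmx (A t) + A t *m C = 0.
  apply/matrixP => i j.
  have [_ <-] := H i j.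
  have -> : (fun u => (A u *m invmx (A u)) i j) = cst ((1%:M : 'M[R]_n) i j).
    by apply/funext => u; rewrite mulmxV.
  by rewrite derive_cst mxE.
move=> /eqP; rewrite addrC addr_eq0 => /eqP E.
by rewrite -mulmxA -mulmxN -E mulmxA mulVmx// mul1mx.
Qed.

End matrix_derivative.

(** * Calculus of one variable *)

Section calculus.
Variable R : realType.
Implicit Types (f g : R -> R).

(** Stated for explicit abstractions, with the factors in this order, so that
    derivatives of concrete expressions can be assembled by application. *)
Lemma is_derive_mul f g (x a b : R) :
  is_derive x (1 : R) f a -> is_derive x (1 : R) g b ->
  is_derive x (1 : R) (fun u => f u * g u) (a * g x + f x * b).
Proof.
move=> df dg; apply: (is_derive_eq (is_deriveM df dg)).
by rewrite addrC -[_ *: a]/(_ * a) mulrC.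
Qed.

Lemma is_derive_expR_mul (x c : R) :
  is_derive x (1 : R) (fun u => expR (u * c)) (c * expR (x * c)).
Proof.
have dl : is_derive x (1 : R) (fun u => u * c) c.
  by apply: (is_derive_eq (is_derive_mul (is_derive_id x 1) (is_derive_cst c x 1)));
    rewrite mulr0 addr0 mul1r.
have := @is_derive1_comp R expR (fun u => u * c) x _ _ (is_derive_expR (x * c)) dl.
by rewrite [_ * c in X in X -> _]mulrC.
Qed.

Lemma is_derive_continuous f (df : R -> R) :
  (forall x, is_derive x (1 : R) f (df x)) -> continuous f.
Proof.
move=> dfx x; apply/differentiable_continuous/derivable1_diffP.
by have [] := dfx x.
Qed.

Lemma mean_value f (df : R -> R) (a b : R) :
  (forall x, is_derive x (1 : R) f (df x)) -> a <= b ->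
  exists2 c, a <= c <= b & f b - f a = df c * (b - a).
Proof.
move=> dfx ab; have [|c] := @MVT_segment R f df a b ab (fun x _ => dfx x).
  by apply: continuous_subspaceT; exact: is_derive_continuous dfx.
by rewrite in_itv/=; exists c.
Qed.

Lemma le_of_derive_ge0 f (df : R -> R) (a b : R) :
  (forall x, is_derive x (1 : R) f (df x)) ->
  (forall x, a <= x <= b -> 0 <= df x) -> a <= b -> f a <= f b.
Proof.
move=> dfx df0 ab; have [c cab] := mean_value dfx ab.
by rewrite -subr_ge0 => ->; rewrite mulr_ge0 ?subr_ge0// df0.
Qed.

(** The differential inequality makes [expR (- b * t) * H t] nonincreasing and
    [expR (b * t) * H t] nondecreasing; integrate twice. *)
Lemma second_order_bounds (F G H J : R -> R) (b t : R) :
  (forall x, is_derive x (1 : R) F (G x)) ->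
  (forall x, is_derive x (1 : R) G (H x)) ->
  (forall x, is_derive x (1 : R) H (J x)) ->
  (forall x, `|J x| <= b * H x) -> 0 <= b -> 0 <= H 0 -> 0 <= t ->
  t * G 0 + expR (- (b * t)) * H 0 * t ^+ 2 / 2 <= F t - F 0 <=
  t * G 0 + expR (b * t) * H 0 * t ^+ 2 / 2.
Proof.
move=> dF dG dH JH b0 H0 t0.
have dE c x : is_derive x (1 : R) (fun u => expR (u * c) * H u)
    (expR (x * c) * (c * H x + J x)).
  apply: (is_derive_eq (is_derive_mul (is_derive_expR_mul x c) (dH x))).
  by ring.
have Hup x : 0 <= x <= t -> H x <= expR (b * t) * H 0.
  move=> /andP[x0 xt].
  have : - (expR (0 * - b) * H 0) <= - (expR (x * - b) * H x).
    apply: (le_of_derive_ge0 (fun y => is_deriveN (dE (- b) y))) => // y _.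
    have := JH y; rewrite ler_norml oppr_ge0 => /andP[_ Jy].
    by rewrite pmulr_rle0 ?expR_gt0//; lra.
  rewrite lerN2 mul0r expR0 mul1r mulrN expRN mulrC ler_pdivrMr ?expR_gt0//.
  move=> /le_trans; apply; rewrite mulrC ler_wpM2r//.
  by rewrite ler_expR mulrC ler_wpM2l.
have Hlo x : 0 <= x <= t -> expR (- (b * t)) * H 0 <= H x.
  move=> /andP[x0 xt].
  have : (expR (0 * b) * H 0) <= (expR (x * b) * H x).
    apply: (le_of_derive_ge0 (fun y => (dE b y))) => // y _.
    have := JH y; rewrite ler_norml => /andP[Jy _].
    by rewrite pmulr_rge0 ?expR_gt0//; lra.
  rewrite mul0r expR0 mul1r => H0x.
  rewrite expRN mulrC ler_pdivrMr ?expR_gt0//.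
  apply: (le_trans H0x); rewrite mulrC ler_wpM2l//; last first.
    by rewrite ler_expR mulrC ler_wpM2l.
  rewrite -(pmulr_rge0 _ (expR_gt0 (x * b))); exact: le_trans H0x.
(* integrating a bound on H twice *)
have dq c a x : is_derive x (1 : R) (fun u => u * a + c * u ^+ 2 / 2) (a + c * x).
  have E : (fun u => u * a + c * u ^+ 2 / 2 : R) =
      (fun u => u * a) + (fun u => u * (c * u / 2)).
    by apply/funext => u; rewrite /= expr2 [in RHS]/GRing.add /=; ring.
  rewrite E.
  have d1 y : is_derive x (1 : R) (fun u => u * y) y.
    by apply: (is_derive_eq (is_derive_mul (is_derive_id x 1) (is_derive_cst y x 1)));
      rewrite mulr0 addr0 mul1r.
  have d2 : is_derive x (1 : R) (fun u => c * u / 2) (c / 2).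
    have -> : (fun u => c * u / 2) = (fun u => u * (c / 2)).
      by apply/funext => u; ring.
    exact: d1.
  apply: (is_derive_eq (is_deriveD (d1 a) (is_derive_mul (is_derive_id x 1) d2))).
  by field.
have dl c a x : is_derive x (1 : R) (fun u => a + c * u) c.
  have -> : (fun u : R => a + c * u) = cst a + (fun u => u * c).
    by apply/funext => u; rewrite [in RHS]/GRing.add /= mulrC.
  apply: (is_derive_eq (is_deriveD (is_derive_cst a x 1)
    (is_derive_mul (is_derive_id x 1) (is_derive_cst c x 1)))).
  by rewrite mulr0 addr0 mul1r add0r.
have G1 c x : 0 <= x <= t -> (forall y, 0 <= y <= t -> H y <= c) ->
    G x <= G 0 + c * x.
  move=> /andP[x0 xt] Hc.
  have : G 0 + c * 0 - G 0 <= G 0 + c * x - G x.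
    apply: (le_of_derive_ge0 (fun y => is_deriveB (dl c (G 0) y) (dG y))) => //.
    by move=> y /andP[y0 yx]; rewrite subr_ge0 Hc// y0 (le_trans yx).
  by rewrite mulr0; lra.
have G2 c x : 0 <= x <= t -> (forall y, 0 <= y <= t -> c <= H y) ->
    G 0 + c * x <= G x.
  move=> /andP[x0 xt] Hc.
  have : G 0 - (G 0 + c * 0) <= G x - (G 0 + c * x).
    apply: (le_of_derive_ge0 (fun y => is_deriveB (dG y) (dl c (G 0) y))) => //.
    by move=> y /andP[y0 yx]; rewrite subr_ge0 Hc// y0 (le_trans yx).
  by rewrite mulr0; lra.
apply/andP; split.
  set c := expR _ * H 0.
  have : F 0 - (0 * G 0 + c * 0 ^+ 2 / 2) <= F t - (t * G 0 + c * t ^+ 2 / 2).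
    apply: (le_of_derive_ge0 (fun y => is_deriveB (dF y) (dq c (G 0) y))) => //.
    by move=> y yt; rewrite subr_ge0 G2.
  by rewrite expr0n/= mul0r mulr0 mul0r; lra.
set c := expR _ * H 0.
have : (0 * G 0 + c * 0 ^+ 2 / 2) - F 0 <= (t * G 0 + c * t ^+ 2 / 2) - F t.
  apply: (le_of_derive_ge0 (fun y => is_deriveB (dq c (G 0) y) (dF y))) => //.
  by move=> y yt; rewrite subr_ge0 G1.
by rewrite expr0n/= mul0r mulr0 mul0r; lra.
Qed.

End calculus.

(** * Cumulant inequalities for kernels with spectrum in [0, 1] *)

Section contractions.
Variable R : rcfType.

Lemma psd_diag n (d : 'rV[R]_n) : (forall i, 0 <= d 0 i) -> psd (diag_mx d).
Proof.
move=> d0; split; first by rewrite tr_diag_mx.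
move=> v; rewrite quadE sumr_ge0// => i _; rewrite (bigD1 i)//= big1 ?addr0.
  by rewrite !mxE eqxx mulr1n mulrAC -expr2 mulr_ge0// sqr_ge0.
by move=> j /negbTE ij; rewrite !mxE eq_sym ij mulr0n mulr0 mul0r.
Qed.

(** psd k and psd (1 - k): the symmetric matrices with spectrum in [0, 1] *)
Definition psd_le1 n (k : 'M[R]_n) := psd k /\ psd (1%:M - k).

(** [k - k^2 = (1 - k) k (1 - k) + k (1 - k) k]. *)
Lemma psd_le1_sub_sqr n (k : 'M[R]_n) :
  psd_le1 k -> psd (k - k *m k).
Proof.
move=> [pk pk1]; have [sk _] := pk; have [sk1 _] := pk1.
have -> : k - k *m k =
    (1%:M - k)^T *m k *m (1%:M - k) + k^T *m (1%:M - k) *m k.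
  rewrite sk1 sk !(mulmxBl, mulmxBr, mul1mx, mulmx1).
  move: (k *m k *m k) (k *m k) => k3 k2.
  by apply/matrixP => i j; rewrite !mxE; ring.
by apply: psdD; exact: psd_congr.
Qed.

Lemma psd_le1C n (k : 'M[R]_n) : psd_le1 k -> psd_le1 (1%:M - k).
Proof. by move=> [pk pk1]; split=> //; rewrite opprB addrC subrK. Qed.

Section cumulant_bounds.
Variables (n : nat) (k : 'M[R]_n) (phi : 'rV[R]_n) (B : R).
Hypotheses (ck : psd_le1 k) (phiB : forall i, `|phi 0 i| <= B) (B0 : 0 <= B).
Let f := diag_mx phi.
Let q := 1%:M - k.

Let sf : f^T = f. Proof. exact: tr_diag_mx. Qed.

(** [B h + e h f h = B (h - h^2) + h (B + e f) h] for [|e| <= 1], a sum of two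
    positive semidefinite matrices. *)
Let psd_sandwich (h : 'M[R]_n) : psd_le1 h ->
  psd (B *: h - h *m f *m h) /\ psd (B *: h + h *m f *m h).
Proof.
move=> ch; have [[sh _] _] := ch.
have pB : psd (B *: (h - h *m h)).
  have [s p] := psd_le1_sub_sqr ch; split; first by rewrite linearZ/= s.
  by move=> v; rewrite quadZ mulr_ge0.
have pd (e : R) : `|e| <= 1 -> psd (diag_mx (const_mx B + e *: phi)).
  move=> e1; apply: psd_diag => i; rewrite !mxE.
  have : `|e * phi 0 i| <= B.
    by rewrite normrM (le_trans _ (phiB i))// ler_piMl.
  by rewrite ler_norml => /andP[]; lra.
have pe e : `|e| <= 1 -> psd (B *: h + e *: (h *m f *m h)).
  move=> e1.
  have -> : B *: h + e *: (h *m f *m h) =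
      B *: (h - h *m h) + h^T *m diag_mx (const_mx B + e *: phi) *m h.
    have -> : diag_mx (const_mx B + e *: phi) = B%:M + e *: f.
      by apply/matrixP => i j; rewrite !mxE mulrnDl mulrnAr.
    rewrite sh mulmxDr mulmxDl mul_mx_scalar -scalemxAr -!scalemxAl.
    by rewrite scalerBr addrA subrK.
  by apply: psdD => //; apply: psd_congr; exact: pd.
split; last by have := pe 1; rewrite normr1 lexx scale1r; exact.
by have := pe (-1); rewrite normrN normr1 lexx scaleN1r; exact.
Qed.

Lemma second_cumulant_ge0 : 0 <= \tr (f *m k *m f *m q).
Proof.
have [pk pq] := ck; apply: psd_trace_mul => //.
by rewrite -{1}sf; exact: psd_congr.
Qed.

(** By cyclicity the two traces pair [f k f] with [q f q] and [f q f] with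
    [k f k]; replacing the second factors by [B q] and [B k] gives twice
    [B \tr (f k f q)]. *)
Lemma third_cumulant_le :
  `|\tr (f *m q *m f *m k *m f *m q) - \tr (f *m k *m f *m k *m f *m q)| <=
  2 * B * \tr (f *m k *m f *m q).
Proof.
have [pk pq] := ck.
have pfk : psd (f *m k *m f) by rewrite -{1}sf; exact: psd_congr.
have pfq : psd (f *m q *m f) by rewrite -{1}sf; exact: psd_congr.
have [kB1 kB2] := psd_sandwich ck.
have [qB1 qB2] := psd_sandwich (psd_le1C ck).
have E1 : \tr (f *m q *m f *m k *m f *m q) =
    \tr ((f *m k *m f) *m (q *m f *m q)).
  by rewrite -!mulmxA mxtrace_mulC -!mulmxA mxtrace_mulC -!mulmxA
    mxtrace_mulC -!mulmxA.
have E2 : \tr (f *m k *m f *m k *m f *m q) =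
    \tr ((f *m q *m f) *m (k *m f *m k)).
  rewrite -!mulmxA mxtrace_mulC -!mulmxA mxtrace_mulC -!mulmxA.
  by rewrite mxtrace_mulC -!mulmxA mxtrace_mulC -!mulmxA.
have E3 : \tr (f *m k *m f *m q) = \tr ((f *m q *m f) *m k).
  by rewrite -!mulmxA mxtrace_mulC -!mulmxA mxtrace_mulC -!mulmxA.
have := psd_trace_mul pfk qB1; have := psd_trace_mul pfk qB2.
have := psd_trace_mul pfq kB1; have := psd_trace_mul pfq kB2.
have trB (X h M : 'M[R]_n) :
    \tr (X *m (B *: h - M)) = B * \tr (X *m h) - \tr (X *m M).
  by rewrite mulmxBr -scalemxAr mxtraceD mxtraceZ raddfN.
have trD (X h M : 'M[R]_n) :
    \tr (X *m (B *: h + M)) = B * \tr (X *m h) + \tr (X *m M).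
  by rewrite mulmxDr -scalemxAr mxtraceD mxtraceZ.
rewrite !trB !trD -/q -E1 -E2 -E3; set x := \tr _; set y := \tr _; set z := \tr _.
by rewrite ler_norml => h1 h2 h3 h4; apply/andP; split; lra.
Qed.

End cumulant_bounds.
End contractions.

(** * Logarithmic Laplace transform of a determinantal process on a finite set *)

Section tilting.
Variables (R : realType) (n : nat) (k : 'M[R]_n) (phi : 'rV[R]_n).
Hypothesis ck : psd_le1 k.
Let f := diag_mx phi.

Let sk : k^T = k. Proof. by have [[]] := ck. Qed.

Definition exp_diag (t : R) : 'M[R]_n := diag_mx (\row_i expR (t * phi 0 i)).

(** For a determinantal process on a finite set with kernel [k], the determinant
    of [tilt_mx t] is the Laplace transform at [t] of the sum of [phi] over the
    particles. *)
Definition tilt_mx (t : R) : 'M[R]_n := 1%:M + (exp_diag t - 1%:M) *m k.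

Lemma exp_diagD s t : exp_diag (s + t) = exp_diag s *m exp_diag t.
Proof.
rewrite mulmx_diag; congr diag_mx; apply/rowP => i.
by rewrite !mxE mulrDl expRD.
Qed.

Lemma exp_diag0 : exp_diag 0 = 1%:M.
Proof.
by rewrite -diag_const_mx; congr diag_mx; apply/rowP => i; rewrite !mxE mul0r expR0.
Qed.

Lemma exp_diagNK t : exp_diag (- t) *m exp_diag t = 1%:M.
Proof. by rewrite -exp_diagD addNr exp_diag0. Qed.

Lemma exp_diagC t : f *m exp_diag t = exp_diag t *m f.
Proof. exact: diag_mxC. Qed.

Lemma psd_exp_diag t : psd (exp_diag t).
Proof. by apply: psd_diag => i; rewrite mxE expR_ge0. Qed.

Lemma tr_exp_diag t : (exp_diag t)^T = exp_diag t.
Proof. exact: tr_diag_mx. Qed.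

Lemma tilt_mxE t : tilt_mx t = (1%:M - k) + exp_diag t *m k.
Proof. by rewrite /tilt_mx mulmxBl mul1mx addrA addrAC. Qed.

Lemma tr_tilt_mx t : (tilt_mx t)^T = (1%:M - k) + k *m exp_diag t.
Proof. by rewrite tilt_mxE linearD/= linearB/= trmx1 trmx_mul tr_exp_diag sk. Qed.

(** For [w] in the kernel and [y = k w], the form of [k - k^2] at [w] equals
    minus the form of [exp_diag t] at [y]; signs force [y = 0], then [w = 0]. *)
Lemma tilt_mx_unit t : tilt_mx t \in unitmx.
Proof.
rewrite unitmxE unitfE -det_tr; apply/negP => /det0P[v v0 vA].
pose w := v^T; pose y := k *m w; pose D := exp_diag t.
have wA : (1%:M - k) *m w = - (D *m y).
  have : (tilt_mx t) *m w = 0 by rewrite -[LHS]trmxK trmx_mul trmxK vA trmx0.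
  by rewrite tilt_mxE mulmxDl => /eqP; rewrite addr_eq0 -mulmxA => /eqP.
have y0 : quad D y <= 0.
  have [_ /(_ w)] := psd_le1_sub_sqr ck.
  have -> : k - k *m k = k *m (1%:M - k) by rewrite mulmxBr mulmx1.
  rewrite /quad -!mulmxA wA !mulmxN mulmxA.
  have -> : w^T *m k = y^T by rewrite trmx_mul sk.
  by rewrite mxE oppr_ge0 mulmxA.
have {}y0 : y = 0.
  apply/matrixP => i j; rewrite ord1 [RHS]mxE.
  have qE : quad D y = \sum_i expR (t * phi 0 i) * (y i 0) ^+ 2.
    have DE a b : D a b = expR (t * phi 0 a) *+ (a == b) by rewrite !mxE.
    rewrite quadE; apply: eq_bigr => a _; rewrite (bigD1 a)//= big1 ?addr0.
      by rewrite DE eqxx mulr1n; ring.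
    by move=> b /negbTE ab; rewrite DE eq_sym ab mulr0n mulr0 mul0r.
  have ge0 a : 0 <= expR (t * phi 0 a) * (y a 0) ^+ 2.
    by rewrite mulr_ge0 ?expR_ge0 ?sqr_ge0.
  have : expR (t * phi 0 i) * (y i 0) ^+ 2 <= 0.
    apply: le_trans y0; rewrite qE (bigD1 i)//= lerDl sumr_ge0//.
  by rewrite pmulr_rle0 ?expR_gt0// => h; apply/eqP; rewrite -sqrf_eq0 eq_le h sqr_ge0.
move: wA; rewrite y0 mulmx0 oppr0 mulmxBl mul1mx -/y y0 subr0 => w0.
by move: v0; rewrite -[v]trmxK -/w w0 trmx0 eqxx.
Qed.

(** The kernel of the determinantal process reweighted by the exponential of [t]
    times the sum of [phi]. *)
Definition tilt_kernel (t : R) : 'M[R]_n := exp_diag t *m k *m invmx (tilt_mx t).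

(** The conjugate of [tilt_kernel] that is symmetric: positivity arguments apply
    to it, while traces of words are the same for both. *)
Definition sym_kernel (t : R) : 'M[R]_n :=
  exp_diag (t / 2) *m (k *m invmx (tilt_mx t)) *m exp_diag (t / 2).

Lemma tilt_kernelE t :
  tilt_kernel t = exp_diag (t / 2) *m sym_kernel t *m exp_diag (- (t / 2)).
Proof.
have E : exp_diag t = exp_diag (t / 2) *m exp_diag (t / 2).
  by rewrite -exp_diagD; congr exp_diag; field.
rewrite /tilt_kernel /sym_kernel E -!mulmxA -exp_diagD subrr exp_diag0.
by rewrite mulmx1.
Qed.

Lemma psd_le1_sym_kernel t : psd_le1 (sym_kernel t).
Proof.
pose A := tilt_mx t; pose Ai := invmx A; pose D := exp_diag t.
pose Di := exp_diag (- t).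
have AAi : A *m Ai = 1%:M by rewrite mulmxV// tilt_mx_unit.
have AiA : Ai^T *m A^T = 1%:M by rewrite -trmx_mul AAi trmx1.
have DiD : Di *m D = 1%:M by exact: exp_diagNK.
have DDi : D *m Di = 1%:M by rewrite -exp_diagD subrr exp_diag0.
have pkk := psd_le1_sub_sqr ck.
have pos : psd (k *m Ai).
  have -> : k *m Ai = Ai^T *m ((k - k *m k) + k^T *m D *m k) *m Ai.
    have -> : (k - k *m k) + k^T *m D *m k = A^T *m k.
      rewrite tr_tilt_mx sk !mulmxDl -/D mulNmx mul1mx.
      by [].
    by rewrite mulmxA AiA mul1mx.
  by apply: psd_congr; apply: psdD => //; apply: psd_congr; exact: psd_exp_diag.
have posC : psd (Di - k *m Ai).
  have -> : Di - k *m Ai =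
      Ai^T *m ((1%:M - k)^T *m Di *m (1%:M - k) + (k - k *m k)) *m Ai.
    have -> : (1%:M - k)^T *m Di *m (1%:M - k) + (k - k *m k) =
        A^T *m (Di *m A - k).
      have -> : Di *m A - k = Di *m (1%:M - k).
        by rewrite /A tilt_mxE mulmxDr mulmxA DiD mul1mx addrK.
      rewrite mulmxA tr_tilt_mx -/D [in RHS]mulmxDl -[k *m D *m Di]mulmxA DDi.
      rewrite mulmx1 [in RHS]mulmxDl; congr (_ + _).
        by have [_ [-> _]] := ck.
      by rewrite mulmxBr mulmx1.
    by rewrite mulmxA AiA mul1mx mulmxBl -mulmxA AAi mulmx1.
  apply: psd_congr; apply: psdD => //.
  by apply: psd_congr; exact: psd_exp_diag.
split; rewrite /sym_kernel -/Ai -{1}[exp_diag (t / 2)]tr_exp_diag.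
  exact: psd_congr.
have -> : 1%:M - (exp_diag (t / 2))^T *m (k *m Ai) *m exp_diag (t / 2) =
    (exp_diag (t / 2))^T *m (Di - k *m Ai) *m exp_diag (t / 2).
  rewrite mulmxBr mulmxBl tr_exp_diag; congr (_ - _).
  by rewrite -!exp_diagD -exp_diag0; congr exp_diag; field.
exact: psd_congr.
Qed.

Lemma mx_derive_exp_diag t : mx_derive exp_diag t (f *m exp_diag t).
Proof.
move=> i j; rewrite mul_diag_mx !mxE.
have [->|/negbTE ij] := eqVneq i j.
  rewrite mulr1n (_ : (fun u => _) = fun u => expR (u * phi 0 j)).
    exact: is_derive_expR_mul.
  by apply/funext => u; rewrite !mxE eqxx mulr1n.
rewrite mulr0n mulr0 (_ : (fun u => _) = cst 0); first exact: is_derive_cst.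
by apply/funext => u; rewrite !mxE ij mulr0n.
Qed.

Lemma mx_derive_tilt_mx t : mx_derive tilt_mx t (f *m exp_diag t *m k).
Proof.
have := mx_deriveD (mx_derive_cst 1%:M t) (mx_deriveM (mx_deriveD
  (mx_derive_exp_diag t) (mx_derive_cst (- 1%:M) t)) (mx_derive_cst k t)).
by rewrite add0r mulmx0 !addr0.
Qed.

(** This Riccati equation is closed, so every derivative of the logarithm of the
    determinant is a combination of traces of words in [f] and the kernel. *)
Lemma mx_derive_tilt_kernel t :
  mx_derive tilt_kernel t (f *m tilt_kernel t - tilt_kernel t *m f *m tilt_kernel t).
Proof.
have := mx_deriveM (mx_deriveM (mx_derive_exp_diag t) (mx_derive_cst k t))
  (mx_derive_inv tilt_mx_unit (mx_derive_tilt_mx t)).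
by move=> /mx_derive_eq; apply; rewrite mulmx0 addr0 mulmxN /tilt_kernel !mulmxA.
Qed.

Lemma tilt_det_gt0 t : 0 < \det (tilt_mx t).
Proof.
have ne0 u : \det (tilt_mx u) != 0.
  by have := tilt_mx_unit u; rewrite unitmxE unitfE.
have det0 : \det (tilt_mx 0) = 1.
  by rewrite /tilt_mx exp_diag0 subrr mul0mx addr0 det1.
have ct : continuous (fun u => \det (tilt_mx u)).
  exact: (is_derive_continuous (fun u => is_derive_det (mx_derive_tilt_mx u))).
rewrite lt_def ne0 /= leNgt; apply/negP => neg.
have [t0|t0] := leP 0 t.
  have [||c _ /eqP] := @IVT R (fun u => \det (tilt_mx u)) 0 t 0 t0.
  - exact: continuous_subspaceT.
  - by rewrite det0 ge_min le_max ler01 (ltW neg) orbT.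
  - by rewrite (negbTE (ne0 c)).
have [||c _ /eqP] := @IVT R (fun u => \det (tilt_mx u)) t 0 0 (ltW t0).
- exact: continuous_subspaceT.
- by rewrite det0 ge_min le_max ler01 (ltW neg) orbT.
- by rewrite (negbTE (ne0 c)).
Qed.

Definition log_tilt (t : R) : R := ln (\det (tilt_mx t)).
Definition cumulant1 (t : R) : R := \tr (f *m tilt_kernel t).
Definition cumulant2 (t : R) : R :=
  \tr (f *m (f *m tilt_kernel t)) -
  \tr (f *m (tilt_kernel t *m (f *m tilt_kernel t))).
Definition cumulant3 (t : R) : R := let K := tilt_kernel t in
  \tr (f *m (f *m (f *m K))) - 3 * \tr (f *m (f *m (K *m (f *m K)))) +
  2 * \tr (f *m (K *m (f *m (K *m (f *m K))))).

Lemma is_derive_log_tilt t : is_derive t (1 : R) log_tilt (cumulant1 t).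
Proof.
have dd := is_derive_det (mx_derive_tilt_mx t).
have := @is_derive1_comp R (@ln R) (fun u => \det (tilt_mx u)) t _ _
  (is_derive1_ln (tilt_det_gt0 t)) dd.
rewrite (_ : _ * _ = cumulant1 t)//.
rewrite -mxtraceZ scalemxAl /cumulant1 /tilt_kernel.
have -> : (\det (tilt_mx t))^-1 *: \adj (tilt_mx t) = invmx (tilt_mx t).
  by rewrite /invmx tilt_mx_unit.
by rewrite mxtrace_mulC !mulmxA.
Qed.

Let trN (X : 'M[R]_n) : \tr (- X) = - \tr X.
Proof. by rewrite raddfN. Qed.

Let trB (X Y : 'M[R]_n) : \tr (X - Y) = \tr X - \tr Y.
Proof. by rewrite mxtraceD trN. Qed.

Let mx_derive_fM (A : R -> 'M[R]_n) t A' :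
  mx_derive A t A' -> mx_derive (fun u => f *m A u) t (f *m A').
Proof.
move=> dA; have := mx_deriveM (mx_derive_cst f t) dA.
by rewrite mul0mx add0r.
Qed.

Lemma is_derive_cumulant1 t : is_derive t (1 : R) cumulant1 (cumulant2 t).
Proof.
have := is_derive_trace (mx_derive_fM (mx_derive_tilt_kernel t)).
by rewrite mulmxBr trB -(mulmxA (tilt_kernel t) f (tilt_kernel t)).
Qed.

Lemma is_derive_cumulant2 t : is_derive t (1 : R) cumulant2 (cumulant3 t).
Proof.
have dK := mx_derive_tilt_kernel t.
have d1 := is_derive_trace (mx_derive_fM (mx_derive_fM dK)).
have d2 := is_derive_trace (mx_derive_fM (mx_deriveM dK (mx_derive_fM dK))).
apply: (is_derive_eq (is_deriveB d1 d2)).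
rewrite /cumulant3; move: (tilt_kernel t) => K.
rewrite !mulmxBr mulmxBl mulmxDr !mulmxBr !mxtraceD -!mulmxA !trN.
have -> : \tr (f *m (K *m (f *m (f *m K)))) = \tr (f *m (f *m (K *m (f *m K)))).
  by move: f => F; rewrite (mulmxA F K) mxtrace_mulC -!mulmxA.
by ring.
Qed.

Let trace_conj t (X : 'M[R]_n) (h := t / 2) :
  \tr (exp_diag h *m X *m exp_diag (- h)) = \tr X.
Proof. by rewrite mxtrace_mulC mulmxA exp_diagNK mul1mx. Qed.

(* Traces of words in f and the kernel are invariant under conjugation by the
   diagonal matrix exp_diag, which commutes with f. *)
Let word t (h := t / 2) (X : 'M[R]_n) :
  f *m (exp_diag h *m X *m exp_diag (- h)) =
  exp_diag h *m (f *m X) *m exp_diag (- h).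
Proof. by rewrite !mulmxA exp_diagC. Qed.

Let conjM (E E' S X : 'M[R]_n) : E' *m E = 1%:M ->
  (E *m S *m E') *m (E *m X *m E') = E *m (S *m X) *m E'.
Proof. by move=> EE; rewrite !mulmxA -[E *m S *m _ *m _]mulmxA EE mulmx1. Qed.

Let wordK t (h := t / 2) (X : 'M[R]_n) :
  tilt_kernel t *m (exp_diag h *m X *m exp_diag (- h)) =
  exp_diag h *m (sym_kernel t *m X) *m exp_diag (- h).
Proof.
by rewrite tilt_kernelE conjM// exp_diagNK.
Qed.

Lemma cumulant2E t : cumulant2 t =
  \tr (f *m sym_kernel t *m f *m (1%:M - sym_kernel t)).
Proof.
rewrite /cumulant2.
have -> : tilt_kernel t *m (f *m tilt_kernel t) =
  exp_diag (t / 2) *m (sym_kernel t *m (f *m sym_kernel t)) *m exp_diag (- (t / 2)).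
  by rewrite {2}tilt_kernelE word wordK.
rewrite tilt_kernelE !word !trace_conj.
move: (sym_kernel t) f => K F; rewrite mulmxBr mulmx1 trB !mulmxA.
by congr (_ - _); rewrite -(mulmxA F F K) mxtrace_mulC.
Qed.

(** In this form the third cumulant is dominated by the second one, by
    [third_cumulant_le]. *)
Lemma cumulant3E t (K := sym_kernel t) (q := 1%:M - K) : cumulant3 t =
  \tr (f *m q *m f *m K *m f *m q) - \tr (f *m K *m f *m K *m f *m q).
Proof.
rewrite /cumulant3 /=.
have E2 : tilt_kernel t *m (f *m tilt_kernel t) =
  exp_diag (t / 2) *m (sym_kernel t *m (f *m sym_kernel t)) *m exp_diag (- (t / 2)).
  by rewrite {2}tilt_kernelE word wordK.
have E3 : tilt_kernel t *m (f *m (tilt_kernel t *m (f *m tilt_kernel t))) =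
  exp_diag (t / 2) *m (K *m (f *m (K *m (f *m K)))) *m exp_diag (- (t / 2)).
  by rewrite E2 word wordK.
rewrite E3 E2 tilt_kernelE !word !trace_conj -/K /q; move: (K) (f) => {E2 E3 q} k0 F.
rewrite !mulmxBr !mulmxBl !mulmx1 !trB -!mulmxA.
have -> : \tr (F *m (F *m (k0 *m F))) = \tr (F *m (F *m (F *m k0))).
  by rewrite !mulmxA mxtrace_mulC !mulmxA.
have -> : \tr (F *m (k0 *m (F *m (k0 *m F)))) = \tr (F *m (F *m (k0 *m (F *m k0)))).
  by rewrite !mulmxA mxtrace_mulC !mulmxA.
by ring.
Qed.

Definition linear_var : R := \tr (f *m k *m f *m (1%:M - k)).

Variable B : R.
Hypotheses (phiB : forall i, `|phi 0 i| <= B) (B0 : 0 <= B).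

(** The third derivative is at most [2 * B] times the second one, so
    [second_order_bounds] applies, with constants that depend on [phi] through
    its sup norm and on [k] through the mean and the variance alone. *)
Lemma log_tilt_bounds t : 0 <= t ->
  t * \tr (f *m k) + expR (- (2 * B * t)) * linear_var * t ^+ 2 / 2
    <= log_tilt t <=
  t * \tr (f *m k) + expR (2 * B * t) * linear_var * t ^+ 2 / 2.
Proof.
move=> t0; set V := linear_var.
have k0 : sym_kernel 0 = k.
  rewrite /sym_kernel mul0r exp_diag0 mul1mx mulmx1 /tilt_mx exp_diag0 subrr.
  by rewrite mul0mx addr0 invmx1 mulmx1.
have V0 : cumulant2 0 = V by rewrite cumulant2E k0.
have C0 : cumulant1 0 = \tr (f *m k).
  by rewrite /cumulant1 tilt_kernelE k0 mul0r oppr0 exp_diag0 mul1mx mulmx1.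
have L0 : log_tilt 0 = 0.
  by rewrite /log_tilt /tilt_mx exp_diag0 subrr mul0mx addr0 det1 ln1.
have := @second_order_bounds R log_tilt cumulant1 cumulant2 cumulant3 (2 * B) t
  is_derive_log_tilt is_derive_cumulant1 is_derive_cumulant2.
rewrite L0 subr0 C0 V0; apply => //.
- move=> x; rewrite cumulant3E cumulant2E.
  exact: third_cumulant_le (psd_le1_sym_kernel x) phiB B0.
- by rewrite mulr_ge0.
- exact: second_cumulant_ge0.
Qed.

End tilting.

(** * The discrete sine kernel *)

Section trigonometry.
Variable R : realType.

Lemma is_derive_comp_mull (f df : R -> R) (c x : R) :
  (forall y, is_derive y (1 : R) f (df y)) ->
  is_derive x (1 : R) (fun u => f (u * c)) (c * df (x * c)).
Proof.
move=> H.
have dl : is_derive x (1 : R) (fun u => u * c) c.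
  by apply: (is_derive_eq (is_derive_mul (is_derive_id x 1) (is_derive_cst c x 1)));
    rewrite mulr0 addr0 mul1r.
have := @is_derive1_comp R f (fun u => u * c) x _ _ (H (x * c)) dl.
by rewrite [_ * c in X in X -> _]mulrC.
Qed.

Lemma cos_lipschitz (x y : R) : `|cos x - cos y| <= `|x - y|.
Proof.
wlog yx : x y / y <= x.
  move=> H; have [|/ltW] := leP y x; first exact: H.
  by move=> /H; rewrite distrC [in X in _ <= X]distrC.
have [c _ ->] := mean_value (@is_derive_cos R) yx.
by rewrite normrM normrN ler_piMl// ler_norml sin_geN1 sin_le1.
Qed.

Lemma sin_lipschitz (x y : R) : `|sin x - sin y| <= `|x - y|.
Proof.
wlog yx : x y / y <= x.
  move=> H; have [|/ltW] := leP y x; first exact: H.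
  by move=> /H; rewrite distrC [in X in _ <= X]distrC.
have [c _ ->] := mean_value (@is_derive_sin R) yx.
by rewrite normrM ler_piMl// ler_norml cos_geN1 cos_le1.
Qed.

(** sin (h w) / w, extended by continuity at w = 0.  As a function of h it is
    the antiderivative of cos (h w) that vanishes at 0: all the properties of
    the sine kernel used below come from differentiating in this parameter. *)
Definition sinch (h w : R) : R := if w == 0 then h else sin (h * w) / w.

Lemma is_derive_sinch (h w : R) :
  is_derive h (1 : R) (fun u => sinch u w) (cos (h * w)).
Proof.
rewrite /sinch; have [->|w0] := eqVneq w 0.
  by rewrite mulr0 cos0; exact: is_derive_id.
have := @is_derive_comp_mull sin cos w h (@is_derive_sin R).
move=> /is_derive_mul/(_ (is_derive_cst w^-1 h 1)) /is_derive_eq; apply.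
by rewrite mulr0 addr0 mulrAC mulfV// mul1r.
Qed.

Lemma sinch0 w : sinch 0 w = 0.
Proof. by rewrite /sinch mul0r sin0 mul0r; case: ifP. Qed.

Lemma sinchN h w : sinch h (- w) = sinch h w.
Proof. by rewrite /sinch oppr_eq0 mulrN sinN invrN mulrNN. Qed.

Lemma sinchB h x y : sinch h (x - y) = sinch h (y - x).
Proof. by rewrite -sinchN opprB. Qed.

Lemma sinch_le1 w : `|sinch 1 w| <= 1.
Proof.
have [c _] := @mean_value R _ _ 0 1 (is_derive_sinch^~ w) ler01.
by rewrite sinch0 !subr0 mulr1 => ->; rewrite ler_norml cos_geN1 cos_le1.
Qed.

Lemma sinch_lipschitz w w' : `|sinch 1 w - sinch 1 w'| <= `|w - w'|.
Proof.
have [c /andP[c0 c1]] := mean_value (fun h =>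
  is_deriveB (is_derive_sinch h w) (is_derive_sinch h w')) (@ler01 R).
rewrite -![(_ - _ : R -> R) _]/(_ - _) !sinch0 !subr0 mulr1 => ->.
rewrite (le_trans (cos_lipschitz _ _))// -mulrBr normrM ler_piMl// ger0_norm//.
Qed.

(** A sum of two squares, which makes the derivative of the quadratic form of
    [sinch] in [h] nonnegative. *)
Lemma sum_cosB n (v x : 'I_n -> R) (h : R) :
  \sum_i \sum_j v i * v j * cos (h * (x i - x j)) =
  (\sum_i v i * cos (h * x i)) ^+ 2 + (\sum_i v i * sin (h * x i)) ^+ 2.
Proof.
rewrite !expr2 !big_distrlr/= -big_split/=; apply: eq_bigr => i _.
rewrite -big_split/=; apply: eq_bigr => j _.
by rewrite mulrBr cosB; ring.
Qed.

Lemma is_derive_sinch_form n (v x : 'I_n -> R) (h : R) :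
  is_derive h (1 : R)
    (fun u => \sum_i \sum_j v i * v j * sinch u (x i - x j))
    (\sum_i \sum_j v i * v j * cos (h * (x i - x j))).
Proof.
apply: is_derive_bigsum => i; apply: is_derive_bigsum => j.
apply: (is_derive_eq (is_derive_mul (is_derive_cst (v i * v j) h 1)
  (is_derive_sinch h (x i - x j)))).
by rewrite mul0r add0r.
Qed.

Lemma sinch_form_le n (v x : 'I_n -> R) (h h' : R) : h <= h' ->
  \sum_i \sum_j v i * v j * sinch h (x i - x j) <=
  \sum_i \sum_j v i * v j * sinch h' (x i - x j).
Proof.
apply: (le_of_derive_ge0 (is_derive_sinch_form v x)) => u _.
by rewrite sum_cosB addr_ge0 ?sqr_ge0.
Qed.

Definition sinch_mx n (h : R) (x : 'I_n -> R) : 'M[R]_n :=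
  \matrix_(i, j) (pi^-1 * sinch h (x i - x j)).

Lemma quad_sinch_mx n h (x : 'I_n -> R) w :
  quad (sinch_mx h x) w =
  pi^-1 * \sum_i \sum_j w i 0 * w j 0 * sinch h (x i - x j).
Proof.
rewrite quadE mulr_sumr; apply: eq_bigr => i _; rewrite mulr_sumr.
by apply: eq_bigr => j _; rewrite mxE; ring.
Qed.

Lemma psd_sinch_mx n h (x : 'I_n -> R) : 0 <= h -> psd (sinch_mx h x).
Proof.
move=> h0; split; first by apply/matrixP => i j; rewrite !mxE sinchB.
move=> w; rewrite quad_sinch_mx mulr_ge0 ?invr_ge0 ?pi_ge0//.
apply: le_trans (sinch_form_le (fun i => w i 0) x h0).
by rewrite big1// => i _; rewrite big1// => j _; rewrite sinch0 mulr0.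
Qed.

(** At h = pi the kernel is the identity on integer points, and the quadratic
    form increases with h. *)
Lemma psd_le1_sinch_mx n h : 0 <= h <= pi ->
  psd_le1 (sinch_mx h (fun i : 'I_n => i%:R)).
Proof.
move=> /andP[h0 hpi]; split; first exact: psd_sinch_mx.
have [s _] := psd_sinch_mx (fun i : 'I_n => i%:R) h0.
split; first by rewrite linearB/= trmx1 s.
move=> w; rewrite quadD quadN subr_ge0 quad_sinch_mx.
rewrite mulrC ler_pdivrMr ?pi_gt0//.
apply: (le_trans (sinch_form_le (fun i => w i 0) (fun i : 'I_n => i%:R) hpi)).
rewrite quadE mulr_suml ler_sum// => i _; rewrite mulr_suml ler_sum// => j _.
rewrite !mxE; have [->|ij] := eqVneq i j.
  by rewrite subrr /sinch eqxx mulr1 mulrAC.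
rewrite /sinch subr_eq0 eqr_nat (inj_eq val_inj) (negbTE ij) mulrBr.
have sn (a : nat) : sin (pi * a%:R : R) = 0.
  by rewrite mulr_natr; elim: a => [|a IH]; rewrite ?mulr0n ?sin0// mulrSr sinDpi IH oppr0.
by rewrite sinB !sn !mul0r mulr0 subrr mul0r mulr0 mulr0n mulr0 !mul0r.
Qed.

Lemma sine_kernelE (x y : R) : sine_kernel x y = pi^-1 * sinch 1 (x - y).
Proof.
rewrite /sine_kernel /sinch subr_eq0 mul1r; case: eqP => _; first by rewrite mulr1.
by rewrite invfM mulrCA mulrA.
Qed.

(** Sampling the sine kernel with mesh [1 / q] and multiplying by the mesh gives
    the discrete sine kernel with parameter [1 / q]. *)
Lemma sine_kernel_scale (q x y : R) : 0 < q ->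
  q^-1 * sine_kernel (x / q) (y / q) = pi^-1 * sinch q^-1 (x - y).
Proof.
move=> q0; rewrite sine_kernelE /sinch -mulrBl mulf_eq0 invr_eq0 (gt_eqF q0) orbF.
case: eqP => [_|/eqP xy]; first by rewrite mulr1 mulrC.
rewrite mul1r [q^-1 * (x - y)]mulrC; set s := sin _.
have p0 : (pi : R) != 0 by rewrite gt_eqF// pi_gt0.
have qN0 : q != 0 by rewrite gt_eqF.
by move: (@pi R) p0 => p p0; field; rewrite ?p0 ?qN0 ?xy.
Qed.

End trigonometry.

(** * Logarithmic growth of the number variance *)

Section number_variance.
Variable R : realType.

Lemma le_of_derive_ge0_in (f df : R -> R) (a b : R) :
  (forall x, a <= x <= b -> is_derive x (1 : R) f (df x)) ->
  (forall x, a <= x <= b -> 0 <= df x) -> a <= b -> f a <= f b.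
Proof.
move=> dfx df0 ab; have [x /[1!in_itv]/= /andP[/ltW ax /ltW xb]||c] :=
  @MVT_segment R f df a b ab.
- by apply: dfx; rewrite ax.
- apply: derivable_within_continuous => x; rewrite in_itv/= => xab.
  by have [] := dfx x xab.
rewrite in_itv/= => cab.
by rewrite -subr_ge0 => ->; rewrite mulr_ge0 ?subr_ge0// df0.
Qed.

Lemma is_derive_inv (f : R -> R) (x a : R) : f x != 0 ->
  is_derive x (1 : R) f a -> is_derive x (1 : R) (fun u => (f u)^-1) (- (a / f x ^+ 2)).
Proof.
move=> fx0 [dd <-]; apply: DeriveDef; first exact: derivableV.
by rewrite deriveV// -[_ *: _]/(_ * _) mulrC mulrN.
Qed.

Lemma is_derive_add (f g : R -> R) (x a b : R) :
  is_derive x (1 : R) f a -> is_derive x (1 : R) g b ->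
  is_derive x (1 : R) (fun u => f u + g u) (a + b).
Proof. exact: is_deriveD. Qed.

Lemma is_derive_sub (f g : R -> R) (x a b : R) :
  is_derive x (1 : R) f a -> is_derive x (1 : R) g b ->
  is_derive x (1 : R) (fun u => f u - g u) (a - b).
Proof. exact: is_deriveB. Qed.

Lemma is_derive_scale (f : R -> R) (c x a : R) :
  is_derive x (1 : R) f a -> is_derive x (1 : R) (fun u => c * f u) (c * a).
Proof.
move=> df; apply: (is_derive_eq (is_derive_mul (is_derive_cst c x 1) df)).
by rewrite mul0r add0r.
Qed.

Lemma sin_le_id (x : R) : 0 <= x -> sin x <= x.
Proof.
move=> x0; have := sin_lipschitz x 0.
by rewrite sin0 !subr0 (ger0_norm x0); apply: le_trans; exact: ler_norm.
Qed.

Lemma sin_ge_half (x : R) : 0 <= x <= 1 -> x / 2 <= sin x.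
Proof.
move=> /andP[x0 x1].
have : sin 0 - (0 - 0 * (0 * 2^-1)) <= sin x - (x - x * (x * 2^-1)).
  have dh (y : R) : is_derive y (1 : R) (fun u => u * 2^-1) 2^-1.
    have := is_derive_mul (is_derive_id y 1) (is_derive_cst (2^-1 : R) y 1).
    by rewrite mulr0 addr0 mul1r.
  apply: (@le_of_derive_ge0 R (fun u => sin u - (u - u * (u * 2^-1)))
    (fun u => cos u - (1 - u)) 0 x) => //.
    move=> y; have d1 := is_derive_mul (is_derive_id y 1) (dh y).
    apply: (is_derive_eq (is_derive_sub (is_derive_sin y)
      (is_derive_sub (is_derive_id y 1) d1))).
    by field.
  move=> y /andP[y0 _]; have := cos_lipschitz 0 y.
  by rewrite cos0 sub0r normrN (ger0_norm y0) ler_norml => /andP[_]; lra.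
rewrite sin0 mul0r !subr0.
have : x * x <= x by rewrite ler_piMr.
lra.
Qed.

Variable m : nat.

(** pi ^ 2 times the variance of the number of particles of the determinantal
    process with kernel sin (h (a - b)) / (pi (a - b)) on the integers in
    [0, m). *)
Definition fejer_var (h : R) : R :=
  m%:R * pi * h - \sum_(a < m) \sum_(b < m) (sinch h (a%:R - b%:R)) ^+ 2.

Definition fejer_var' (h : R) : R :=
  m%:R * pi - \sum_(a < m) \sum_(b < m) sinch (2 * h) (a%:R - b%:R).

Lemma is_derive_fejer_var h : is_derive h (1 : R) fejer_var (fejer_var' h).
Proof.
have d1 := is_derive_scale (m%:R * pi) (is_derive_id h (1 : R)).
rewrite mulr1 in d1.
apply: is_derive_sub => //.
apply: is_derive_bigsum => a; apply: is_derive_bigsum => b.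
have ds := is_derive_sinch h (a%:R - b%:R).
apply: (is_derive_eq (is_derive_mul ds ds)).
rewrite /sinch; case: eqP => [->|_].
  by rewrite mulr0 cos0; ring.
set w := _ - _; have -> : 2 * h * w = h * w + h * w by ring.
by rewrite sinD; ring.
Qed.

Lemma fejer_closed_form (h : R) :
  (\sum_(a < m) cos (2 * h * a%:R)) * sin h = sin (m%:R * h) * cos ((m%:R - 1) * h)
  /\ (\sum_(a < m) sin (2 * h * a%:R)) * sin h = sin (m%:R * h) * sin ((m%:R - 1) * h).
Proof.
elim: m => [|n [IHc IHs]]; first by rewrite !big_ord0 !mul0r sin0 !mul0r.
have E1 : n.+1%:R * h = n%:R * h + h by rewrite -natr1 mulrDl mul1r.
have E2 : (n.+1%:R - 1) * h = n%:R * h by rewrite -natr1 addrK.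
have E3 : (n%:R - 1) * h = n%:R * h - h by rewrite mulrBl mul1r.
have E4 : 2 * h * n%:R = n%:R * h + n%:R * h by ring.
rewrite !big_ord_recr/= [(_ + cos _) * _]mulrDl [(_ + sin _) * _]mulrDl.
rewrite IHc IHs E1 E2 E3 E4 !sinD !cosD sinN cosN.
have := cos2Dsin2 (n%:R * h); set c := cos (_ * _); set s := sin (_ * _).
by move=> cs; split; ring.
Qed.

Lemma fejer (h : R) :
  (\sum_(a < m) \sum_(b < m) cos (2 * h * (a%:R - b%:R))) * sin h ^+ 2 =
  sin (m%:R * h) ^+ 2.
Proof.
have := sum_cosB (fun=> 1) (fun a : 'I_m => a%:R) (2 * h).
under eq_bigr do under eq_bigr do rewrite !mul1r.
move=> ->; under eq_bigr do rewrite mul1r.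
under [X in _ + X ^+ 2]eq_bigr do rewrite mul1r.
have [c s] := fejer_closed_form h.
rewrite mulrDl -!exprMn c s !exprMn -mulrDr.
by rewrite addrC [_ + _](_ : _ = 1) ?mulr1// addrC cos2Dsin2.
Qed.

(** The second derivative is minus twice a Fejer kernel, hence nonpositive and
    explicit: the logarithm comes from integrating [1 / sin^2] twice. *)
Lemma is_derive_fejer_var' h : is_derive h (1 : R) fejer_var'
  (- (2 * \sum_(a < m) \sum_(b < m) cos (2 * h * (a%:R - b%:R)))).
Proof.
apply: (is_derive_eq (is_derive_sub (is_derive_cst (m%:R * pi) h 1) _)); last first.
  by rewrite sub0r; reflexivity.
rewrite mulr_sumr; apply: is_derive_bigsum => a.
rewrite mulr_sumr; apply: is_derive_bigsum => b.
have := @is_derive_comp_mull R (fun u => sinch u (a%:R - b%:R)) _ 2 h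
  (fun u => is_derive_sinch u (a%:R - b%:R)).
rewrite (_ : (fun u => sinch (u * 2) _) = (fun u => sinch (2 * u) (a%:R - b%:R))).
  by rewrite [h * 2]mulrC.
by apply/funext => u; rewrite mulrC.
Qed.

Lemma sin_pi_nat (a : nat) : sin (pi * a%:R : R) = 0.
Proof.
by rewrite mulr_natr; elim: a => [|a IH];
  rewrite ?mulr0n ?sin0// mulrSr sinDpi IH oppr0.
Qed.

(** At [2 h = pi] the discrete sine kernel is diagonal, so its double sum is its
    trace. *)
Lemma fejer_var'_pihalf : fejer_var' (pi / 2) = 0.
Proof.
rewrite /fejer_var' [2 * _]mulrC divfK//.
rewrite (eq_bigr (fun=> pi)) ?sumr_const ?card_ord ?mulr_natl ?subrr//.
move=> a _; rewrite (bigD1 a)//= big1 ?addr0; first by rewrite /sinch subrr eqxx.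
move=> b /negbTE ba; rewrite /sinch subr_eq0 eqr_nat (inj_eq val_inj) eq_sym ba.
by rewrite mulrBr sinB !sin_pi_nat !mul0r mulr0 subrr mul0r.
Qed.

Lemma sum_cos_ge0 (h : R) : 0 <= \sum_(a < m) \sum_(b < m) cos (2 * h * (a%:R - b%:R)).
Proof.
have := sum_cosB (fun=> 1) (fun a : 'I_m => a%:R) (2 * h).
under eq_bigr do under eq_bigr do rewrite !mul1r.
by move=> ->; rewrite addr_ge0 ?sqr_ge0.
Qed.

Lemma fejer_var'_le (h h' : R) : h <= h' -> fejer_var' h' <= fejer_var' h.
Proof.
move=> hh; rewrite -lerN2.
apply: (le_of_derive_ge0 (fun x => is_deriveN (is_derive_fejer_var' x)) _ hh).
by move=> x _; rewrite opprK mulr_ge0// sum_cos_ge0.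
Qed.

Lemma fejer_var0 : fejer_var 0 = 0.
Proof.
rewrite /fejer_var mulr0 big1 ?subr0// => a _; rewrite big1// => b _.
by rewrite sinch0 expr0n.
Qed.

Lemma fejer_var_ge0 h : 0 <= h <= pi / 2 -> 0 <= fejer_var h.
Proof.
move=> /andP[h0 hp]; rewrite -fejer_var0.
apply: (le_of_derive_ge0 is_derive_fejer_var _ h0) => x /andP[_ xh].
by rewrite -fejer_var'_pihalf fejer_var'_le// (le_trans xh).
Qed.

Lemma fejer_var_le h : 0 <= h -> fejer_var h <= m%:R * pi * h.
Proof.
move=> h0; rewrite /fejer_var gerBl sumr_ge0// => a _.
by rewrite sumr_ge0// => b _; rewrite sqr_ge0.
Qed.

Hypothesis m0 : (0 < m)%N.
Let M : R := m%:R.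
Let M0 : 0 < M. Proof. by rewrite ltr0n. Qed.

Let sinp (h : R) : 0 < h <= pi / 2 -> 0 < sin h.
Proof.
move=> /andP[h0 hp]; rewrite sin_gt0_pi// h0 (le_lt_trans hp)//.
by rewrite ltr_pdivrMr// ltr_pMr ?pi_gt0// ltr1n.
Qed.

Let cosp (h : R) : 0 < h <= pi / 2 -> 0 <= cos h.
Proof.
move=> /andP[h0 hp]; rewrite cos_ge0_pihalf// hp andbT.
by rewrite (le_trans _ (ltW h0))// oppr_le0 divr_ge0 ?pi_ge0.
Qed.

(** The deviation of [fejer_var'] from the cotangent, minus the oscillating term
    of size [1 / (M sin^2)], is monotone on [0, pi / 2] for [e = 1] and for
    [e = -1], and explicit at [pi / 2]. *)
Let Phi (e h : R) : R :=
  fejer_var' h - cos h * (sin h)^-1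
  - (sin (h * (2 * M)) + e) * (2 * M)^-1 * (sin h ^+ 2)^-1.

Let is_derive_Phi (e h : R) : 0 < h <= pi / 2 ->
  is_derive h (1 : R) (Phi e)
    ((sin (h * (2 * M)) + e) * cos h / (M * sin h ^+ 3)).
Proof.
move=> hp; have s0 := sinp hp.
have sN0 : sin h != 0 by rewrite gt_eqF.
have ds := @is_derive_sin R h; have dc := @is_derive_cos R h.
have d1 := is_derive_mul dc (is_derive_inv sN0 ds).
have d2 := is_derive_mul ds ds.
have d3 : is_derive h (1 : R) (fun u => (sin u ^+ 2)^-1)
    (- ((2 * (sin h * cos h)) / (sin h ^+ 2) ^+ 2)).
  apply: is_derive_inv; first by rewrite expf_neq0.
  by apply: (is_derive_eq d2); ring.
have d4 : is_derive h (1 : R) (fun u => sin (u * (2 * M)) + e)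
    (2 * M * cos (h * (2 * M))).
  have := is_derive_add (is_derive_comp_mull (2 * M) h (@is_derive_sin R))
     (is_derive_cst e h 1).
  by rewrite addr0.
have d5 := is_derive_mul (is_derive_mul d4 (is_derive_cst (2 * M)^-1 h 1)) d3.
apply: (is_derive_eq (is_derive_sub (is_derive_sub (is_derive_fejer_var' h) d1) d5)).
have F := fejer h.
have -> : \sum_(a < m) \sum_(b < m) cos (2 * h * (a%:R - b%:R)) =
    sin (M * h) ^+ 2 / sin h ^+ 2.
  by rewrite -F mulfK// expf_neq0.
have -> : cos (h * (2 * M)) = 1 - 2 * sin (M * h) ^+ 2.
  rewrite (_ : h * (2 * M) = M * h + M * h); last by ring.
  by rewrite cosD; have := cos2Dsin2 (M * h); lra.
have -> : cst (2 * M)^-1 h = (2 * M)^-1 by [].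
have := cos2Dsin2 h; have MN0 : M != 0 by rewrite gt_eqF.
move: (sin (h * (2 * M))) (sin (M * h)) (sin h) (cos h) sN0 => A B s c sN0 cs.
have -> : - s * s^-1 + c * - (c / s ^+ 2) = - (1 / s ^+ 2).
  by rewrite -cs; field.
by move: (M) MN0 => M' MN0; field; rewrite MN0 sN0.
Qed.

Let dev_le (h : R) : 0 < h <= pi / 2 ->
  `|fejer_var' h - cos h / sin h| <= (M * sin h ^+ 2)^-1.
Proof.
move=> hp; have s0 := sinp hp; have /andP[h0 hpi] := hp.
have sub x : h <= x <= pi / 2 -> 0 < x <= pi / 2.
  by move=> /andP[hx ->]; rewrite (lt_le_trans h0).
have P1 : Phi 1 h <= Phi 1 (pi / 2).
  apply: (@le_of_derive_ge0_in (Phi 1) (fun x => (sin (x * (2 * M)) + 1) * cos x / (M * sin x ^+ 3)) h (pi / 2) _ _ hpi).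
    by move=> x /sub; exact: is_derive_Phi.
  move=> x /sub xp; apply: divr_ge0; apply: mulr_ge0.
  - by have := sin_geN1 (x * (2 * M)); lra.
  - exact: cosp.
  - exact: ltW.
  - by rewrite exprn_ge0// ltW// sinp.
have P2 : - Phi (-1) h <= - Phi (-1) (pi / 2).
  apply: (@le_of_derive_ge0_in (- Phi (-1)) (fun x => - ((sin (x * (2 * M)) - 1) * cos x / (M * sin x ^+ 3))) h (pi / 2) _ _ hpi).
    by move=> x /sub xp; apply: is_deriveN; exact: is_derive_Phi.
  move=> x /sub xp; rewrite -!mulNr; apply: divr_ge0; apply: mulr_ge0.
  - by have := sin_le1 (x * (2 * M)); lra.
  - exact: cosp.
  - exact: ltW.
  - by rewrite exprn_ge0// ltW// sinp.
have E0 e : Phi e (pi / 2) = - (e / (2 * M)).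
  rewrite /Phi fejer_var'_pihalf cos_pihalf sin_pihalf mul0r expr1n invr1 mulr1.
  have -> : pi / 2 * (2 * M) = pi * M by rewrite mulrA divfK.
  by rewrite sin_pi_nat; ring.
have y0 : 0 <= (sin h ^+ 2)^-1 by rewrite invr_ge0 sqr_ge0.
rewrite !E0 in P1 P2; move: P1 P2 y0.
have -> : (M * sin h ^+ 2)^-1 = M^-1 * (sin h ^+ 2)^-1 by rewrite invfM.
rewrite /Phi; set D := _ - cos h * _; move: (sin h ^+ 2)^-1 => y P1 P2 y0.
have i0 : 0 <= M^-1 by rewrite invr_ge0 ltW.
have s1 := sin_geN1 (h * (2 * M)); have s2 := sin_le1 (h * (2 * M)).
move: P1 P2 s1 s2; rewrite !invfM; move: (sin (h * (2 * M))) => A P1 P2 s1 s2.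
have Ay : A * 2^-1 * M^-1 * y <= 2^-1 * M^-1 * y /\ - (2^-1 * M^-1 * y) <= A * 2^-1 * M^-1 * y.
  have p0 : 0 <= 2^-1 * M^-1 * y by rewrite !mulr_ge0.
  have := ler_wpM2r p0 s2; have := ler_wpM2r p0 s1.
  by rewrite !mulrA mul1r mulN1r; lra.
have i1 : 0 <= 2^-1 * M^-1 by rewrite mulr_ge0.
by rewrite ler_norml; apply/andP; split; lra.
Qed.

(** As [dev_le] bounds the derivative of [fejer_var - ln sin] by [1 / (M sin^2)],
    adding or subtracting a multiple of the cotangent makes it monotone. *)
Let Psi (e h : R) : R := fejer_var h - ln (sin h) + e * (cos h * (sin h)^-1).

Let is_derive_Psi (e h : R) : 0 < h <= pi / 2 ->
  is_derive h (1 : R) (Psi e) (fejer_var' h - cos h / sin h - e / sin h ^+ 2).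
Proof.
move=> hp; have s0 := sinp hp.
have sN0 : sin h != 0 by rewrite gt_eqF.
have ds := @is_derive_sin R h; have dc := @is_derive_cos R h.
have d1 := is_derive_scale e (is_derive_mul dc (is_derive_inv sN0 ds)).
have d2 := @is_derive1_comp R (@ln R) sin h _ _ (is_derive1_ln s0) ds.
apply: (is_derive_eq (is_derive_add (is_derive_sub (is_derive_fejer_var h) d2) d1)).
have := cos2Dsin2 h; move: (sin h) (cos h) sN0 => s c sN0 cs.
have -> : - s * s^-1 + c * - (c / s ^+ 2) = - (1 / s ^+ 2).
  by rewrite -cs; field.
by rewrite [s^-1 * c]mulrC mulrN mulrA mulr1.
Qed.

(** Integrate the comparison with the cotangent between [1 / m], where the
    variance is at most [pi], and [h]. *)
Lemma fejer_var_log (h : R) : h <= 1 -> 1 <= m%:R * h ->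
  `|fejer_var h - ln (m%:R * h)| <= pi + 4.
Proof.
move=> h1; rewrite -/M => Mh.
have h0 : 0 < h by rewrite -(pmulr_rgt0 _ M0) (lt_le_trans ltr01).
have p1 : 1 <= pi / 2 :> R by exact: pihalf_ge1.
(* the lower endpoint: there the variance is bounded *)
pose g := M^-1; have g0 : 0 < g by rewrite invr_gt0.
have gh : g <= h by rewrite /g -[M^-1]mul1r ler_pdivrMr// mulrC.
have hp : 0 < h <= pi / 2 by rewrite h0 (le_trans h1).
have gp : 0 < g <= pi / 2 by rewrite g0 (le_trans gh)// (le_trans h1).
have sub x : g <= x <= h -> 0 < x <= pi / 2.
  move=> /andP[gx xh]; rewrite (lt_le_trans g0)//=.
  by rewrite (le_trans xh)// (le_trans h1).
have P1 : - Psi g g <= - Psi g h.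
  apply: (@le_of_derive_ge0_in (- Psi g) (fun x =>
    - (fejer_var' x - cos x / sin x - g / sin x ^+ 2)) g h _ _ gh).
    by move=> x /sub xp; apply: is_deriveN; exact: is_derive_Psi.
  move=> x /sub xp; have := dev_le xp; rewrite invfM -/g ler_norml => /andP[_].
  lra.
have P2 : Psi (- g) g <= Psi (- g) h.
  apply: (@le_of_derive_ge0_in (Psi (- g)) (fun x =>
    (fejer_var' x - cos x / sin x - - g / sin x ^+ 2)) g h _ _ gh).
    by move=> x /sub xp; exact: is_derive_Psi.
  move=> x /sub xp; have := dev_le xp; rewrite invfM -/g ler_norml => /andP[+ _].
  by rewrite mulNr; lra.
have W1 : 0 <= fejer_var g by rewrite fejer_var_ge0// (ltW g0); case/andP: gp.
have W2 : fejer_var g <= pi.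
  by rewrite (le_trans (fejer_var_le (ltW g0)))// mulrAC mulfV ?mul1r// gt_eqF.
have sg := sinp gp; have sh := sinp hp.
have cot_h : 0 <= g * (cos h * (sin h)^-1).
  by rewrite !mulr_ge0 ?invr_ge0 ?(ltW g0) ?(ltW sh) ?cosp.
have hg1 : 0 <= g <= 1 by rewrite (ltW g0) (le_trans gh).
have hh1 : 0 <= h <= 1 by rewrite (ltW h0).
have cot_g : g * (cos g * (sin g)^-1) <= 2.
  rewrite mulrA ler_pdivrMr// (@le_trans _ _ g)//.
    by rewrite ler_piMr ?(ltW g0)// cos_le1.
  by have := sin_ge_half hg1; lra.
have cot_g0 : 0 <= g * (cos g * (sin g)^-1).
  by rewrite !mulr_ge0 ?invr_ge0 ?(ltW g0) ?(ltW sg) ?cosp.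
have Mh0 : 0 < M * h by rewrite mulr_gt0.
have lnh : ln (M * h) = ln h - ln g.
  by rewrite lnM ?posrE// /g lnV ?posrE// opprK addrC.
have ln2 : ln 2 <= 1 :> R.
  by rewrite (le_trans (@le_ln1Dx R 1 _))// ?ler_ltD//; lra.
have lnb (x : R) : 0 < x -> x <= 1 -> ln x - 1 <= ln (sin x) <= ln x.
  move=> x0 x1.
  have sx : 0 < sin x by apply: sinp; rewrite x0 (le_trans x1).
  rewrite !(ler_ln, posrE)// sin_le_id ?(ltW x0)// andbT.
  have xx1 : 0 <= x <= 1 by rewrite (ltW x0).
  have : ln (x / 2) <= ln (sin x) by rewrite ler_ln ?posrE ?divr_gt0// sin_ge_half.
  by rewrite ln_div ?posrE//; lra.
have /andP[l1 l2] := lnb h h0 h1.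
have /andP[l3 l4] := lnb g g0 (le_trans gh h1).
move: P1 P2; rewrite /Psi lnh ler_norml !mulNr => P1 P2.
by apply/andP; split; lra.
Qed.

End number_variance.

(** * Laplace transforms of counts on a grid *)

Section grid_determinant.
Variable R : realType.

Definition gap (x y : nat) : nat := ((x - y) + (y - x))%N.

Lemma gapC x y : gap x y = gap y x.
Proof. by rewrite /gap addnC. Qed.

Let rect (h : R) (x x' y y' : nat) : R :=
  \sum_(x <= a < x') \sum_(y <= b < y') (sinch h (a%:R - b%:R)) ^+ 2.

Let rectC h x x' y y' : rect h x x' y y' = rect h y y' x x'.
Proof.
rewrite /rect exchange_big/=; apply: eq_bigr => a _; apply: eq_bigr => b _.
by rewrite sinchB.
Qed.

Let rect_split h x x' x'' y y' : (x <= x' <= x'')%N ->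
  rect h x x'' y y' = rect h x x' y y' + rect h x' x'' y y'.
Proof. by move=> /andP[xx' xx'']; rewrite /rect (big_cat_nat xx' xx''). Qed.

Let rect_shift h x y : (x <= y)%N -> rect h x y x y = rect h 0 (y - x) 0 (y - x).
Proof.
move=> xy; rewrite /rect -{1}[x]add0n big_addn; apply: eq_bigr => a _.
rewrite -{1}[x]add0n big_addn; apply: eq_bigr => b _.
by rewrite !natrD opprD addrACA subrr addr0.
Qed.

(** The covariance of the counts in [0, x) and [0, y) by polarization, as a
    difference of counts over nested intervals is a count over an interval. *)
Lemma rect_polarization h x y :
  2 * rect h 0 x 0 y =
  rect h 0 x 0 x + rect h 0 y 0 y - rect h 0 (gap x y) 0 (gap x y).
Proof.
wlog xy : x y / (x <= y)%N.
  move=> H; have [/H//|/ltnW/H] := leqP x y.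
  by rewrite rectC gapC => ->; rewrite [X in X - _]addrC.
have -> : gap x y = (y - x)%N by rewrite /gap; lia.
rewrite -rect_shift// [rect h 0 y 0 y](@rect_split h 0 x y)//.
rewrite rectC [rect h x y 0 y]rectC !(@rect_split h 0 x y)//.
by rewrite [rect h 0 x x y]rectC; ring.
Qed.

Let fejer_varE m h :
  fejer_var m h = m%:R * pi * h - rect h 0 m 0 m.
Proof.
rewrite /fejer_var /rect big_mkord; congr (_ - _); apply: eq_bigr => a _.
by rewrite big_mkord.
Qed.

Variables (d : nat) (s : 'I_d -> R) (n : 'I_d -> nat) (L q : nat).
Hypotheses (nL : forall j, (n j <= L)%N) (q0 : (0 < q)%N).
Let h : R := q%:R^-1.

Let Q0 : 0 < q%:R :> R. Proof. by rewrite ltr0n. Qed.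
Let h0 : 0 < h. Proof. by rewrite invr_gt0. Qed.
Let h1 : h <= 1. Proof. by rewrite invf_le1// ler1n. Qed.

Definition grid_mx : 'M[R]_(L * q) := sinch_mx h (fun i : 'I_(L * q) => i%:R).

Definition grid_phi : 'rV[R]_(L * q) :=
  \row_a \sum_j s j * ((a : nat) < n j * q)%N%:R.

Lemma grid_psd_le1 : psd_le1 grid_mx.
Proof.
apply: psd_le1_sinch_mx; rewrite ltW//= (le_trans h1)//.
by rewrite (le_trans _ (pi_ge2 R))// ler1n.
Qed.

Let B : R := \sum_j `|s j|.

Lemma grid_phi_le a : `|grid_phi 0 a| <= B.
Proof.
rewrite mxE; apply: le_trans (ler_norm_sum _ _ _) _; apply: ler_sum => j _.
by rewrite normrM ler_piMr// normr_nat lern1 leq_b1.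
Qed.

Let sum_cut m (F : nat -> R) : (m <= L)%N ->
  \sum_(a < L * q) ((a : nat) < m * q)%N%:R * F a = \sum_(0 <= a < m * q) F a.
Proof.
move=> mL; rewrite (big_nat_widen _ _ (L * q)); last by rewrite leq_mul2r mL orbT.
rewrite big_mkord [RHS]big_mkcond/=; apply: eq_bigr => a _.
by case: (_ < _)%N; rewrite ?mul1r ?mul0r.
Qed.

Lemma grid_mean : \tr (diag_mx grid_phi *m grid_mx) = \sum_j s j * (n j)%:R / pi.
Proof.
rewrite /mxtrace; under eq_bigr => a _ do
  rewrite mul_diag_mx mxE mxE mxE subrr /sinch eqxx mulr_suml.
rewrite exchange_big/=; apply: eq_bigr => j _.
under eq_bigr => a _ do rewrite -mulrA.
rewrite -mulr_sumr (sum_cut (fun=> pi^-1 * h))// sumr_const_nat subn0 -mulrA.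
congr (_ * _); rewrite -[LHS]mulr_natr natrM mulrAC -mulrA /h.
by rewrite mulfK ?gt_eqF// mulrC.
Qed.

Let vq (m : nat) : R := fejer_var (m * q) h.

Let vq_ln m : `|vq m - ln m%:R| <= pi + 4.
Proof.
have C0 : 0 <= pi + 4 :> R by rewrite addr_ge0 ?pi_ge0.
rewrite /vq; case: m => [|m].
  rewrite mul0n ln0// subr0 (_ : fejer_var 0 h = 0) ?normr0//.
  by rewrite /fejer_var big_ord0 !mul0r subr0.
have E : (m.+1 * q)%:R * h = m.+1%:R by rewrite natrM -mulrA mulfV ?mulr1 ?gt_eqF.
have := @fejer_var_log R (m.+1 * q) _ h h1; rewrite E; apply.
  by rewrite muln_gt0.
by rewrite ler1n.
Qed.

(** The variance of a combination of counts, by polarization a combination of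
    variances of counts over intervals. *)
Lemma grid_var : pi ^+ 2 * linear_var grid_mx grid_phi =
  \sum_i \sum_j s i * s j * ((vq (n i) + vq (n j) - vq (gap (n i) (n j))) / 2).
Proof.
have p0 : (pi : R) != 0 by rewrite gt_eqF// pi_gt0.
pose S (a : 'I_(L * q)) := grid_phi 0 a.
have -> : linear_var grid_mx grid_phi =
  \sum_a S a * S a * (pi^-1 * h)
  - \sum_a \sum_b S a * S b * (pi^-1 ^+ 2 * (sinch h (a%:R - b%:R)) ^+ 2).
  rewrite /linear_var mulmxBr mulmx1 mxtraceD raddfN; congr (_ - _).
    apply: eq_bigr => a _; rewrite mul_mx_diag mxE mul_diag_mx mxE.
    by rewrite [grid_mx _ _]mxE subrr /sinch eqxx -/(S a); ring.
  rewrite /mxtrace; apply: eq_bigr => a _; rewrite mxE; apply: eq_bigr => b _.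
  rewrite mul_mx_diag mxE mul_diag_mx mxE ![grid_mx _ _]mxE.
  by rewrite [sinch h (b%:R - a%:R)]sinchB -/(S a) -/(S b); ring.
have SE a : S a = \sum_j s j * ((a : nat) < n j * q)%N%:R by rewrite /S mxE.
have -> : \sum_a S a * S a * (pi^-1 * h) = \sum_i \sum_j s i * s j *
    (\sum_(a < L * q) ((a : nat) < n i * q)%N%:R *
       (((a : nat) < n j * q)%N%:R * (pi^-1 * h))).
  transitivity (\sum_(a < L * q) \sum_i \sum_j s i * s j *
     (((a : nat) < n i * q)%N%:R * (((a : nat) < n j * q)%N%:R * (pi^-1 * h)))).
    apply: eq_bigr => a _; rewrite !SE big_distrlr/= mulr_suml.
    apply: eq_bigr => i _; rewrite mulr_suml; apply: eq_bigr => j _; ring.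
  rewrite exchange_big/=; apply: eq_bigr => i _.
  rewrite exchange_big/=; apply: eq_bigr => j _.
  by rewrite mulr_sumr.
have -> : \sum_a \sum_b S a * S b * (pi^-1 ^+ 2 * (sinch h (a%:R - b%:R)) ^+ 2)
   = \sum_i \sum_j s i * s j * (pi^-1 ^+ 2 * rect h 0 (n i * q) 0 (n j * q)).
  transitivity (\sum_(a < L * q) \sum_(b < L * q) \sum_i \sum_j s i * s j *
     (((a : nat) < n i * q)%N%:R * (((b : nat) < n j * q)%N%:R *
       (pi^-1 ^+ 2 * (sinch h (a%:R - b%:R)) ^+ 2)))).
    apply: eq_bigr => a _; apply: eq_bigr => b _; rewrite !SE big_distrlr/= mulr_suml.
    apply: eq_bigr => i _; rewrite mulr_suml; apply: eq_bigr => j _; ring.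
  under eq_bigr => a _ do rewrite exchange_big/=.
  rewrite exchange_big/=; apply: eq_bigr => i _.
  under eq_bigr => a _ do rewrite exchange_big/=.
  rewrite exchange_big/=; apply: eq_bigr => j _.
  rewrite /rect mulr_sumr -(sum_cut (fun a => pi^-1 ^+ 2 *
    \sum_(0 <= b < n j * q) (sinch h (a%:R - b%:R)) ^+ 2))// mulr_sumr.
  apply: eq_bigr => a _; rewrite mulr_sumr -(sum_cut (fun b => pi^-1 ^+ 2 *
     (sinch h (a%:R - b%:R)) ^+ 2))// !mulr_sumr.
  by apply: eq_bigr => b _.
rewrite -sumrB mulr_sumr; apply: eq_bigr => i _.
rewrite -sumrB mulr_sumr; apply: eq_bigr => j _.
rewrite -mulrBr mulrCA; congr (_ * _).
have -> : \sum_(a < L * q) ((a : nat) < n i * q)%N%:R *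
       (((a : nat) < n j * q)%N%:R * (pi^-1 * h)) = (minn (n i) (n j))%:R * q%:R * (pi^-1 * h).
  transitivity (\sum_(a < L * q) ((a : nat) < minn (n i) (n j) * q)%N%:R * (pi^-1 * h)).
    apply: eq_bigr => a _; rewrite mulrA -natrM mulnb minnMl leq_min.
    by rewrite -!/(a < _)%N.
  rewrite (sum_cut (fun=> pi^-1 * h)) ?geq_min ?nL// sumr_const_nat subn0.
  by rewrite -[LHS]mulr_natr natrM mulrC.
rewrite /vq !fejer_varE.
have -> : (gap (n i) (n j) * q = gap (n i * q) (n j * q))%N.
  by rewrite /gap mulnDl !mulnBl.
have P := rect_polarization h (n i * q) (n j * q).
have G : (gap (n i * q) (n j * q))%:R = (n i)%:R * q%:R + (n j)%:R * q%:R
    - 2 * ((minn (n i) (n j))%:R * q%:R) :> R.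
  have G' x y : (gap x y + 2 * minn x y = x + y)%N by rewrite /gap; lia.
  have := congr1 (fun a => a%:R : R) (G' (n i * q)%N (n j * q)%N).
  by rewrite -minnMl /= !natrD !natrM => <-; ring.
rewrite G !natrM mulrBr.
have -> : pi ^+ 2 * (pi^-1 ^+ 2 * rect h 0 (n i * q) 0 (n j * q)) =
   (rect h 0 (n i * q) 0 (n i * q) + rect h 0 (n j * q) 0 (n j * q) -
   rect h 0 (gap (n i * q) (n j * q)) 0 (gap (n i * q) (n j * q))) / 2.
  by rewrite -P mulrA -exprMn mulfV// expr1n; field.
move: (rect _ _ _ _ _) (rect _ _ _ _ _) (rect _ _ _ _ _) => r1 r2 r3.
have qN0 : q%:R != 0 :> R by rewrite gt_eqF.
move: (@pi R) p0 => p p0; rewrite /h.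
by field; rewrite ?p0 ?qN0.
Qed.

Let Lam : R :=
  \sum_i \sum_j s i * s j * ((ln (n i)%:R + ln (n j)%:R - ln (gap (n i) (n j))%:R) / 2).

Lemma grid_var_le : `|pi ^+ 2 * linear_var grid_mx grid_phi - Lam| <= 3 * (pi + 4) * B ^+ 2.
Proof.
rewrite grid_var -sumrB expr2 /B big_distrlr/= mulr_sumr.
apply: le_trans (ler_norm_sum _ _ _) _; apply: ler_sum => i _.
rewrite -sumrB mulr_sumr; apply: le_trans (ler_norm_sum _ _ _) _; apply: ler_sum => j _.
rewrite -mulrBr !normrM mulrC; apply: ler_wpM2r; first by rewrite mulr_ge0.
have := vq_ln (n i); have := vq_ln (n j); have := vq_ln (gap (n i) (n j)).
by rewrite !ler_norml => /andP[a1 a2] /andP[b1 b2] /andP[c1 c2]; apply/andP; split; lra.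
Qed.

(** [log_tilt_bounds] with the mean and the variance of the grid: the mesh has
    disappeared from the bounds. *)
Lemma grid_det_bounds (t : R) : 0 <= t ->
  let m := t * \sum_j s j * (n j)%:R / pi in
  let C := 3 * (pi + 4) * B ^+ 2 in
  expR (m + expR (- (2 * B * t)) * ((Lam - C) / pi ^+ 2) * t ^+ 2 / 2)
    <= \det (tilt_mx grid_mx grid_phi t) /\
  \det (tilt_mx grid_mx grid_phi t) <=
  expR (m + expR (2 * B * t) * ((Lam + C) / pi ^+ 2) * t ^+ 2 / 2).
Proof.
move=> t0 m C; have B0 : 0 <= B by exact: sumr_ge0.
have := log_tilt_bounds grid_psd_le1 grid_phi_le B0 t0.
have D0 := tilt_det_gt0 grid_phi grid_psd_le1 t.
rewrite grid_mean -/m /log_tilt -{3 4}(lnK D0) !ler_expR => /andP[l u].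
have p2 : 0 < pi ^+ 2 :> R by rewrite exprn_gt0// pi_gt0.
have := grid_var_le; rewrite -/C ler_norml => /andP[c1 c2].
have V1 : (Lam - C) / pi ^+ 2 <= linear_var grid_mx grid_phi.
  by rewrite ler_pdivrMr//; lra.
have V2 : linear_var grid_mx grid_phi <= (Lam + C) / pi ^+ 2.
  by rewrite ler_pdivlMr//; lra.
split; [apply: le_trans l|apply: le_trans u _]; rewrite lerD2l.
  by rewrite ler_wpM2r// ler_wpM2r ?sqr_ge0// ler_wpM2l ?expR_ge0.
by rewrite ler_wpM2r// ler_wpM2r ?sqr_ge0// ler_wpM2l ?expR_ge0.
Qed.

End grid_determinant.

(** * Iterated integrals and mesh cells *)

Lemma big_tuple_cons (R : nmodType) (T : finType) n (F : n.+1.-tuple T -> R) :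
  \sum_(a : n.+1.-tuple T) F a =
  \sum_(b : T) \sum_(a : n.-tuple T) F [tuple of b :: a].
Proof.
rewrite pair_bigA /=.
rewrite (reindex (fun p : T * n.-tuple T => [tuple of p.1 :: p.2])) //=.
exists (fun a => (thead a, [tuple of behead a])) => [[b a] _|a _] /=.
  by rewrite theadE; congr (_, _); apply: val_inj.
by rewrite [RHS]tuple_eta.
Qed.

(** The integral of a nonnegative function is a supremum over the simple functions
    below it. This makes iterated integrals monotone without an appeal to
    Tonelli's theorem for the inner integrals. *)
Lemma ge0_le_integral_nomeas d (T : measurableType d) (R : realType)
    (mu : {measure set T -> \bar R}) (f g : T -> \bar R) :
  (forall x, 0 <= f x)%E -> (forall x, f x <= g x)%E ->
  (\int[mu]_x f x <= \int[mu]_x g x)%E.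
Proof.
move=> f0 fg; rewrite !ge0_integralE//; last first.
  by move=> x _; exact: le_trans (fg x).
apply: ereal_sup_le => _ [h hf <-]; exists h => //= x.
by apply: le_trans (hf x) _; rewrite !patch_setT.
Qed.

Section iterated_integrals.
Variable R : realType.
Notation lit := (@lebesgue_integral_tuple R _).

Lemma lit_ge0 n (f : n.-tuple R -> \bar R) : (forall x, 0 <= f x)%E -> (0 <= lit f)%E.
Proof.
elim: n f => [f f0|n IH f f0] /=; first exact: f0.
by apply: integral_ge0 => x _; apply: IH => y; exact: f0.
Qed.

Lemma le_lit n (f g : n.-tuple R -> \bar R) :
  (forall x, 0 <= f x)%E -> (forall x, f x <= g x)%E -> (lit f <= lit g)%E.
Proof.
elim: n f g => [f g f0 fg|n IH f g f0 fg] /=; first exact: fg.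
apply: ge0_le_integral_nomeas => x; first by apply: lit_ge0 => y; exact: f0.
by apply: IH => y; [exact: f0|exact: fg].
Qed.

Lemma eq_lit n (f g : n.-tuple R -> \bar R) : f =1 g -> lit f = lit g.
Proof. by move=> fg; congr lebesgue_integral_tuple; apply/funext. Qed.

Lemma lit_step (I : finType) (e : I -> set R) (h : R) n (c : n.-tuple I -> R) :
  (forall i, measurable (e i)) -> (forall i, lebesgue_measure (e i) = h%:E) ->
  0 <= h -> (forall a, 0 <= c a) ->
  lit (fun x : n.-tuple R => (\sum_(a : n.-tuple I) c a *
    \prod_(i < n) \1_(e (tnth a i)) (tnth x i))%:E) =
  (h ^+ n * \sum_(a : n.-tuple I) c a)%:E.
Proof.
move=> me he h0; elim: n c => [c c0|n IH c c0] /=.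
  rewrite expr0 mul1r; congr _%:E; apply: eq_bigr => a _.
  by rewrite big_ord0 mulr1.
have E x : lit (fun y : n.-tuple R => (\sum_(a : n.+1.-tuple I) c a *
    \prod_(i < n.+1) \1_(e (tnth a i)) (tnth [tuple of x :: y] i))%:E) =
    (\sum_(b : I) (h ^+ n * \sum_(a : n.-tuple I) c [tuple of b :: a]) * \1_(e b) x)%:E.
  pose c' (a : n.-tuple I) := \sum_(b : I) c [tuple of b :: a] * \1_(e b) x.
  transitivity (lit (fun y : n.-tuple R => (\sum_(a : n.-tuple I) c' a *
      \prod_(i < n) \1_(e (tnth a i)) (tnth y i))%:E)).
    apply: eq_lit => y; congr _%:E; rewrite big_tuple_cons exchange_big/=.
    apply: eq_bigr => a _; rewrite mulr_suml; apply: eq_bigr => b _.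
    rewrite big_ord_recl !tnth0 mulrA; congr (_ * _).
    by apply: eq_bigr => i _; rewrite !tnthS.
  rewrite IH; last by move=> a; apply: sumr_ge0 => b _; rewrite mulr_ge0.
  congr _%:E; rewrite exchange_big/= mulr_sumr; apply: eq_bigr => b _.
  by rewrite -mulrA mulr_suml.
under eq_integral => x _ do rewrite E -sumEFin.
rewrite ge0_integral_sum//; last 2 first.
- by move=> b; apply/measurable_EFinP; apply: measurable_funM => //; apply: measurable_indic; exact: me.
- by move=> b x _; rewrite lee_fin !mulr_ge0// ?exprn_ge0// sumr_ge0.
rewrite big_tuple_cons mulr_sumr -sumEFin; apply: eq_bigr => b _.
under eq_integral do rewrite EFinM.
rewrite ge0_integralZl//; last 2 first.
- by apply/measurable_EFinP; apply: measurable_indic; exact: me.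
- by rewrite lee_fin mulr_ge0 ?exprn_ge0 ?sumr_ge0.
rewrite integral_indic //; last exact: me.
rewrite setIT; transitivity ((h ^+ n * (\sum_(a : n.-tuple I) c [tuple of b :: a]))%:E * h%:E)%E.
  by congr (_ * _)%E; exact: he.
by rewrite -EFinM exprSr mulrAC.
Qed.

Variables (L q : nat).
Hypothesis q0 : (0 < q)%N.
Let h : R := q%:R^-1.
Let Q0 : 0 < q%:R :> R. Proof. by rewrite ltr0n. Qed.
Let h0 : 0 < h. Proof. by rewrite invr_gt0. Qed.

Definition mesh_cell (a : 'I_(L * q)) : set R := `[a%:R * h, a.+1%:R * h[.

Definition mesh_pt (a : 'I_(L * q)) : R := a%:R * h.

Lemma measure_mesh_cell a : lebesgue_measure (mesh_cell a) = h%:E.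
Proof.
rewrite lebesgue_measure_itv/= lte_fin ltr_pM2r// ltr_nat ltnSn -EFinB.
by rewrite -mulrBl -natrB// subSnn mul1r.
Qed.

Lemma mesh_cellP (x : R) : 0 <= x < L%:R -> exists a, mesh_cell a x.
Proof.
move=> /andP[x0 xL].
have xq : (Num.truncn (x * q%:R) < L * q)%N.
  rewrite -(ltr_nat R) natrM (@le_lt_trans _ _ (x * q%:R))//.
    by rewrite truncn_le mulr_ge0// ltW.
  by rewrite ltr_pM2r.
exists (Ordinal xq); rewrite /mesh_cell/= in_itv/=.
have /truncn_itv/andP[t1 t2] : 0 <= x * q%:R by rewrite mulr_ge0// ltW.
by rewrite /h ler_pdivrMr// t1 ltr_pdivlMr.
Qed.

Lemma mesh_cell_window a x : mesh_cell a x -> 0 <= x < L%:R.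
Proof.
rewrite /mesh_cell/= in_itv/= => /andP[ax xa].
rewrite (le_trans _ ax) ?mulr_ge0 ?(ltW h0)//= (lt_le_trans xa)//.
by rewrite ler_pdivrMr// -natrM ler_nat.
Qed.

Lemma mesh_cell_inj a b x : mesh_cell a x -> mesh_cell b x -> a = b.
Proof.
rewrite /mesh_cell/= !in_itv/= /h => /andP[a1 a2] /andP[b1 b2].
apply: val_inj; apply/eqP; rewrite eqn_leq.
have := le_lt_trans a1 b2; rewrite ltr_pM2r// ltr_nat ltnS => ->.
by have := le_lt_trans b1 a2; rewrite ltr_pM2r// ltr_nat ltnS => ->.
Qed.

Let step_sum n (c : n.-tuple 'I_(L * q) -> R) (x : n.-tuple R) a :
  (forall i, mesh_cell (tnth a i) (tnth x i)) ->
  \sum_(b : n.-tuple 'I_(L * q)) c b *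
    \prod_(i < n) \1_(mesh_cell (tnth b i)) (tnth x i) = c a.
Proof.
move=> ax; rewrite (bigD1 a)//= big1 ?mulr1 ?big1 ?addr0//.
  by move=> b ba; apply/eqP; rewrite mulf_eq0; apply/orP; right; apply/eqP;
    have [i iab] : exists i, tnth b i != tnth a i;
    [by apply/existsP; apply: contraNT ba; rewrite negb_exists => /forallP H;
       apply/eqP/eq_from_tnth => i; apply/eqP; rewrite -[_ == _]negbK
    |rewrite (bigD1 i)//= indicE memNset ?mul0r// => xb;
       by move: iab; rewrite (mesh_cell_inj xb (ax i)) eqxx].
by move=> i _; rewrite indicE mem_set.
Qed.

(** Step functions over the mesh squeeze the integrand, and their iterated
    integrals are explicit sums. *)
Lemma lit_sandwich n (F : n.-tuple R -> R) (lo hi : n.-tuple 'I_(L * q) -> R) :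
  (forall x, 0 <= F x) -> (forall a, 0 <= lo a) ->
  (forall x, ~ (forall i, 0 <= tnth x i < L%:R) -> F x = 0) ->
  (forall x a, (forall i, mesh_cell (tnth a i) (tnth x i)) -> lo a <= F x <= hi a) ->
  ((h ^+ n * \sum_(a : n.-tuple 'I_(L * q)) lo a)%:E <= lit (fun x => (F x)%:E)
   <= (h ^+ n * \sum_(a : n.-tuple 'I_(L * q)) hi a)%:E)%E.
Proof.
move=> F0 lo0 Fout Fin.
have mc a : measurable (mesh_cell a) by exact: measurable_itv.
have hi0 a : 0 <= hi a.
  have /Fin/andP[_] : forall i, mesh_cell (tnth a i) (tnth (map_tuple mesh_pt a) i).
    move=> i; rewrite tnth_map /mesh_cell/mesh_pt/= in_itv/= lexx/=.
    by rewrite ltr_pM2r// ltr_nat.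
  exact: le_trans.
have p0 (b : n.-tuple 'I_(L * q)) (x : n.-tuple R) :
    0 <= \prod_(i < n) \1_(mesh_cell (tnth b i)) (tnth x i) :> R.
  by apply: prodr_ge0 => i _.
have dich (x : n.-tuple R) : (exists a : n.-tuple 'I_(L * q),
      forall i, mesh_cell (tnth a i) (tnth x i)) \/
    ~ (forall i, 0 <= tnth x i < L%:R).
  have [xw|] := pselect (forall i, 0 <= tnth x i < L%:R); last by right.
  left; have /choice[f fx] : forall i, exists a, mesh_cell a (tnth x i).
    by move=> i; exact: mesh_cellP.
  by exists [tuple f i | i < n] => i; rewrite tnth_mktuple.
apply/andP; split.
  rewrite -(lit_step mc measure_mesh_cell (ltW h0) lo0); apply: le_lit => x.
    by rewrite lee_fin sumr_ge0// => a _; rewrite mulr_ge0.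
  rewrite lee_fin; have [[a xa]|xw] := dich x.
    by rewrite (step_sum _ xa); have /andP[] := Fin _ _ xa.
  rewrite big1 ?F0// => a _.
  have [/allP xa|/allPn[i _ xi]] := boolP (all (fun i => `[< mesh_cell (tnth a i) (tnth x i) >]) (enum 'I_n)).
    exfalso; apply: xw => i; apply: (@mesh_cell_window (tnth a i)).
    by apply/asboolP; apply: xa; rewrite mem_enum.
  by rewrite (bigD1 i)//= indicE memNset ?mul0r ?mulr0// => xai;
    move/asboolP: xi.
rewrite -(lit_step mc measure_mesh_cell (ltW h0) hi0); apply: le_lit => x.
  by rewrite lee_fin.
rewrite lee_fin; have [[a xa]|xw] := dich x.
  by rewrite (step_sum _ xa); have /andP[] := Fin _ _ xa.
by rewrite Fout// sumr_ge0// => a _; rewrite mulr_ge0.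
Qed.

End iterated_integrals.

Section sine_determinant.
Variable R : realType.

Definition sine_det n (x : n.-tuple R) : R :=
  \det (\matrix_(i < n, j < n) sine_kernel (tnth x i) (tnth x j)).

Lemma sine_matrixE n (x : n.-tuple R) :
  \matrix_(i < n, j < n) sine_kernel (tnth x i) (tnth x j) =
  sinch_mx 1 (tnth x) :> 'M[R]_n.
Proof. by apply/matrixP => i j; rewrite !mxE sine_kernelE. Qed.

Lemma sine_det_ge0 n (x : n.-tuple R) : 0 <= sine_det x.
Proof. by rewrite /sine_det sine_matrixE psd_det_ge0//; exact: psd_sinch_mx. Qed.

(** Hadamard's inequality: the diagonal entries are [1 / pi]. *)
Lemma sine_det_le n (x : n.-tuple R) : sine_det x <= pi^-1 ^+ n.
Proof.
rewrite /sine_det sine_matrixE (le_trans (hadamard (psd_sinch_mx _ _)))//.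
under eq_bigr do rewrite mxE subrr /sinch eqxx mulr1.
by rewrite prodr_const card_ord.
Qed.

Let invpi_le1 : pi^-1 <= 1 :> R.
Proof. by rewrite invf_le1 ?pi_gt0// (le_trans _ (pi_ge2 R))// ler1n. Qed.

Lemma sine_kernel_le1 (x y : R) : `|sine_kernel x y| <= 1.
Proof.
rewrite sine_kernelE normrM -[X in _ <= X]mulr1 ler_pM//; last exact: sinch_le1.
by rewrite ger0_norm ?invr_ge0 ?pi_ge0.
Qed.

Lemma sine_kernel_lipschitz (x y x' y' e : R) :
  `|x - x'| <= e -> `|y - y'| <= e -> `|sine_kernel x y - sine_kernel x' y'| <= 2 * e.
Proof.
move=> xe ye; rewrite !sine_kernelE -mulrBr normrM.
rewrite -[X in _ <= X]mul1r ler_pM//; first by rewrite ger0_norm ?invr_ge0 ?pi_ge0.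
apply: le_trans (sinch_lipschitz _ _) _.
move: xe ye; rewrite !ler_norml => /andP[a1 a2] /andP[b1 b2].
by apply/andP; split; lra.
Qed.

Lemma prod_lipschitz (I : Type) (r : seq I) (f g : I -> R) (e : R) :
  (forall i, `|f i| <= 1) -> (forall i, `|g i| <= 1) ->
  (forall i, `|f i - g i| <= e) ->
  `|\prod_(i <- r) f i - \prod_(i <- r) g i| <= (size r)%:R * e.
Proof.
move=> f1 g1 fg.
have le1 (s : seq I) (k : I -> R) : (forall i, `|k i| <= 1) -> `|\prod_(i <- s) k i| <= 1.
  move=> k1; rewrite normr_prod; apply: prodr_ile1 => i _.
  by rewrite normr_ge0 k1.
elim: r => [|i r IH]; first by rewrite !big_nil subrr normr0 mul0r.
rewrite !big_cons.
set P := \prod_(j <- r) f j; set Q := \prod_(j <- r) g j.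
have -> : f i * P - g i * Q = f i * (P - Q) + (f i - g i) * Q by ring.
rewrite (le_trans (ler_normD _ _))// !normrM -natr1 mulrDl mul1r lerD//.
  by rewrite -[X in _ <= X]mul1r ler_pM.
by rewrite -[e]mulr1 ler_pM// le1.
Qed.

(** A crude bound, permutation by permutation: any dependence of the constant on
    [n] is acceptable because the mesh tends to zero for fixed [n]. *)
Lemma sine_det_lipschitz n (x y : n.-tuple R) (e : R) :
  (forall i, `|tnth x i - tnth y i| <= e) ->
  `|sine_det x - sine_det y| <= n`!%:R * (n%:R * (2 * e)).
Proof.
move=> xy; rewrite /sine_det /determinant -sumrB.
apply: le_trans (ler_norm_sum _ _ _) _.
have -> : n`!%:R * (n%:R * (2 * e)) = \sum_(s : 'S_n) n%:R * (2 * e).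
  by rewrite sumr_const card_Sn mulr_natl.
apply: ler_sum => s _; rewrite -mulrBr normrM normrX normrN1 expr1n mul1r.
have sz : size (index_enum 'I_n) = n.
  by rewrite -[RHS]card_ord -sum1_card -sum1_size; exact: eq_bigl.
rewrite -[X in X%:R * _]sz; apply: prod_lipschitz => i; rewrite !mxE.
- exact: sine_kernel_le1.
- exact: sine_kernel_le1.
- exact: sine_kernel_lipschitz.
Qed.

End sine_determinant.

(** * Fredholm expansions and Riemann sums *)

Section determinant_expansion.
Variable R : numFieldType.

Lemma sum_sets_by_card (T : finType) (w : {set T} -> R) K : (#|T| < K)%N ->
  \sum_(J : {set T}) w J =
  \sum_(n < K) n`!%:R^-1 * \sum_(a : n.-tuple T | uniq a) w [set x in a].
Proof.
move=> TK.
have cJ (J : {set T}) : (#|J| < K)%N by rewrite (leq_ltn_trans (max_card _)).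
rewrite (partition_big (fun J : {set T} => Ordinal (cJ J)) xpredT)//=.
apply: eq_bigr => n _; rewrite sum_uniq_tuples mulrA mulVf ?mul1r; last first.
  by rewrite pnatr_eq0 -lt0n fact_gt0.
by apply: eq_bigl => J.
Qed.

(** The finite Fredholm expansion. The sum runs over all tuples since the minors
    with a repeated index vanish, and over orders up to any [K] beyond the
    size. *)
Lemma det_1D_expansion N (M : 'M[R]_N) K : (N < K)%N ->
  \det (1%:M + M) = \sum_(n < K) n`!%:R^-1 * \sum_(a : n.-tuple 'I_N)
    \det (\matrix_(i < n, j < n) M (tnth a i) (tnth a j)).
Proof.
move=> NK; rewrite det_1D_sum (sum_sets_by_card _ (K := K)) ?card_ord//.
apply: eq_bigr => n _; congr (_ * _); rewrite big_mkcond /=.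
apply: eq_bigr => a _; case: ifPn => ua; first by rewrite det_rows_from.
by rewrite det_minor_dup.
Qed.

End determinant_expansion.

Section window_functions.
Variable R : realType.

(** Functions of n points of [0, L) that only depend on the cells of the mesh
    1/q containing the points, for every q. *)
Definition window_fun (L n : nat) (w : n.-tuple R -> R) : Prop :=
  (forall x, ~ (forall i, 0 <= tnth x i < L%:R) -> w x = 0) /\
  (forall q x (a : n.-tuple 'I_(L * q)), (0 < q)%N ->
    (forall i, mesh_cell (tnth a i) (tnth x i)) -> w x = w (map_tuple (@mesh_pt R L q) a)).

Definition riemann_sum (L n q : nat) (w : n.-tuple R -> R) : R :=
  q%:R^-1 ^+ n * \sum_(a : n.-tuple 'I_(L * q))
    w (map_tuple (@mesh_pt R L q) a) * sine_det (map_tuple (@mesh_pt R L q) a).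

Lemma mesh_volume (L q n : nat) : (0 < q)%N ->
  q%:R^-1 ^+ n * \sum_(a : n.-tuple 'I_(L * q)) 1 = L%:R ^+ n :> R.
Proof.
move=> q0; rewrite sumr_const card_tuple card_ord -[1 *+ _]mulr_natr mul1r.
by rewrite natrX natrM -exprMn mulrCA mulVf ?mulr1// pnatr_eq0 -lt0n.
Qed.

(** The weight is constant on cells, so only the variation of the determinant
    inside a cell contributes to the error. *)
Lemma lit_riemann (L n : nat) (w : n.-tuple R -> R) (W : R) :
  window_fun L w -> (forall x, 0 <= w x <= W) ->
  exists2 T : R, lebesgue_integral_tuple (fun x => (w x * sine_det x)%:E) = T%:E &
  forall q, (0 < q)%N ->
    `|T - riemann_sum L q w| <= n`!%:R * (n%:R * (2 * q%:R^-1)) * (W * L%:R ^+ n).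
Proof.
move=> [wout wcell] wW.
pose F x := w x * sine_det x.
have w0 x : 0 <= w x by have /andP[] := wW x.
have W0 : 0 <= W.
  by have /andP[a b] := wW [tuple 0 | i < n]; exact: le_trans b.
have F0 x : 0 <= F x by rewrite mulr_ge0// sine_det_ge0.
have Fout x : ~ (forall i, 0 <= tnth x i < L%:R) -> F x = 0.
  by move=> /wout xw; rewrite /F xw mul0r.
pose delta q : R := n`!%:R * (n%:R * (2 * q%:R^-1)).
pose wa q (a : n.-tuple 'I_(L * q)) := w (map_tuple (@mesh_pt R L q) a).
pose ra q (a : n.-tuple 'I_(L * q)) : R := sine_det (map_tuple (@mesh_pt R L q) a).
have sand q : (0 < q)%N ->
  ((q%:R^-1 ^+ n * \sum_(a : n.-tuple 'I_(L * q)) wa q a * Num.max 0 (ra q a - delta q))%:E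
   <= lebesgue_integral_tuple (fun x => (F x)%:E) <=
   (q%:R^-1 ^+ n * \sum_(a : n.-tuple 'I_(L * q)) wa q a * (ra q a + delta q))%:E)%E.
  move=> q0; apply: lit_sandwich => //.
    by move=> a; apply: mulr_ge0; [exact: w0|rewrite le_max lexx].
  move=> x a xa; rewrite /F (wcell _ _ _ q0 xa) -/(wa q a) -/(ra q a).
  have : `|sine_det x - ra q a| <= delta q.
    apply: sine_det_lipschitz => i; rewrite tnth_map.
    have := xa i; rewrite /mesh_cell/mesh_pt/= in_itv/= -natr1 mulrDl mul1r.
    by move=> /andP[l u]; rewrite ger0_norm ?subr_ge0// lerBlDl ltW.
  rewrite ler_norml => /andP[l u].
  apply/andP; split; (apply: ler_wpM2l; first exact: w0).
    by rewrite ge_max sine_det_ge0 /=; lra.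
  by lra.
have [T TE] : exists T, lebesgue_integral_tuple (fun x => (F x)%:E) = T%:E.
  have /andP[l u] := sand 1%N isT.
  exists (fine (lebesgue_integral_tuple (fun x => (F x)%:E))).
  rewrite fineK// ge0_fin_numE; last by apply: lit_ge0 => x; rewrite lee_fin.
  by apply: le_lt_trans u _; rewrite ltry.
exists T => // q q0; have := sand q q0; rewrite TE !lee_fin => /andP[l u].
have d0 : 0 <= delta q by rewrite !mulr_ge0.
pose A := q%:R^-1 ^+ n * \sum_(a : n.-tuple 'I_(L * q)) wa q a.
have S1 : A <= W * L%:R ^+ n.
  rewrite /A -(mesh_volume L n q0) mulrCA; apply: ler_wpM2l.
    by rewrite exprn_ge0 ?invr_ge0.
  rewrite mulr_sumr ler_sum// => a _.
  by rewrite mulr1; have /andP[] := wW (map_tuple (@mesh_pt R L q) a).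
have E D : q%:R^-1 ^+ n * (\sum_(a : n.-tuple 'I_(L * q)) wa q a * (ra q a + D))
   = riemann_sum L q w + A * D.
  rewrite /riemann_sum /A -[X in _ + X]mulrA -mulrDr; congr (_ * _).
  rewrite mulr_suml -big_split/=; apply: eq_bigr => a _.
  by rewrite mulrDr.
have S2 := ler_wpM2r d0 S1; move: u l; rewrite E => u l.
have l2 : q%:R^-1 ^+ n * (\sum_(a : n.-tuple 'I_(L * q)) wa q a * (ra q a + - delta q)) <= T.
  apply: le_trans l; rewrite ler_wpM2l ?exprn_ge0 ?invr_ge0// ler_sum// => a _.
  by rewrite ler_wpM2l// /wa// le_max lexx orbT.
move: l2; rewrite E mulrN => l2; rewrite [leRHS]mulrC -/(delta q).
by move: (delta q) S2 u l2 => D S2 u l2; rewrite ler_norml; apply/andP; split; lra.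
Qed.

Lemma riemann_sum_le (L n q : nat) (w : n.-tuple R -> R) (W : R) : (0 < q)%N ->
  (forall x, `|w x| <= W) -> `|riemann_sum L q w| <= W * (L%:R / pi) ^+ n.
Proof.
move=> q0 wW; rewrite /riemann_sum normrM ger0_norm ?exprn_ge0 ?invr_ge0//.
have -> : W * (L%:R / pi) ^+ n = q%:R^-1 ^+ n *
    ((\sum_(a : n.-tuple 'I_(L * q)) 1) * (W * pi^-1 ^+ n)).
  by rewrite exprMn -(mesh_volume L n q0); ring.
apply: ler_wpM2l; first by rewrite exprn_ge0 ?invr_ge0.
rewrite mulr_suml.
rewrite (le_trans (ler_norm_sum _ _ _))// ler_sum// => a _.
rewrite normrM mul1r ler_pM// ger0_norm ?sine_det_ge0//.
exact: sine_det_le.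
Qed.

Lemma riemann_sumD (L n q : nat) (w w' : n.-tuple R -> R) :
  riemann_sum L q (fun x => w x + w' x) = riemann_sum L q w + riemann_sum L q w'.
Proof.
rewrite /riemann_sum -mulrDr -big_split/=; congr (_ * _).
by apply: eq_bigr => a _; rewrite mulrDl.
Qed.

End window_functions.

Section symbol.
Variables (R : realType) (d : nat) (s : 'I_d -> R) (n : 'I_d -> nat) (L : nat) (t : R).
Hypothesis nL : forall j, (n j <= L)%N.

(** The function [g] with [1 + g = expR (t * phi)], where [phi] is the step
    function counting each particle in [0, n j) with weight [s j]; it vanishes
    outside the window. *)
Definition symbol (x : R) : R :=
  (expR (t * \sum_j s j * (x < (n j)%:R)%R%:R) - 1) * (0 <= x < L%:R)%R%:R.

Let mesh_lt q (a : 'I_(L * q)) (m : nat) x : (0 < q)%N -> mesh_cell a x ->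
  (x < m%:R :> R) = (a < m * q)%N.
Proof.
move=> q0; rewrite /mesh_cell/= in_itv/= => /andP[ax xa].
have Q0 : 0 < q%:R :> R by rewrite ltr0n.
apply/idP/idP.
  by move=> /(le_lt_trans ax); rewrite ltr_pdivrMr// -natrM ltr_nat.
move=> am; apply: lt_le_trans xa _; rewrite ler_pdivrMr// -natrM ler_nat.
exact: am.
Qed.

Lemma symbol_mesh q (a : 'I_(L * q)) x : (0 < q)%N -> mesh_cell a x ->
  symbol x = expR (t * grid_phi s n L q 0 a) - 1.
Proof.
move=> q0 xa; rewrite /symbol (mesh_cell_window q0 xa) mulr1 mxE.
congr (expR (t * _) - 1).
by apply: eq_bigr => j _; rewrite (mesh_lt _ q0 xa).
Qed.

Lemma mesh_pt_cell q (a : 'I_(L * q)) : (0 < q)%N -> mesh_cell a (mesh_pt R a).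
Proof.
move=> q0; rewrite /mesh_cell/mesh_pt/= in_itv/= lexx/= ltr_pM2r ?invr_gt0 ?ltr0n//.
by rewrite ltr_nat.
Qed.

(** The tilted determinant is the Fredholm determinant of the sampled sine
    kernel; its terms are the Riemann sums of the correlation integrals. *)
Lemma grid_det_expansion q K : (0 < q)%N -> (L * q < K)%N ->
  \det (tilt_mx (grid_mx R L q) (grid_phi s n L q) t) =
  \sum_(m < K) m`!%:R^-1 *
    riemann_sum L q (fun x : m.-tuple R => \prod_(i < m) symbol (tnth x i)).
Proof.
move=> q0 LK; rewrite /tilt_mx (det_1D_expansion _ LK).
apply: eq_bigr => m _; congr (_ * _); rewrite /riemann_sum mulr_sumr.
apply: eq_bigr => a _.
have -> : \matrix_(i < m, j < m) ((exp_diag (grid_phi s n L q) t - 1%:M) *m grid_mx R L q)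
      (tnth a i) (tnth a j) =
    diag_mx (\row_i symbol (tnth (map_tuple (@mesh_pt R L q) a) i)) *m
    (q%:R^-1 *: \matrix_(i < m, j < m) sine_kernel
      (tnth (map_tuple (@mesh_pt R L q) a) i) (tnth (map_tuple (@mesh_pt R L q) a) j)).
  apply/matrixP => i j; rewrite mul_diag_mx [LHS]mxE [RHS]mxE.
  have -> : exp_diag (grid_phi s n L q) t - 1%:M =
      diag_mx (\row_b (expR (t * grid_phi s n L q 0 b) - 1)).
    by apply/matrixP => b c; rewrite !mxE mulrnBl.
  rewrite mul_diag_mx 2!mxE [grid_mx _ _ _ _ _]mxE [in RHS]mxE !tnth_map.
  rewrite (symbol_mesh q0 (mesh_pt_cell _ q0)); congr (_ * _).
  by rewrite 2!mxE !tnth_map sine_kernel_scale ?ltr0n.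
rewrite det_mulmx det_diag detZ -/(sine_det _) mulrCA; congr (_ * (_ * _)).
by apply: eq_bigr => i _; rewrite mxE.
Qed.

End symbol.

(** * Configurations seen through a bounded window *)

Lemma prod_1D_sum_sets (R : comNzRingType) (T : finType) (g : T -> R) :
  \prod_x (1 + g x) = \sum_(J : {set T}) \prod_(x in J) g x.
Proof.
under eq_bigr do rewrite addrC.
rewrite bigA_distr; apply: eq_bigr => J _.
by rewrite [RHS]big_mkcond.
Qed.

Section configurations_in_a_window.
Variables (R : realType) (L : nat).
Implicit Types X : config R.

Definition pts X : {fset R} := fset_set (particles X `&` `[0, L%:R[).

Lemma finite_window X : finite_set (particles X `&` `[0, L%:R[).
Proof.
apply: sub_finite_set (config_locally_finite X 0 L%:R) => x [Xx].
by rewrite /= !in_itv/= => /andP[-> /ltW ->]; split.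
Qed.

Lemma mem_pts X x : (x \in pts X) = `[< particles X x /\ 0 <= x < L%:R >].
Proof.
rewrite in_fset_set; last exact: finite_window.
by apply/idP/asboolP; rewrite inE/= in_itv.
Qed.

Lemma pts_window X (x : pts X) : 0 <= val x < L%:R.
Proof. by have := valP x; rewrite mem_pts => /asboolP[]. Qed.

Lemma npart_pts X (B : set R) : B `<=` `[0, L%:R[ ->
  npart B X = (\sum_(x : pts X) `[< B (val x) >])%N.
Proof.
move=> BL; rewrite /npart card_fset_sum1.
rewrite -(big_seq_fsetE _ _ xpredT (fun x => nat_of_bool `[< B x >])) /=.
have fB : finite_set (particles X `&` B).
  by apply: sub_finite_set (finite_window X) => x [Xx /BL].
rewrite -big_mkcond /= -[RHS]big_filter; apply: perm_big.
apply: uniq_perm; [exact: fset_uniq|exact/filter_uniq/fset_uniq|].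
move=> x; rewrite mem_filter mem_pts in_fset_set//; apply/idP/andP.
  rewrite inE => -[Xx Bx]; split; apply/asboolP => //; split => //.
  by have := BL x Bx; rewrite /= in_itv.
by move=> [/asboolP Bx /asboolP[Xx _]]; rewrite inE.
Qed.

(** The linear statistics of [n] distinct particles of the window, as a finite
    sum. *)
Definition tuple_sum n (w : n.-tuple R -> R) X : R :=
  \sum_(a : n.-tuple (pts X) | uniq a) w (map_tuple val a).

Lemma esum_distinct_tuples n (w : n.-tuple R -> R) X : (forall x, 0 <= w x) ->
  (forall x, ~ (forall i, 0 <= tnth x i < L%:R) -> w x = 0) ->
  (\esum_(x in @distinct_tuples R X n) (w x)%:E)%E = (tuple_sum w X)%:E.
Proof.
move=> w0 wout; pose e (a : n.-tuple (pts X)) : n.-tuple R := map_tuple val a.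
rewrite (esumID (e @` [set` (fun a : n.-tuple (pts X) => uniq a)]))/=; last first.
  by move=> x _; rewrite lee_fin.
rewrite [X in (_ + X)%E]esum1 ?adde0; last first.
  move=> x [[ux Xx] nx]; rewrite wout// => xw; apply: nx.
  have xp i : tnth x i \in pts X by rewrite mem_pts; apply/asboolP.
  have ex : e [tuple [` xp i]%fset | i < n] = x.
    by apply: eq_from_tnth => i; rewrite !tnth_map tnth_ord_tuple.
  exists [tuple [` xp i]%fset | i < n] => //=.
  rewrite unfold_in -(map_inj_uniq val_inj).
  by rewrite (_ : map _ _ = x)//; exact: (congr1 val ex).
rewrite [X in esum X _](_ : _ = e @` [set` (fun a : n.-tuple (pts X) => uniq a)]); last first.
  apply/seteqP; split => [x []//|_ [a /= ua <-]]; split; last by exists a.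
  split; first by rewrite map_inj_uniq//; exact: val_inj.
  by move=> i; rewrite tnth_map; have := valP (tnth a i); rewrite mem_pts => /asboolP[].
rewrite esum_image; last first.
  by move=> a b _ _ /(congr1 val)/= /(inj_map val_inj)/val_inj.
rewrite esum_fset//; last by move=> a _; rewrite lee_fin.
rewrite /tuple_sum -sumEFin; apply/esym; apply: bigfs.
  exact: index_enum_uniq.
by move=> a _; rewrite mem_index_enum.
Qed.

Lemma prod_uniq_tuple n (T : finType) (S : comNzRingType) (g : T -> S) (a : n.-tuple T) : uniq a ->
  \prod_(x in [set x in a]%SET) g x = \prod_(i < n) g (tnth a i).
Proof.
move=> ua; rewrite -(big_tuple _ _ a xpredT g) big_uniq//=.
by apply: eq_bigl => x; rewrite inE.
Qed.

Definition prod_fun n (g : R -> R) (x : n.-tuple R) : R := \prod_(i < n) g (tnth x i).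

Lemma tuple_sum_prod n (g : R -> R) X :
  tuple_sum (@prod_fun n g) X =
  \sum_(a : n.-tuple (pts X) | uniq a) \prod_(x in [set x in a]%SET) g (val x).
Proof.
apply: eq_bigr => a ua; rewrite (prod_uniq_tuple (fun x => g (val x)) ua).
by apply: eq_bigr => i _; rewrite tnth_map.
Qed.

(** Expanding the product over the subsets of the configuration, each counted
    once for every ordering; orders beyond the number of particles contribute
    nothing, so [K] may be any larger number. *)
Lemma prod_pts_expansion (g : R -> R) X K : (#|` pts X| < K)%N ->
  \prod_(x : pts X) (1 + g (val x)) =
  \sum_(n < K) n`!%:R^-1 * tuple_sum (@prod_fun n g) X.
Proof.
move=> XK; rewrite prod_1D_sum_sets (sum_sets_by_card _ (K := K)); last first.
  by rewrite -cardfE.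
by apply: eq_bigr => n _; rewrite tuple_sum_prod.
Qed.

(** The elementary symmetric functions of the values of a cellwise constant g
    are coefficients of a polynomial determined by the cell counts. *)
Lemma tuple_sum_coef n (g : R -> R) X :
  (forall c x, mesh_cell c x -> g x = g (@mesh_pt R L 1 c)) ->
  tuple_sum (@prod_fun n g) X =
  n`!%:R * (\prod_(c < L * 1) (1 + g (@mesh_pt R L 1 c) *: 'X) ^+ npart (@mesh_cell R L 1 c) X)`_n.
Proof.
move=> gc; rewrite tuple_sum_prod.
rewrite (sum_uniq_tuples n (fun J : {set pts X} => \prod_(x in J) g (val x))); congr (_ * _).
transitivity ((\prod_(x : pts X) (1 + g (val x) *: 'X : {poly R}))`_n).
  rewrite prod_1D_sum_sets coef_sum big_mkcond/=; apply: eq_bigr => J _.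
  rewrite scaler_prod prodr_const coefZ coefXn.
  by rewrite eq_sym; case: eqP => _; rewrite ?mulr1 ?mulr0.
congr (nth 0 (polyseq _) n).
pose F c : {poly R} := 1 + g (@mesh_pt R L 1 c) *: 'X.
transitivity (\prod_(x : pts X) \prod_(c < L * 1)
    (if `[< mesh_cell c (val x) >] then F c else 1)).
  apply: eq_bigr => x _.
  have [c xc] := @mesh_cellP R L 1 isT _ (pts_window x).
  rewrite (bigD1 c)//= asboolT// big1 ?mulr1 /F -?(gc _ _ xc)//.
  move=> b bc; rewrite asboolF// => xb.
  by move: bc; rewrite (@mesh_cell_inj R L 1 isT _ _ _ xb xc) eqxx.
rewrite exchange_big/=; apply: eq_bigr => c _.
rewrite -/(F c) -big_mkcond/= prodr_const; congr (_ ^+ _).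
rewrite npart_pts; last first.
  by move=> x /(@mesh_cell_window R L 1 isT); rewrite /= in_itv.
by rewrite -sum1_card big_mkcond/=; apply: eq_bigr => x _; rewrite unfold_in; case: ifP.
Qed.

Lemma measurable_npart_preimage (B : set R) k : measurable B -> bounded_subset B ->
  measurable [set X : configs R | npart B X = k].
Proof. by move=> mB bB; apply: sub_sigma_algebra; exists B, k. Qed.

Lemma measurable_fun_counts (I : finType) (B : I -> set R) (H : {ffun I -> nat} -> R) :
  (forall i, measurable (B i)) -> (forall i, bounded_subset (B i)) ->
  measurable_fun [set: configs R] (fun X => H [ffun i => npart (B i) X]).
Proof.
move=> mB bB _ Y mY; rewrite setTI.
have -> : (fun X : configs R => H [ffun i => npart (B i) X]) @^-1` Y =
    \bigcup_(v in [set: {ffun I -> nat}]) (if `[< Y (H v) >]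
      then \bigcap_(i in [set: I]) [set X | npart (B i) X = v i] else set0).
  apply/seteqP; split => [X /= YX|X [v _]].
    exists [ffun i => npart (B i) X] => //.
    by rewrite asboolT// => i _; rewrite /= ffunE.
  case: ifPn => // /asboolP Yv Xv /=.
  by rewrite (_ : [ffun i => npart (B i) X] = v)//; apply/ffunP => i; rewrite ffunE; exact: Xv.
apply: countable_bigcupT_measurable => [|v]; first exact: countableP.
case: ifP => _; last exact: measurable0.
apply: fin_bigcap_measurable => [|i _]; first exact: finite_finset.
exact: measurable_npart_preimage.
Qed.

Lemma bounded_window (B : set R) : B `<=` `[0, L%:R[ -> bounded_subset B.
Proof.
move=> BL; exists L%:R => x /BL; rewrite /= !in_itv/= => /andP[x0 /ltW xL].
by rewrite xL andbT (le_trans _ x0)// oppr_le0.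
Qed.

(** The sum over tuples is a function of finitely many cell counts, and the counts
    are measurable by the choice of the sigma-algebra. *)
Lemma measurable_tuple_sum n (g : R -> R) :
  (forall c x, mesh_cell c x -> g x = g (@mesh_pt R L 1 c)) ->
  measurable_fun [set: configs R] (fun X : configs R => tuple_sum (@prod_fun n g) X).
Proof.
move=> gc; pose B c := @mesh_cell R L 1 c.
pose H (v : {ffun 'I_(L * 1) -> nat}) : R :=
  n`!%:R * (\prod_(c < L * 1) (1 + g (@mesh_pt R L 1 c) *: 'X) ^+ v c)`_n.
rewrite (_ : (fun X => _) = fun X : configs R => H [ffun c => npart (B c) X]).
  apply: measurable_fun_counts => c; first exact: measurable_itv.
  by apply: bounded_window => x /(@mesh_cell_window R L 1 isT); rewrite /= in_itv.
apply/funext => X; rewrite tuple_sum_coef//; congr (_ * nth 0 (polyseq _) n).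
by apply: eq_bigr => c _; rewrite ffunE.
Qed.

Lemma tuple_sumD n (w w' : n.-tuple R -> R) X :
  tuple_sum (fun x => w x + w' x) X = tuple_sum w X + tuple_sum w' X.
Proof. by rewrite /tuple_sum -big_split. Qed.

End configurations_in_a_window.

(** * Expectations of multiplicative functionals *)

Section exponential_series.
Variable R : realType.

Lemma exp_partial_le (b : R) K : 0 <= b ->
  \sum_(n < K) n`!%:R^-1 * b ^+ n <= expR b.
Proof.
move=> b0; have := @is_cvg_series_exp_coeff R b.
have nd : nondecreasing_seq (series (exp_coeff b)).
  apply/nondecreasing_series => n _ _; rewrite /exp_coeff/=.
  by rewrite divr_ge0 ?exprn_ge0.
move=> /(nondecreasing_cvgn_le nd)/(_ K); apply: le_trans.
rewrite /series/= big_mkord ler_sum// => n _.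
by rewrite /exp_coeff/= mulrC.
Qed.

Lemma exp_tail (b e : R) : 0 <= b -> 0 < e -> exists K0, forall K, (K0 <= K)%N ->
  \sum_(K0 <= n < K) n`!%:R^-1 * b ^+ n <= e.
Proof.
move=> b0 e0; have /cvgrPdist_le/(_ e e0)[K0 _ HK] := @is_cvg_series_exp_coeff R b.
exists K0 => K KK; have /= := HK K0 (leqnn _).
rewrite -[limn _]/(expR b) => h.
have E k : series (exp_coeff b) k = \sum_(0 <= n < k) n`!%:R^-1 * b ^+ n.
  by rewrite /series/=; apply: eq_bigr => n _; rewrite /exp_coeff/= mulrC.
have := exp_partial_le K b0; rewrite -(big_mkord xpredT (fun n => n`!%:R^-1 * b ^+ n)).
rewrite (big_cat_nat (leq0n K0) KK)/= -E => h2.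
by move: h; rewrite ler_norml => /andP[_]; lra.
Qed.

(** Tannery's theorem: the majorant [b ^ n / n!], the same for all [q], makes the
    tails small, and [q] large takes care of the finitely many other terms. *)
Lemma tannery_bounds (b : R) (T C : nat -> R) (Rq : nat -> nat -> R) (Kq : nat -> nat)
    (E lo hi : R) :
  0 <= b -> (forall n, 0 <= C n) -> (forall n, `|T n| <= b ^+ n) ->
  (forall q n, (0 < q)%N -> `|Rq q n| <= b ^+ n) ->
  (forall q n, (0 < q)%N -> `|T n - Rq q n| <= C n / q%:R) ->
  (fun K => \sum_(n < K) n`!%:R^-1 * T n) @ \oo --> E ->
  (forall q K, (0 < q)%N -> (Kq q < K)%N ->
    lo <= \sum_(n < K) n`!%:R^-1 * Rq q n <= hi) ->
  lo <= E <= hi.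
Proof.
move=> b0 C0 Tb Rb TR TE lohi.
have f0 n : 0 <= n`!%:R^-1 :> R by rewrite invr_ge0.
have key e : 0 < e -> \forall K \near \oo, lo - e <= \sum_(n < K) n`!%:R^-1 * T n <= hi + e.
  move=> e0; have e30 : 0 < e / 3 by rewrite divr_gt0.
  have [K0 HK0] := exp_tail b0 e30.
  pose S := \sum_(n < K0) n`!%:R^-1 * C n.
  have S0 : 0 <= S by apply: sumr_ge0 => n _; rewrite mulr_ge0.
  pose q := (Num.truncn (S / (e / 3))).+1.
  have Q0 : 0 < q%:R :> R by rewrite ltr0n.
  have Sq : S / q%:R <= e / 3.
    rewrite ler_pdivrMr// mulrC -ler_pdivrMr// ltW//.
    by have /truncn_itv/andP[] : 0 <= S / (e / 3) by rewrite divr_ge0// ltW.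
  exists (maxn (Kq q).+1 K0) => // K /=; rewrite geq_max => /andP[KqK K0K].
  have /andP[l h] := lohi q K isT KqK.
  suff : `|\sum_(n < K) n`!%:R^-1 * T n - \sum_(n < K) n`!%:R^-1 * Rq q n| <= e.
    by rewrite ler_norml => /andP[d1 d2]; apply/andP; split; lra.
  rewrite -sumrB (le_trans (ler_norm_sum _ _ _))//.
  rewrite -(big_mkord xpredT (fun n => `|n`!%:R^-1 * T n - n`!%:R^-1 * Rq q n|)).
  rewrite (big_cat_nat (leq0n K0) K0K)/=.
  have P1 : \sum_(0 <= n < K0) `|n`!%:R^-1 * T n - n`!%:R^-1 * Rq q n| <= e / 3.
    rewrite big_mkord (le_trans _ Sq)// /S mulr_suml ler_sum// => n _.
    by rewrite -mulrBr normrM ger0_norm// -mulrA ler_wpM2l// TR.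
  have P2 : \sum_(K0 <= n < K) `|n`!%:R^-1 * T n - n`!%:R^-1 * Rq q n| <= 2 * (e / 3).
    apply: le_trans (_ : _ <= 2 * \sum_(K0 <= n < K) n`!%:R^-1 * b ^+ n) _.
      rewrite mulr_sumr ler_sum// => n _.
      rewrite -mulrBr normrM ger0_norm// mulrCA ler_wpM2l//.
      rewrite (le_trans (ler_normB _ _))// mulr_natl mulr2n lerD ?Tb ?Rb//.
    by rewrite ler_wpM2l// HK0.
  by lra.
apply/andP; split; apply/ler_addgt0Pr => e /key near_e.
  by rewrite -lerBlDr; apply: (cvgr_to_ge TE); apply: filterS near_e => K /andP[].
by apply: (cvgr_to_le TE); apply: filterS near_e => K /andP[].
Qed.

End exponential_series.

Section laplace_transform.
Variables (R : realType) (P : probability (configs R) R).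
Hypothesis hP : is_sine_process P.
Variables (L : nat) (g : R -> R) (c : R).
Hypotheses (mg : measurable_fun setT g) (gc : forall x, `|g x| <= c).
Hypothesis gout : forall x, ~ (0 <= x < L%:R) -> g x = 0.
Hypothesis gcell : forall q (a : 'I_(L * q)) x, (0 < q)%N -> mesh_cell a x ->
  g x = g (mesh_pt R a).

Let c0 : 0 <= c. Proof. exact: le_trans (gc 0). Qed.

(** The defining property of the correlation functions, followed by the
    comparison of the correlation integral with its Riemann sums. *)
Let expect_window n (w : n.-tuple R -> R) W : measurable_fun setT w ->
  window_fun L w -> (forall x, 0 <= w x <= W) ->
  exists2 T : R, (\int[P]_X (tuple_sum L w X)%:E)%E = T%:E &
  forall q, (0 < q)%N -> `|T - riemann_sum L q w| <=
     n`!%:R * (n%:R * 2) * (W * L%:R ^+ n) / q%:R.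
Proof.
move=> mw ww wW; have [T TE TR] := lit_riemann ww wW.
have w0 x : 0 <= w x by have /andP[] := wW x.
exists T.
  rewrite -TE -(hP (n := n) mw w0); apply: eq_integral => X _.
  by rewrite (esum_distinct_tuples _ w0 ww.1).
move=> q q0; apply: le_trans (TR q q0) _.
by rewrite le_eqVlt; apply/orP; left; apply/eqP; ring.
Qed.

Let prod_norm n (x : n.-tuple R) : prod_fun (fun y => `|g y|) x = `|prod_fun g x|.
Proof. by rewrite /prod_fun normr_prod. Qed.

Let prod_le n (x : n.-tuple R) : `|prod_fun g x| <= c ^+ n.
Proof.
rewrite normr_prod; apply: (@le_trans _ _ (\prod_(i < n) c)).
  by apply: ler_prod => i _; rewrite normr_ge0 gc.
by rewrite prodr_const card_ord.
Qed.

Let prod_out n (x : n.-tuple R) : ~ (forall i, 0 <= tnth x i < L%:R) ->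
  prod_fun g x = 0.
Proof.
move=> xw; have [i xi] : exists i, ~ (0 <= tnth x i < L%:R).
  by apply/existsNP.
by rewrite /prod_fun (bigD1 i)//= gout// mul0r.
Qed.

Let prod_cell n q x (a : n.-tuple 'I_(L * q)) : (0 < q)%N ->
  (forall i, mesh_cell (tnth a i) (tnth x i)) ->
  prod_fun g x = prod_fun g (map_tuple (@mesh_pt R L q) a).
Proof.
move=> q0 xa; apply: eq_bigr => i _.
by rewrite tnth_map; exact: gcell.
Qed.

Let measurable_prod_fun n : measurable_fun setT (fun x : n.-tuple R => prod_fun g x).
Proof.
apply: measurable_prod => i _.
by apply: (measurableT_comp mg); exact: measurable_tnth.
Qed.

Let beta : R := c * (L%:R / pi).

Let beta0 : 0 <= beta.
Proof. by rewrite mulr_ge0// divr_ge0// pi_ge0. Qed.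

Let abs_cell cc x : @mesh_cell R L 1 cc x -> `|g x| = `|g (mesh_pt R cc)|.
Proof. by move=> xc; rewrite (@gcell 1%N cc x isT xc). Qed.

Let expect_abs n : exists2 T : R,
  (\int[P]_X (tuple_sum L (@prod_fun R n (fun y => `|g y|)) X)%:E)%E = T%:E &
  0 <= T <= beta ^+ n /\
  forall q, (0 < q)%N -> `|T - riemann_sum L q (@prod_fun R n (fun y => `|g y|))| <=
     n`!%:R * (n%:R * 2) * (c ^+ n * L%:R ^+ n) / q%:R.
Proof.
have [|||T TE TR] := @expect_window n (@prod_fun R n (fun y => `|g y|)) (c ^+ n).
- rewrite (_ : @prod_fun _ _ _ = Num.norm \o (fun x : n.-tuple R => prod_fun g x)).
    by apply: measurableT_comp; [exact: normr_measurable|exact: measurable_prod_fun].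
  by apply/funext => x; rewrite prod_norm.
- split=> [x xw|q x a q0 xa]; rewrite !prod_norm.
    by rewrite prod_out// normr0.
  by rewrite (prod_cell q0 xa).
- by move=> x; rewrite prod_norm normr_ge0 prod_le.
exists T => //; split=> //; apply/andP; split.
  rewrite -lee_fin -TE integral_ge0// => X _; rewrite lee_fin sumr_ge0// => a _.
  by rewrite prod_norm.
apply/ler_addgt0Pr => e e0.
pose S := n`!%:R * (n%:R * 2) * (c ^+ n * L%:R ^+ n).
have S0 : 0 <= S by rewrite !mulr_ge0// exprn_ge0.
pose q := (Num.truncn (S / e)).+1.
have Sq : S / q%:R <= e.
  rewrite ler_pdivrMr ?ltr0n// mulrC -ler_pdivrMr// ltW//.
  by have /truncn_itv/andP[] : 0 <= S / e by rewrite divr_ge0// ltW.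
have := le_trans (TR q isT) Sq.
have := @riemann_sum_le R L n q (@prod_fun R n (fun y => `|g y|)) (c ^+ n) isT.
rewrite -exprMn -/beta => h; have {}h := h _.
move: h => /(_ _)/le_trans h.
rewrite ler_norml => /andP[_ h1].
have h2 : riemann_sum L q (@prod_fun R n (fun y => `|g y|)) <= beta ^+ n.
  by apply: (le_trans (ler_norm _)); apply: h => // x; rewrite prod_norm normr_id prod_le.
by lra.
Qed.

Let tuple_sum_abs n X :
  `|tuple_sum L (@prod_fun R n g) X| <= tuple_sum L (@prod_fun R n (fun y => `|g y|)) X.
Proof.
rewrite (le_trans (ler_norm_sum _ _ _))// ler_sum// => a _.
by rewrite prod_norm.
Qed.

Let measurable_U n : measurable_fun [set: configs R]
  (fun X : configs R => tuple_sum L (@prod_fun R n g) X).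
Proof. by apply: measurable_tuple_sum => cc x; exact: gcell. Qed.

Let measurable_Uabs n : measurable_fun [set: configs R]
  (fun X : configs R => tuple_sum L (@prod_fun R n (fun y => `|g y|)) X).
Proof. by apply: measurable_tuple_sum => cc x; exact: abs_cell. Qed.

Let Uabs_ge0 n X : 0 <= tuple_sum L (@prod_fun R n (fun y => `|g y|)) X.
Proof. exact: le_trans (tuple_sum_abs n X). Qed.

Let integrable_Uabs n : P.-integrable setT
  (EFin \o (fun X : configs R => tuple_sum L (@prod_fun R n (fun y => `|g y|)) X)).
Proof.
apply/integrableP; split; first exact/measurable_EFinP.
have [T TE _] := expect_abs n.
under eq_integral => X _ do rewrite /= ger0_norm ?Uabs_ge0//.
by rewrite TE ltry.
Qed.

Let integrable_U n : P.-integrable setT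
  (EFin \o (fun X : configs R => tuple_sum L (@prod_fun R n g) X)).
Proof.
apply: le_integrable (integrable_Uabs n) => //; first exact/measurable_EFinP.
by move=> X _; rewrite /= lee_fin [leRHS]ger0_norm ?Uabs_ge0// tuple_sum_abs.
Qed.

(** Correlation functions only control nonnegative test functions; write
    prod g = (|prod g| + prod g) - |prod g|. *)
Let expect_signed n : exists2 T : R,
  (\int[P]_X (tuple_sum L (@prod_fun R n g) X)%:E)%E = T%:E &
  `|T| <= beta ^+ n /\
  forall q, (0 < q)%N -> `|T - riemann_sum L q (@prod_fun R n g)| <=
     3 * (n`!%:R * (n%:R * 2) * (c ^+ n * L%:R ^+ n)) / q%:R.
Proof.
have [T1 T1E [/andP[T10 T1b] T1R]] := expect_abs n.
pose w x := @prod_fun R n (fun y => `|g y|) x + @prod_fun R n g x.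
have [|||T2 T2E T2R] := @expect_window n w (2 * c ^+ n).
- rewrite /w; apply: measurable_funD; last exact: measurable_prod_fun.
  rewrite (_ : @prod_fun _ _ _ = Num.norm \o (fun x : n.-tuple R => prod_fun g x)).
    by apply: measurableT_comp; [exact: normr_measurable|exact: measurable_prod_fun].
  by apply/funext => x; rewrite prod_norm.
- split=> [x xw|q x a q0 xa]; rewrite /w !prod_norm.
    by rewrite prod_out// normr0 addr0.
  by rewrite (prod_cell q0 xa).
- move=> x; rewrite /w prod_norm; have := prod_le x.
  move: (prod_fun g x) => y yc; have := ler_norm y; have := ler_norm (- y).
  by rewrite normrN => h1 h2; apply/andP; split; lra.
have E : (\int[P]_X (tuple_sum L (@prod_fun R n g) X)%:E)%E = (T2 - T1)%:E.
  rewrite EFinB -T2E -T1E.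
  under [X in (X - _)%E]eq_integral => X _ do rewrite tuple_sumD EFinD.
  rewrite integralD_EFin//.
  by rewrite addeAC subee ?add0e// T1E.
exists (T2 - T1) => //; split.
  rewrite -lee_fin (_ : (`|T2 - T1|%:E = `| (T2 - T1)%:E |)%E)// -E.
  apply: le_trans (le_abse_integral P measurableT _) _.
    exact/measurable_EFinP.
  apply: (@le_trans _ _ T1%:E); last by rewrite lee_fin.
  rewrite -T1E; apply: ge0_le_integral_nomeas => X; first exact: abse_ge0.
  by rewrite lee_fin tuple_sum_abs.
move=> q q0; have R1 := T1R q q0; have := T2R q q0.
rewrite /w riemann_sumD; move: R1.
set r1 := riemann_sum _ _ _; set r2 := riemann_sum _ _ _ => R1 R2.
set S := n`!%:R * _ * _ in R1.
have E2 : n`!%:R * (n%:R * 2) * (2 * c ^+ n * L%:R ^+ n) / q%:R = 2 * (S / q%:R).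
  by rewrite /S; ring.
rewrite E2 in R2.
have -> : T2 - T1 - r2 = (T2 - (r1 + r2)) - (T1 - r1) by ring.
rewrite (le_trans (ler_normB _ _))//.
have -> : 3 * S / q%:R = 2 * (S / q%:R) + S / q%:R by ring.
exact: lerD.
Qed.

Let Z (h : R -> R) X := \prod_(x : pts L X) (1 + h (val x)).

Let partial_cvg h X :
  (fun K => \sum_(n < K) n`!%:R^-1 * tuple_sum L (@prod_fun R n h) X) @ \oo --> Z h X.
Proof.
apply: cvg_near_cst; exists (#|` pts L X|.+1) => // K /= XK.
by rewrite -prod_pts_expansion.
Qed.

Let measurable_partial K : measurable_fun [set: configs R]
  (fun X : configs R => \sum_(n < K) n`!%:R^-1 * tuple_sum L (@prod_fun R n g) X).
Proof. by apply: measurable_sum => n; apply: measurable_funM. Qed.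

Let measurable_partial_abs K : measurable_fun [set: configs R]
  (fun X : configs R => \sum_(n < K) n`!%:R^-1 *
     tuple_sum L (@prod_fun R n (fun y => `|g y|)) X).
Proof. by apply: measurable_sum => n; apply: measurable_funM. Qed.

(** Summing the bounds [beta ^ n / n!] on the expected terms of the expansion of
    [\prod (1 + |g|)]; this product then dominates the partial sums of the
    signed expansion. *)
Let integrable_Zabs : P.-integrable setT
   (EFin \o (fun X : configs R => Z (fun y => `|g y|) X)).
Proof.
have Z0 X : 0 <= Z (fun y => `|g y|) X.
  by apply: prodr_ge0 => x _; rewrite addr_ge0.
apply/integrableP; split.
  apply/measurable_EFinP; apply: (measurable_fun_cvg measurable_partial_abs).
  by move=> X _; exact: partial_cvg.
under eq_integral => X _ do rewrite /= ger0_norm//.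
pose f n X := (n`!%:R^-1 * tuple_sum L (@prod_fun R n (fun y => `|g y|)) X)%:E.
have fi n : (\int[P]_X f n X)%E = (n`!%:R^-1%:E * \int[P]_X (tuple_sum L (@prod_fun R n (fun y => `|g y|)) X)%:E)%E.
  rewrite /f; under eq_integral do rewrite EFinM.
  rewrite ge0_integralZl_EFin//.
  - by move=> X _; rewrite lee_fin Uabs_ge0.
  - exact/measurable_EFinP.
apply: (@le_lt_trans _ _ (expR beta)%:E); last exact: ltry.
have -> : (\int[P]_X (Z (fun y => `|g y|) X)%:E = \int[P]_X \sum_(n <oo) f n X)%E.
  apply: eq_integral => X _; apply/esym/cvg_lim => //.
  rewrite (_ : (fun K => _) = (fun K => (\sum_(n < K) n`!%:R^-1 *
    tuple_sum L (@prod_fun R n (fun y => `|g y|)) X)%:E)).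
    by apply: cvg_EFin; [exact: nearW|exact: partial_cvg].
  by apply/funext => K; rewrite big_mkord -sumEFin.
rewrite integral_nneseries//; last 2 first.
- move=> n; apply/measurable_EFinP; exact: measurable_funM.
- by move=> n X _; rewrite lee_fin mulr_ge0 ?invr_ge0 ?Uabs_ge0.
apply: lime_le.
  apply: is_cvg_nneseries => n _ _; apply: integral_ge0 => X _.
  by rewrite lee_fin mulr_ge0 ?invr_ge0 ?Uabs_ge0.
apply: nearW => K; rewrite big_mkord.
apply: (@le_trans _ _ (\sum_(n < K) n`!%:R^-1 * beta ^+ n)%:E).
  rewrite -sumEFin; apply: lee_sum => n _; rewrite fi.
  have [T -> [/andP[T0 Tb] _]] := expect_abs n.
  by rewrite -EFinM lee_fin ler_wpM2l ?invr_ge0.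
by rewrite lee_fin exp_partial_le.
Qed.

Let partial_le K X :
  `|\sum_(n < K) n`!%:R^-1 * tuple_sum L (@prod_fun R n g) X| <= Z (fun y => `|g y|) X.
Proof.
rewrite /Z (@prod_pts_expansion R L (fun y => `|g y|) X (maxn K (#|` pts L X|.+1))); last first.
  by rewrite leq_max ltnSn orbT.
rewrite (le_trans (ler_norm_sum _ _ _))//.
rewrite -(big_mkord xpredT (fun n => `|n`!%:R^-1 * tuple_sum L (@prod_fun R n g) X|)).
rewrite -(big_mkord xpredT (fun n => n`!%:R^-1 *
  tuple_sum L (@prod_fun R n (fun y => `|g y|)) X)).
rewrite [leRHS](big_cat_nat (leq0n K))/=; last by rewrite leq_max leqnn.
rewrite ler_wpDr//; first by apply: sumr_ge0 => n _; rewrite mulr_ge0 ?invr_ge0 ?Uabs_ge0.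
apply: ler_sum => n _; rewrite normrM ger0_norm ?invr_ge0//.
by rewrite ler_wpM2l ?invr_ge0// tuple_sum_abs.
Qed.

(** Bounds that hold for all the Fredholm expansions over meshes pass to the
    expectation of the multiplicative functional. *)
Lemma multiplicative_functional_bounds lo hi :
  (forall q K, (0 < q)%N -> (L * q < K)%N ->
    lo <= \sum_(n < K) n`!%:R^-1 * riemann_sum L q (@prod_fun R n g) <= hi) ->
  P.-integrable setT (EFin \o (fun X : configs R => \prod_(x : pts L X) (1 + g (val x)))) /\
  (lo%:E <= \int[P]_X (\prod_(x : pts L X) (1 + g (val x)))%:E <= hi%:E)%E.
Proof.
move=> lohi.
have mZ : measurable_fun [set: configs R] (fun X : configs R => Z g X).
  apply: (measurable_fun_cvg measurable_partial).
  by move=> X _; exact: partial_cvg.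
have [iZ _ cZ] : [/\ P.-integrable setT (EFin \o (fun X : configs R => Z g X)),
   [sequence \int[P]_X `|(\sum_(n < K) n`!%:R^-1 * tuple_sum L (@prod_fun R n g) X)%:E - (Z g X)%:E|]_K @ \oo --> 0 &
   [sequence \int[P]_X (\sum_(n < K) n`!%:R^-1 * tuple_sum L (@prod_fun R n g) X)%:E]_K @ \oo
     --> \int[P]_X (Z g X)%:E]%E.
  apply: dominated_convergence integrable_Zabs _ => //.
  - by move=> K; exact/measurable_EFinP.
  - exact/measurable_EFinP.
  - apply: aeW => X _; apply: cvg_EFin; [exact: nearW|exact: partial_cvg].
  - by apply: aeW => X K _; rewrite /= lee_fin partial_le.
split=> //.
have /boolp.choice[T TE] : forall n, exists T : R,
  [/\ (\int[P]_X (tuple_sum L (@prod_fun R n g) X)%:E)%E = T%:E,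
  `|T| <= beta ^+ n &
  forall q, (0 < q)%N -> `|T - riemann_sum L q (@prod_fun R n g)| <=
     3 * (n`!%:R * (n%:R * 2) * (c ^+ n * L%:R ^+ n)) / q%:R].
  by move=> n; have [T ? []] := expect_signed n; exists T.
have [E EE] : exists E, (\int[P]_X (Z g X)%:E)%E = E%:E.
  by exists (fine (\int[P]_X (Z g X)%:E)%E); rewrite fineK//; exact: integrable_fin_num.
rewrite EE !lee_fin.
apply: (tannery_bounds (b := beta) (T := T)
  (C := fun n => 3 * (n`!%:R * (n%:R * 2) * (c ^+ n * L%:R ^+ n)))
  (Rq := fun q n => riemann_sum L q (@prod_fun R n g)) (Kq := fun q => (L * q)%N)) => //.
- by move=> n; rewrite !mulr_ge0 ?exprn_ge0.
- by move=> n; have [] := TE n.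
- by move=> q n q0; rewrite exprMn; apply: riemann_sum_le => // x; exact: prod_le.
- by move=> q n q0; have [_ _] := TE n; exact.
- rewrite EE in cZ; move/fine_cvgP : cZ => [_].
  rewrite (_ : (fun K => _) = fine \o (fun K => (\int[P]_X (\sum_(n < K) n`!%:R^-1 *
     tuple_sum L (@prod_fun R n g) X)%:E)%E)); first exact.
  apply/funext => K /=; apply: EFin_inj; rewrite fineK; last first.
    apply: integrable_fin_num => //.
    apply: (le_integrable measurableT _ _ integrable_Zabs).
      by apply/measurable_EFinP; exact: (measurable_partial K).
    move=> X _; rewrite /= lee_fin [leRHS]ger0_norm ?partial_le//.
    by rewrite prodr_ge0// => x _; rewrite addr_ge0.
  under eq_integral do rewrite -sumEFin.
  rewrite integral_sum//; last first.
    move=> n; under eq_fun do rewrite EFinM.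
    by apply: integrableZl => //; exact: integrable_U.
  rewrite -sumEFin; apply: eq_bigr => n _.
  under eq_integral do rewrite EFinM.
  rewrite integralZl//; last exact: integrable_U.
  by have [-> _ _] := TE n; rewrite EFinM.
Qed.

End laplace_transform.

(** * Laplace transforms of counts of the sine process *)

Section counts.
Variables (R : realType) (P : probability (configs R) R).
Hypothesis hP : is_sine_process P.

(** The main term of [pi ^ 2] times the variance of the sum of [s j] times the
    number of particles in [0, n j). *)
Definition log_var (d : nat) (s : 'I_d -> R) (n : 'I_d -> nat) : R :=
  \sum_i \sum_j s i * s j * ((ln (n i)%:R + ln (n j)%:R - ln (gap (n i) (n j))%:R) / 2).

(** The Fredholm expansions over all meshes obey the same bounds, which involve
    the mean exactly and the variance up to a bounded error. *)
Lemma laplace_count_bounds d (s : 'I_d -> R) (n : 'I_d -> nat) (t : R) : 0 <= t ->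
  let B := \sum_j `|s j| in
  let m := t * \sum_j s j * (n j)%:R / pi in
  let C := 3 * (pi + 4) * B ^+ 2 in
  let S (X : configs R) := \sum_j s j * npartR `[0, (n j)%:R[ X in
  P.-integrable setT (fun X => (expR (t * S X))%:E) /\
  ((expR (m + expR (- (2 * B * t)) * ((log_var s n - C) / pi ^+ 2) * t ^+ 2 / 2))%:E
   <= \int[P]_X (expR (t * S X))%:E <=
   (expR (m + expR (2 * B * t) * ((log_var s n + C) / pi ^+ 2) * t ^+ 2 / 2))%:E)%E.
Proof.
move=> t0 B m C S.
(* any bound of all the [n j] would do *)
pose L := (\sum_j n j)%N.
have nL j : (n j <= L)%N by rewrite /L (bigD1 j)//= leq_addr.
pose g := symbol s n L t.
have B0 : 0 <= B by exact: sumr_ge0.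
have sB x : `|t * \sum_j s j * (x < (n j)%:R :> R)%R%:R| <= t * B.
  rewrite normrM ger0_norm// ler_wpM2l// (le_trans (ler_norm_sum _ _ _))//.
  by apply: ler_sum => j _; rewrite normrM ler_piMr// normr_nat lern1 leq_b1.
have gc x : `|g x| <= expR (t * B) + 1.
  rewrite /g /symbol normrM; case: (_ <= _ < _); last first.
    by rewrite normr0 mulr0 addr_ge0 ?expR_ge0.
  rewrite normr1 mulr1 (le_trans (ler_normB _ _))// normr1 lerD2r.
  rewrite ger0_norm ?expR_ge0// ler_expR (le_trans (ler_norm _))//.
have mg : measurable_fun setT g.
  rewrite (_ : g = fun x => (expR (t * \sum_j s j * \1_(`]-oo, (n j)%:R[ : set R) x) - 1)
     * \1_(`[0, L%:R[ : set R) x).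
    apply: measurable_funM; last exact: measurable_indic.
    apply: measurable_funB => //; apply: measurableT_comp; first exact: measurable_expR.
    apply: measurable_funM => //; apply: measurable_sum => j.
    by apply: measurable_funM => //; exact: measurable_indic.
  apply/funext => x; rewrite /g /symbol !indicE; congr (_ * _%:R); last first.
    by rewrite mem_setE in_itv.
  congr (expR (t * _) - 1); apply: eq_bigr => j _; congr (_ * _%:R).
  by rewrite mem_setE in_itv.
have gout x : ~ (0 <= x < L%:R) -> g x = 0.
  by move=> /negP/negbTE xL; rewrite /g /symbol xL mulr0.
have gcell q (a : 'I_(L * q)) x : (0 < q)%N -> mesh_cell a x -> g x = g (mesh_pt R a).
  move=> q0 xa; rewrite /g (symbol_mesh _ _ _ q0 xa).
  by rewrite (symbol_mesh _ _ _ q0 (mesh_pt_cell R a q0)).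
have E X : \prod_(x : pts L X) (1 + g (val x)) = expR (t * S X).
  transitivity (\prod_(x : pts L X) expR (t * \sum_j s j * (val x < (n j)%:R)%R%:R)).
    apply: eq_bigr => x _; rewrite /g /symbol (pts_window x) mulr1.
    by rewrite addrC subrK.
  rewrite -expR_sum -mulr_sumr exchange_big/=; congr (expR (t * _)).
  apply: eq_bigr => j _; rewrite -mulr_sumr; congr (_ * _).
  rewrite /npartR (@npart_pts R L); last first.
    move=> x; rewrite /= !in_itv/= => /andP[-> xn]/=.
    by rewrite (lt_le_trans xn)// ler_nat.
  rewrite natr_sum; apply: eq_bigr => x _; congr (_%:R); congr nat_of_bool.
  apply/idP/asboolP; rewrite /= in_itv/=; last by case/andP.
  by move=> ->; have /andP[-> _] := pts_window x.
have [|iZ bZ] := @multiplicative_functional_bounds R P hP L g _ mg gc gout gcell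
  (expR (m + expR (- (2 * B * t)) * ((log_var s n - C) / pi ^+ 2) * t ^+ 2 / 2))
  (expR (m + expR (2 * B * t) * ((log_var s n + C) / pi ^+ 2) * t ^+ 2 / 2)).
  move=> q K q0 LK; rewrite -(grid_det_expansion s n t q0 LK).
  by have [l u] := grid_det_bounds s nL q0 t0; rewrite l u.
split.
  apply: eq_integrable iZ => // X _ /=; by rewrite E.
by move: bZ; under eq_integral do rewrite E.
Qed.

(** The first correlation function of the process is the constant [1 / pi]. *)
Lemma expect_npart (L : nat) (B : set R) : measurable B -> B `<=` `[0, L%:R[ ->
  (\int[P]_X (npartR B X)%:E = (pi^-1)%:E * lebesgue_measure B)%E.
Proof.
move=> mB BL.
pose w (x : 1.-tuple R) : R := \1_B (tnth x ord0).
have mw : measurable_fun setT w.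
  by apply: (measurableT_comp (measurable_indic mB)); exact: measurable_tnth.
have w0 x : 0 <= w x by rewrite /w.
have wout x : ~ (forall i, 0 <= tnth x i < L%:R) -> w x = 0.
  move=> xL; rewrite /w indicE memNset// => /BL; rewrite /= in_itv/= => xB; apply: xL => i.
  by rewrite (ord1 i).
have := hP mw w0.
under [X in X = _ -> _]eq_integral => X _ do rewrite (esum_distinct_tuples _ w0 wout).
have -> : (fun X : configs R => (tuple_sum L w X)%:E) = (fun X => (npartR B X)%:E).
  apply/funext => X; rewrite /npartR (@npart_pts R L)// natr_sum /tuple_sum.
  congr (_%:E); rewrite big_mkcond big_tuple_cons/=.
  apply: eq_bigr => x _.
  rewrite (bigD1 [tuple])//= big1 ?addr0; last by move=> a /negP[]; apply/eqP; exact: tuple0.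
  rewrite /w tnth_map tnth0 indicE; congr (_%:R); congr nat_of_bool.
move=> ->; rewrite /=.
transitivity (\int[lebesgue_measure]_x ((pi^-1)%:E * (\1_B x)%:E))%E.
  apply: eq_integral => x _; rewrite -EFinM /w tnth0 mulrC; congr (_ * _)%:E.
  by rewrite det_mx11 mxE tnth0 sine_kernelE subrr /sinch eqxx mulr1.
rewrite ge0_integralZl_EFin//.
- by rewrite integral_indic// setIT.
- by apply/measurable_EFinP; exact: measurable_indic.
- by rewrite invr_ge0 pi_ge0.
Qed.

End counts.

(** * Limit of the Laplace transforms at integer endpoints *)

Section logarithmic_limits.
Variable R : realType.

Lemma near_pinfty_ge (a : R) : \forall N \near (+oo : set_system R), a <= N.
Proof. by apply: nbhs_pinfty_ge; rewrite num_real. Qed.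

Lemma inv_ln_cvg0 (D e : R) : 0 < e ->
  \forall N \near (+oo : set_system R), [/\ 1 < N, 0 < ln N & `|D| / ln N <= e].
Proof.
move=> e0; near=> N.
have N1 : 1 < N.
  by apply: (@lt_le_trans _ _ 2); [rewrite ltr1n|near: N; exact: near_pinfty_ge].
have lN : 0 < ln N by rewrite ln_gt0.
split => //; rewrite ler_pdivrMr// mulrC -ler_pdivrMr//.
rewrite -(expRK (`|D| / e)) ler_ln ?posrE ?expR_gt0//.
Unshelve. all: by end_near. Qed.

Lemma cvg_of_inv_ln (u : R -> R) (l D : R) :
  (\forall N \near (+oo : set_system R), `|u N - l| <= D / ln N) ->
  u N @[N --> +oo] --> l.
Proof.
move=> uD; apply/cvgrPdist_le => e e0; near=> N.
rewrite distrC; apply: (@le_trans _ _ (D / ln N)); first by near: N.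
have [N1 lN] : [/\ 1 < N, 0 < ln N & `|D| / ln N <= e].
  by near: N; exact: inv_ln_cvg0.
by apply: le_trans; rewrite ler_wpM2r ?invr_ge0 ?(ltW lN)// ler_norm.
Unshelve. all: by end_near. Qed.

Lemma ln_ratio_cvg1 (k : R -> nat) (c : R) : 0 < c ->
  (\forall N \near (+oo : set_system R), c * N - 1 <= (k N)%:R <= c * N + 1) ->
  ln (k N)%:R / ln N @[N --> +oo] --> (1 : R).
Proof.
move=> c0 kc; apply: (@cvg_of_inv_ln _ _ (`|ln c| + 1)); near=> N.
have [N1 lN _] : [/\ 1 < N, 0 < ln N & `|1| / ln N <= 1 :> R].
  by near: N; exact: inv_ln_cvg0.
have N0 : 0 < N by exact: lt_trans N1.
have /andP[k1 k2] : c * N - 1 <= (k N)%:R <= c * N + 1 by near: N.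
have cN : 2 <= c * N.
  by rewrite -ler_pdivrMl//; near: N; exact: near_pinfty_ge.
have ln2 : ln 2 <= 1 :> R.
  by rewrite (le_trans (@le_ln1Dx R 1 _))// ?ltrN1// (lt_le_trans _ ler01)// ltrN10.
have cN0 : 0 < c * N by rewrite mulr_gt0.
have K0 : 0 < (k N)%:R :> R by lra.
have L1 : ln (c * N / 2) <= ln (k N)%:R.
  by rewrite ler_ln ?posrE ?divr_gt0//; lra.
have L2 : ln (k N)%:R <= ln (c * N * 2).
  by rewrite ler_ln ?posrE ?mulr_gt0//; lra.
rewrite ln_div ?posrE// lnM ?posrE// in L1.
rewrite [ln (c * N * 2)]lnM ?posrE// lnM ?posrE// in L2.
have -> : ln (k N)%:R / ln N - 1 = (ln (k N)%:R - ln N) / ln N.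
  by rewrite mulrBl mulfV ?gt_eqF.
rewrite normrM [ `|(ln N)^-1| ]ger0_norm ?invr_ge0 ?(ltW lN)//.
apply: ler_wpM2r; first by rewrite invr_ge0 ltW.
have := ler_norm (ln c); have := ler_norm (- ln c); rewrite normrN => h1 h2.
by rewrite ler_norml; apply/andP; split; lra.
Unshelve. all: by end_near. Qed.

Lemma cvg_sum_ord (d : nat) (f : 'I_d -> R -> R) (l : 'I_d -> R) :
  (forall i, f i N @[N --> +oo] --> l i) ->
  (\sum_(i < d) f i N) @[N --> +oo] --> \sum_(i < d) l i.
Proof.
move=> fl; have -> : (fun N => \sum_(i < d) f i N) = \sum_(i < d) f i.
  by apply/funext => N; rewrite fct_sumE.
by elim/big_ind2 : _ => // [|g a h b ga hb]; [exact: cvg_cst|exact: cvgD].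
Qed.

End logarithmic_limits.

Section laplace_limit.
Variables (R : realType) (P : probability (configs R) R).
Hypothesis hP : is_sine_process P.
Variables (d : nat) (t : 'I_d -> R).
Hypothesis t0 : forall i, 0 <= t i.

(** Integer endpoints make the step functions constant on the cells of every
    mesh [1 / q]. *)
Definition lattice_end (N : R) (j : 'I_d) : nat := Num.truncn (t j * N).

Definition scale (N : R) : R := pi^-1 * Num.sqrt (ln N).

Definition lattice_xi (N : R) (j : 'I_d) (X : configs R) : R :=
  (npartR `[0, (lattice_end N j)%:R[ X - (lattice_end N j)%:R / pi) / scale N.

(** The covariance of [eta 0 - eta (t i)] and [eta 0 - eta (t j)] for independent
    centred [eta] of variance [1 / 2]. *)
Definition limit_cov (i j : 'I_d) : R :=
  ((t i != 0)%:R + (t j != 0)%:R - (t i != t j)%:R) / 2.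

Let truncn_bounds (N : R) j : 0 <= N -> t j * N - 1 <= (lattice_end N j)%:R <= t j * N.
Proof.
move=> N0; have /truncn_itv/andP[l u] : 0 <= t j * N by rewrite mulr_ge0.
by rewrite l andbT -natr1 in u *; lra.
Qed.

Let cvg_ln_end j : ln (lattice_end N j)%:R / ln N @[N --> +oo] --> ((t j != 0)%:R : R).
Proof.
have [tj0|tj0] := eqVneq (t j) 0.
  rewrite /lattice_end tj0; apply: cvg_near_cst; apply: nearW => N.
  by rewrite mul0r truncn0 ln0// mul0r.
apply: (@ln_ratio_cvg1 _ _ (t j)); first by rewrite lt_def tj0 t0.
near=> N; have N0 : 0 <= N by near: N; exact: near_pinfty_ge.
by have /andP[l u] := truncn_bounds j N0; apply/andP; split; lra.
Unshelve. all: by end_near. Qed.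

Let cvg_ln_gap i j : ln (gap (lattice_end N i) (lattice_end N j))%:R / ln N
  @[N --> +oo] --> ((t i != t j)%:R : R).
Proof.
have [tij|tij] := eqVneq (t i) (t j).
  apply: cvg_near_cst; apply: nearW => N.
  by rewrite /gap /lattice_end tij subnn addn0 ln0// mul0r.
wlog tij' : i j tij / t i < t j.
  move=> H; have /orP[ij|ji] : (t i < t j) || (t j < t i) by rewrite -neq_lt.
    exact: H.
  have := H j i; rewrite eq_sym => /(_ tij ji).
  rewrite (_ : (fun N => ln (gap (lattice_end N j) _)%:R / _) =
    (fun N => ln (gap (lattice_end N i) (lattice_end N j))%:R / ln N))//.
  by apply/funext => N; rewrite gapC.
apply: (@ln_ratio_cvg1 _ _ (t j - t i)); first by rewrite subr_gt0.
near=> N; have N0 : 0 <= N by near: N; exact: near_pinfty_ge.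
have /andP[l1 u1] := truncn_bounds i N0; have /andP[l2 u2] := truncn_bounds j N0.
have le : (lattice_end N i <= lattice_end N j)%N.
  by apply: le_truncn; rewrite ler_wpM2r// ltW.
have -> : gap (lattice_end N i) (lattice_end N j) = (lattice_end N j - lattice_end N i)%N.
  by rewrite /gap; lia.
by rewrite natrB//; apply/andP; split; lra.
Unshelve. all: by end_near. Qed.

Variable s : 'I_d -> R.

Let Lam : R := \sum_i \sum_j s i * s j * limit_cov i j.

Let cvg_log_var : log_var s (lattice_end N) / ln N @[N --> +oo] --> Lam.
Proof.
rewrite (_ : (fun N => _) = fun N => \sum_i \sum_j s i * s j *
   ((ln (lattice_end N i)%:R / ln N + ln (lattice_end N j)%:R / ln N
    - ln (gap (lattice_end N i) (lattice_end N j))%:R / ln N) * 2^-1)).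
  apply: cvg_sum_ord => i; apply: cvg_sum_ord => j.
  apply: cvgM; first exact: cvg_cst.
  apply: cvgM; last exact: cvg_cst.
  apply: cvgB; last exact: cvg_ln_gap.
  by apply: cvgD; exact: cvg_ln_end.
apply/funext => N; rewrite /log_var mulr_suml; apply: eq_bigr => i _.
by rewrite mulr_suml; apply: eq_bigr => j _; ring.
Qed.

Let tau (N : R) : R := (scale N)^-1.

Lemma cvg_inv_scale : (scale N)^-1 @[N --> +oo] --> (0 : R).
Proof.
apply/cvgrPdist_le => e e0; near=> N.
have [N1 lN h] : [/\ 1 < N, 0 < ln N & `|pi ^+ 2| / ln N <= e ^+ 2].
  by near: N; apply: inv_ln_cvg0; rewrite exprn_gt0.
have ta0 : 0 <= (scale N)^-1 by rewrite invr_ge0 mulr_ge0 ?invr_ge0 ?pi_ge0.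
rewrite sub0r normrN ger0_norm// -(ler_pXn2r (n := 2))//; last first.
  by rewrite nnegrE ltW.
rewrite exprVn exprMn sqr_sqrtr ?(ltW lN)// invfM exprVn invrK.
by rewrite ger0_norm ?sqr_ge0 in h.
Unshelve. all: by end_near. Qed.

(** After division by [scale N] the parameter of [laplace_count_bounds] tends to
    zero, so both exponential distortions tend to one, and the bounded error in
    the variance is divided by [ln N]. *)
Lemma laplace_lattice_xi :
  (forall N, 1 < N -> P.-integrable setT
     (fun X => (expR (\sum_j s j * lattice_xi N j X))%:E)) /\
  fine (\int[P]_X (expR (\sum_j s j * lattice_xi N j X))%:E)%E @[N --> +oo] -->
    expR (Lam / 2).
Proof.
have cvg_tau : tau N @[N --> +oo] --> (0 : R) by exact: cvg_inv_scale.
pose B := \sum_j `|s j|; pose C := 3 * (pi + 4) * B ^+ 2.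
have ta0 N : 0 <= tau N by rewrite invr_ge0 mulr_ge0 ?invr_ge0 ?pi_ge0.
pose m N := tau N * \sum_j s j * (lattice_end N j)%:R / pi.
pose S N (X : configs R) := \sum_j s j * npartR `[0, (lattice_end N j)%:R[ X.
have E N X : expR (\sum_j s j * lattice_xi N j X) = expR (- m N) * expR (tau N * S N X).
  rewrite -expRD /m /S !mulr_sumr -sumrN -big_split/=; congr expR.
  by apply: eq_bigr => j _; rewrite /lattice_xi /tau; ring.
have I N : P.-integrable setT (fun X => (expR (\sum_j s j * lattice_xi N j X))%:E).
  have [iS _] := laplace_count_bounds hP s (lattice_end N) (ta0 N).
  have := integrableZl measurableT (expR (- m N)) iS.
  by apply: eq_integrable => // X _; rewrite E EFinM.
split=> //.
pose lo N := expR (expR (- (2 * B * tau N)) * (log_var s (lattice_end N) / ln N - C / ln N) / 2).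
pose hi N := expR (expR (2 * B * tau N) * (log_var s (lattice_end N) / ln N + C / ln N) / 2).
have Cl : C / ln N @[N --> +oo] --> (0 : R).
  apply: (@cvg_of_inv_ln _ _ _ `|C|); near=> N.
  have [N1 lN _] : [/\ 1 < N, 0 < ln N & `|1| / ln N <= 1 :> R].
    by near: N; exact: inv_ln_cvg0.
  by rewrite subr0 normrM [ `|(ln N)^-1| ]ger0_norm// invr_ge0 ltW.
have cE (f : R -> R) l : f N @[N --> +oo] --> l -> expR (f N) @[N --> +oo] --> expR l.
  by move=> fl; apply: (cvg_comp _ _ fl); exact: continuous_expR.
have clo : lo N @[N --> +oo] --> expR (Lam / 2).
  apply: (cE _ _); have <- : expR (- (2 * B * 0)) * (Lam - 0) / 2 = Lam / 2.
    by rewrite subr0 [2 * B * 0]mulr0 oppr0 expR0 mul1r.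
  apply: cvgM; last exact: cvg_cst.
  apply: cvgM; last exact: cvgB.
  by apply: (cE _ _); apply: cvgN; apply: cvgM => //; exact: cvg_cst.
have chi : hi N @[N --> +oo] --> expR (Lam / 2).
  apply: (cE _ _); have <- : expR (2 * B * 0) * (Lam + 0) / 2 = Lam / 2.
    by rewrite addr0 [2 * B * 0]mulr0 expR0 mul1r.
  apply: cvgM; last exact: cvg_cst.
  apply: cvgM; last exact: cvgD.
  by apply: (cE _ _); apply: cvgM => //; exact: cvg_cst.
apply: (squeeze_cvgr _ clo chi); near=> N.
have [N1 lN _] : [/\ 1 < N, 0 < ln N & `|1| / ln N <= 1 :> R].
  by near: N; exact: inv_ln_cvg0.
have [iS bS] := laplace_count_bounds hP s (lattice_end N) (ta0 N).
have -> : (\int[P]_X (expR (\sum_j s j * lattice_xi N j X))%:E =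
   (expR (- m N))%:E * \int[P]_X (expR (tau N * S N X))%:E)%E.
  by under eq_integral do rewrite E EFinM; rewrite integralZl.
have fS : (\int[P]_X (expR (tau N * S N X))%:E)%E \is a fin_num.
  exact: integrable_fin_num.
move: bS; rewrite -(fineK fS) !lee_fin -EFinM /= => /andP[l u].
have t2 : tau N ^+ 2 = pi ^+ 2 / ln N.
  by rewrite /tau exprVn exprMn sqr_sqrtr ?(ltW lN)// invfM exprVn invrK.
have p0 : pi ^+ 2 != 0 :> R by rewrite expf_neq0// gt_eqF// pi_gt0.
have loE : lo N = expR (- m N) * expR (m N + expR (- (2 * B * tau N)) *
    ((log_var s (lattice_end N) - C) / pi ^+ 2) * tau N ^+ 2 / 2).
  rewrite -expRD addrA addNr add0r /lo t2; congr expR.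
  move: (pi ^+ 2) p0 (ln N) lN (log_var _ _) (expR _) => p p0 l' l0 v e.
  by field; rewrite p0 gt_eqF.
have hiE : hi N = expR (- m N) * expR (m N + expR (2 * B * tau N) *
    ((log_var s (lattice_end N) + C) / pi ^+ 2) * tau N ^+ 2 / 2).
  rewrite -expRD addrA addNr add0r /hi t2; congr expR.
  move: (pi ^+ 2) p0 (ln N) lN (log_var _ _) (expR _) => p p0 l' l0 v e.
  by field; rewrite p0 gt_eqF.
by rewrite loE hiE !ler_wpM2l ?expR_ge0.
Unshelve. all: by end_near. Qed.

End laplace_limit.

(** * Laplace transform of the Gaussian increments *)

Section integrals_from_indicators.
Context d1 d2 (T1 : measurableType d1) (T2 : measurableType d2) (R : realType).
Variables (mu1 : {measure set T1 -> \bar R}) (mu2 : {measure set T2 -> \bar R}).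
Variables (G1 : T1 -> R) (Y1 : T1 -> R) (G2 : T2 -> R) (Y2 : T2 -> R).
Hypotheses (mG1 : measurable_fun setT G1) (mY1 : measurable_fun setT Y1).
Hypotheses (mG2 : measurable_fun setT G2) (mY2 : measurable_fun setT Y2).
Hypotheses (G10 : forall x, 0 <= G1 x) (G20 : forall x, 0 <= G2 x).
Hypothesis G12 : forall A : set R, measurable A ->
  (\int[mu1]_x (G1 x * \1_A (Y1 x))%:E = \int[mu2]_x (G2 x * \1_A (Y2 x))%:E)%E.

Let simple d (T : measurableType d) (mu : {measure set T -> \bar R})
    (G Y : T -> R) (mG : measurable_fun setT G) (mY : measurable_fun setT Y)
    (G0 : forall x, 0 <= G x) (h : {nnsfun R >-> R}) :
  (\int[mu]_x (G x * h (Y x))%:E =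
   \sum_(y \in range h) y%:E * \int[mu]_x (G x * \1_(h @^-1` [set y]) (Y x))%:E)%E.
Proof.
have mi y : measurable_fun setT (fun x => G x * \1_(h @^-1` [set y]) (Y x)).
  apply: measurable_funM => //; apply: measurableT_comp mY.
  by apply: measurable_indic; exact: measurable_funPTI.
have E x : (G x * h (Y x))%:E =
    (\sum_(y \in range h) y%:E * (G x * \1_(h @^-1` [set y]) (Y x))%:E)%E.
  rewrite fimfunE mulr_fsumr -fsumEFin//; apply: eq_fsbigr => y _.
  by rewrite -EFinM mulrCA.
under eq_integral do rewrite E.
rewrite ge0_integral_fsum//.
- apply: eq_fsbigr => y; rewrite inE => -[r _ <-].
  by rewrite ge0_integralZl_EFin//; [move=> x _; rewrite lee_fin mulr_ge0|exact/measurable_EFinP].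
- by move=> y; apply: emeasurable_funM => //; exact/measurable_EFinP.
- move=> y x _; have [[r _ <-]|yh] := pselect (range h y).
    by rewrite -EFinM lee_fin !mulr_ge0.
  rewrite indicE memNset ?mulr0 ?mule0// => hy; apply: yh; exists (Y x) => //.
Qed.

(** Both sides are monotone limits along the same simple functions approximating
    [f]. The weights [G1] and [G2] allow one variable to be integrated out while
    the others are kept. *)
Lemma integral_eq_of_indic (f : R -> R) : measurable_fun setT f ->
  (forall x, 0 <= f x) ->
  (\int[mu1]_x (G1 x * f (Y1 x))%:E = \int[mu2]_x (G2 x * f (Y2 x))%:E)%E.
Proof.
move=> mf f0.
have mEf : measurable_fun setT (EFin \o f) by exact/measurable_EFinP.
pose h := nnsfun_approx measurableT mEf.
have hf y : EFin \o h^~ y @ \oo --> (f y)%:E.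
  exact: (cvg_nnsfun_approx measurableT mEf (fun x _ => f0 x)).
have hn n x y : (n <= x)%N -> h n y <= h x y.
  by move=> nx; exact: (lefP _ _ (nd_nnsfun_approx measurableT mEf nx)).
have lim d (T : measurableType d) (mu : {measure set T -> \bar R})
    (G Y : T -> R) (mG : measurable_fun setT G) (mY : measurable_fun setT Y)
    (G0 : forall x, 0 <= G x) :
    (\int[mu]_x (G x * h n (Y x))%:E)%E @[n --> \oo] --> (\int[mu]_x (G x * f (Y x))%:E)%E.
  have := @cvg_monotone_convergence _ T R mu setT measurableT
    (fun n x => (G x * h n (Y x))%:E).
  have -> : (\int[mu]_x (G x * f (Y x))%:E = \int[mu]_x limn (fun n => (G x * h n (Y x))%:E))%E.
    apply: eq_integral => x _; apply/esym/cvg_lim => //.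
    rewrite EFinM; under eq_fun do rewrite EFinM.
    by apply: cvgeZl => //; exact: hf.
  apply.
  - move=> n; apply/measurable_EFinP; apply: measurable_funM => //.
    by apply: measurableT_comp mY; exact: measurable_funP.
  - by move=> n x _; rewrite lee_fin mulr_ge0.
  - by move=> x _ n m nm; rewrite lee_fin ler_wpM2l// hn.
have L1 := lim _ _ mu1 G1 Y1 mG1 mY1 G10.
have L2 := lim _ _ mu2 G2 Y2 mG2 mY2 G20.
apply/esym; apply: (cvg_unique _ L2) => //; apply: cvg_trans L1; apply: near_eq_cvg.
apply: nearW => n /=; rewrite !simple//; apply: eq_fsbigr => y _; congr (_ * _)%E.
by rewrite G12.
Qed.

End integrals_from_indicators.

Section gaussian.
Variable R : realType.

(** Completing the square gives a normal density with mean [c * s ^ 2]. *)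
Lemma normal_mgf (s c : R) : s != 0 ->
  (\int[lebesgue_measure]_x (normal_pdf 0 s x * expR (c * x))%:E =
   (expR (c ^+ 2 * s ^+ 2 / 2))%:E)%E.
Proof.
move=> s0.
transitivity (\int[lebesgue_measure]_x ((expR (c ^+ 2 * s ^+ 2 / 2))%:E *
   (normal_pdf (c * s ^+ 2) s x)%:E))%E.
  apply: eq_integral => x _; rewrite -EFinM; congr (_%:E).
  rewrite !normal_pdfE// /normal_fun mulrCA -[LHS]mulrA -!expRD.
  by congr (_ * expR _); rewrite -[s ^+ 2 *+ 2]mulr_natr; field.
rewrite ge0_integralZl_EFin//.
- by rewrite integral_normal_pdf mule1.
- by move=> x _; rewrite lee_fin normal_pdf_ge0.
- by apply/measurable_EFinP; exact: measurable_normal_pdf.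
Qed.

End gaussian.

Section independent_exponentials.
Context {dT : measure_display} {T : measurableType dT} {R : realType}.
Variables (Q : probability T R) (eta : R -> {RV Q >-> R}) (D : set R).
Hypothesis ind : mutually_independent D eta.
Variables (c : R -> R) (e : R -> R).
Hypothesis mgf : forall u, D u -> (\int[Q]_w (expR (c u * eta u w))%:E = (e u)%:E)%E.

Let f u (x : R) := expR (c u * x).

Let mf u : measurable_fun setT (f u).
Proof. by apply: measurableT_comp; [exact: measurable_expR|exact: measurable_funM]. Qed.

Let meta u : measurable_fun setT (eta u). Proof. exact: measurable_funP. Qed.

(** Mutual independence is a product formula for indicators; the indicators are
    replaced by exponentials one variable at a time, the remaining factors
    serving as a weight. *)
Let mixed (r1 r2 : seq R) (A : R -> set R) : uniq (r1 ++ r2) ->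
  (forall u, u \in r1 ++ r2 -> D u) -> (forall u, measurable (A u)) ->
  (\int[Q]_w ((\prod_(u <- r1) f u (eta u w)) * \prod_(u <- r2) \1_(A u) (eta u w))%:E
   = ((\prod_(u <- r1) e u) * \prod_(u <- r2) fine (Q (eta u @^-1` A u)))%:E)%E.
Proof.
elim: r1 r2 A => [|i r1 IH] r2 A ur rD mA.
  under eq_integral => w _ do rewrite big_nil mul1r.
  rewrite big_nil mul1r.
  transitivity (\int[Q]_w
      (\1_(\bigcap_(u in [set` [fset u in r2]%fset]) (eta u @^-1` A u)) w)%:E)%E.
    apply: eq_integral => w _; congr (_%:E); rewrite [RHS]indicE.
    case: (boolP (w \in _)).
      rewrite inE => wA; rewrite big1_seq// => u /andP[_ ur2].
      by rewrite indicE mem_set//; apply: wA; rewrite /= inE.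
    rewrite notin_setE => wA.
    have [u ur2 uA] : exists2 u, u \in r2 & ~ A u (eta u w).
      apply/not_exists2P => h; apply: wA => u; rewrite /= inE => ur2.
      by have [//|] := h u; move=> /contrapT.
    by rewrite (big_rem u)//= indicE memNset// mul0r.
  rewrite integral_indic//; last first.
    apply: fin_bigcap_measurable => // u _; rewrite -[X in measurable X]setTI.
    exact: meta.
  transitivity (\prod_(u <- [fset u in r2]%fset) Q (eta u @^-1` A u))%E.
    rewrite setIT; apply: (ind (J := [fset u in r2]%fset) (A := A)) => //.
    by move=> u; rewrite /= inE => ur2; apply: rD.
  rewrite (perm_big r2); last first.
    by apply: uniq_perm => //; [exact: fset_uniq|move=> u; rewrite inE].
  rewrite /= -prodEFin; apply: eq_bigr => u _; rewrite fineK//.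
  by apply: fin_num_measure; rewrite -[X in measurable X]setTI; exact: meta.
have iD : D i by apply: rD; rewrite mem_head.
have [ii ur'] : i \notin r1 ++ r2 /\ uniq (r1 ++ r2) by apply/andP.
pose K := (\prod_(u <- r1) e u) * \prod_(u <- r2) fine (Q (eta u @^-1` A u)).
pose G w := (\prod_(u <- r1) f u (eta u w)) * \prod_(u <- r2) \1_(A u) (eta u w).
have f0 u x : 0 <= f u x by exact: expR_ge0.
have G0 w : 0 <= G w by rewrite mulr_ge0// prodr_ge0.
have mG : measurable_fun setT G.
  apply: measurable_funM; apply: measurable_prod => u _.
    exact: measurableT_comp.
  by apply: measurableT_comp => //; exact: measurable_indic.
have K0 : 0 <= K.
  rewrite -lee_fin.
  have <- : (\int[Q]_w (G w)%:E)%E = K%:E.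
    by apply: IH => // u ur2; apply: rD; rewrite /= inE ur2 orbT.
  by apply: integral_ge0 => w _; rewrite lee_fin.
have GA B : measurable B ->
  (\int[Q]_w (G w * \1_B (eta i w))%:E = \int[Q]_w (K * \1_B (eta i w))%:E)%E.
  move=> mB; pose A' u := if u == i then B else A u.
  have A'r r : i \notin r -> forall h : R -> set R -> R,
      \prod_(u <- r) h u (A' u) = \prod_(u <- r) h u (A u).
    move=> ir h; rewrite big_seq [RHS]big_seq; apply: eq_bigr => u ur1.
    by rewrite /A'; case: eqP => // ui; move: ir; rewrite -ui ur1.
  have [ir1 ir2] : i \notin r1 /\ i \notin r2.
    by move: ii; rewrite mem_cat negb_or => /andP.
  have A'i : A' i = B by rewrite /A' eqxx.
  transitivity (\int[Q]_w ((\prod_(u <- r1) f u (eta u w)) *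
      \prod_(u <- i :: r2) \1_(A' u) (eta u w))%:E)%E.
    apply: eq_integral => w _; rewrite big_cons A'i.
    by rewrite (A'r r2 ir2 (fun u S => \1_S (eta u w))) /G mulrAC -mulrA; congr (_ * _)%:E; rewrite mulrC.
  rewrite IH; last 3 first.
  - have /perm_uniq -> // : perm_eq (r1 ++ i :: r2) (i :: r1 ++ r2).
    by apply/permPl; exact: (perm_catCA r1 [:: i] r2).
  - by move=> u; rewrite mem_cat inE orbCA -mem_cat -in_cons => /rD.
  - by move=> u; rewrite /A'; case: ifP.
  rewrite big_cons A'i (A'r r2 ir2 (fun u S => fine (Q (eta u @^-1` S)))).
  under [in RHS]eq_integral do rewrite EFinM.
  have mBi : measurable (eta i @^-1` B) by rewrite -[X in measurable X]setTI; exact: meta.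
  rewrite ge0_integralZl_EFin//; last first.
    by apply/measurable_EFinP; apply: measurableT_comp => //; exact: measurable_indic.
  have -> : (\int[Q]_w (\1_B (eta i w))%:E = (fine (Q (eta i @^-1` B)))%:E)%E.
    rewrite fineK; last exact: fin_num_measure.
    rewrite -[X in Q X]setIT -(@integral_indic _ _ _ Q setT)//.
  by rewrite -EFinM; congr (_%:E); rewrite /K; ring.
transitivity (\int[Q]_w (G w * f i (eta i w))%:E)%E.
  by apply: eq_integral => w _; rewrite big_cons /G; congr (_%:E); ring.
rewrite (integral_eq_of_indic mG (meta i) (measurable_cst K) (meta i) G0 (fun=> K0) GA (mf i) (f0 i)).
under eq_integral do rewrite EFinM.
rewrite ge0_integralZl_EFin//; last 2 first.
- by move=> w _; rewrite lee_fin.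
- by apply/measurable_EFinP; exact: measurableT_comp.
have -> : (\int[Q]_w (f i (eta i w))%:E = (e i)%:E)%E by exact: mgf.
by rewrite -EFinM big_cons /K; congr (_%:E); ring.
Qed.

Lemma independent_mgf (r : seq R) : uniq r -> (forall u, u \in r -> D u) ->
  (\int[Q]_w (expR (\sum_(u <- r) c u * eta u w))%:E = (\prod_(u <- r) e u)%:E)%E.
Proof.
move=> ur rD; have := @mixed r [::] (fun=> setT).
rewrite cats0 => /(_ ur rD (fun=> measurableT)).
rewrite big_nil mulr1 => <-; apply: eq_integral => w _.
by rewrite big_nil mulr1 expR_sum.
Qed.

End independent_exponentials.

Section gaussian_increments.
Context {dT : measure_display} {T : measurableType dT} {R : realType}.
Variables (Q : probability T R) (eta : R -> {RV Q >-> R}).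
Hypothesis eta_indep : mutually_independent `[0, 1] eta.
Hypothesis eta_gauss : forall t, 0 <= t <= 1 -> forall A : set R, measurable A ->
  distribution Q (eta t) A = normal_prob 0 (Num.sqrt (1 / 2)) A.

Lemma gaussian_mgf (c u : R) : 0 <= u <= 1 ->
  (\int[Q]_w (expR (c * eta u w))%:E = (expR (c ^+ 2 / 4))%:E)%E.
Proof.
move=> u01; set s : R := Num.sqrt (1 / 2).
have s0 : s != 0 by rewrite sqrtr_eq0 -ltNge.
have s2 : s ^+ 2 = 1 / 2 by rewrite sqr_sqrtr.
rewrite [RHS](_ : _ = (expR (c ^+ 2 * s ^+ 2 / 2))%:E); last first.
  by rewrite s2; congr (expR _)%:E; field.
rewrite -normal_mgf//.
transitivity (\int[Q]_w (1 * expR (c * eta u w))%:E)%E.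
  by apply: eq_integral => w _; rewrite mul1r.
have mexp : measurable_fun setT (fun x : R => expR (c * x)).
  by apply: measurableT_comp; [exact: measurable_expR|exact: measurable_funM].
apply: (@integral_eq_of_indic _ _ _ _ _ Q (@lebesgue_measure R) (fun=> 1)
  (eta u) (normal_pdf 0 s) id _ _ _ _ _ _ _ (fun x => expR (c * x))) => //.
- exact: measurable_normal_pdf.
- by move=> x; exact: normal_pdf_ge0.
move=> A mA; have := eta_gauss u01 mA; rewrite /normal_prob /distribution /pushforward.
move=> gA.
transitivity (Q (eta u @^-1` A)).
  rewrite -[X in Q X]setIT -(@integral_indic _ _ _ Q setT)//.
    by apply: eq_integral => w _; rewrite mul1r.
  by rewrite -[X in measurable X]setTI; exact: measurable_funP.
rewrite gA [LHS]integral_mkcond; apply: eq_integral => x _; rewrite patchE /=.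
by rewrite indicE; case: ifP; rewrite ?mulr1 ?mulr0.
Qed.

Lemma sum_delta_seq (r : seq R) (v : R) (x : R -> R) : uniq r -> v \in r ->
  \sum_(u <- r) (u == v)%:R * x u = x v.
Proof.
move=> ur vr; rewrite (bigD1_seq v)//= eqxx mul1r big1 ?addr0// => u /negPf->.
by rewrite mul0r.
Qed.

(** Only finitely many of the variables occur: collecting the coefficient of
    each [eta u] gives independent Gaussian terms even when some [t j] is [0]
    or when times repeat. *)
Lemma laplace_increments d (t s : 'I_d -> R) : (forall i, 0 <= t i <= 1) ->
  (\int[Q]_w (expR (\sum_j s j * (eta 0 w - eta (t j) w)))%:E =
   (expR ((\sum_i \sum_j s i * s j * limit_cov t i j) / 2))%:E)%E.
Proof.
move=> t01; pose c u := \sum_j s j * ((u == 0)%:R - (u == t j)%:R).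
pose r := undup (0 :: codom t).
have ur : uniq r by exact: undup_uniq.
have r0 : 0 \in r by rewrite mem_undup mem_head.
have rt j : t j \in r by rewrite mem_undup inE codom_f orbT.
have rD u : u \in r -> 0 <= u <= 1.
  rewrite mem_undup inE => /orP[/eqP->|/codomP[j ->]//]; first by rewrite lexx ler01.
have sum_c (y : R -> R) : \sum_(u <- r) c u * y u = \sum_j s j * (y 0 - y (t j)).
  rewrite /c; under eq_bigr do rewrite mulr_suml; rewrite exchange_big/=.
  apply: eq_bigr => j _; under eq_bigr do rewrite -mulrA mulrBl.
  by rewrite -mulr_sumr sumrB !sum_delta_seq.
have := @independent_mgf _ _ _ Q eta `[0, 1] eta_indep c (fun u => expR (c u ^+ 2 / 4)) _ r ur _.
under eq_integral do rewrite (sum_c (fun u => eta u _)).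
move=> ->; last first.
- by move=> u /rD; rewrite /= in_itv.
- by move=> u /=; rewrite in_itv/= => u01; exact: gaussian_mgf.
rewrite -expR_sum; congr (expR _)%:E; rewrite -mulr_suml.
under eq_bigr do rewrite expr2; rewrite sum_c.
rewrite !mulr_suml; apply: eq_bigr => i _.
rewrite /c -sumrB !mulr_sumr mulr_suml [in RHS]mulr_suml; apply: eq_bigr => j _.
rewrite /limit_cov eqxx [0 == t j]eq_sym.
by case: (t i == 0); case: (t j == 0); case: (t i == t j) => /=; field.
Qed.

End gaussian_increments.

(** * Functions controlled by Laplace transforms *)

Section exponential_closure.
Variables (R : realType) (d : nat).
Implicit Types (f g W : ('I_d -> R) -> R) (s x : 'I_d -> R).

(** The functions whose expectations are controlled by Laplace transforms:
    the weight [W] of a limit is itself such a function, so its expectations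
    stay bounded, while the approximants [g n] may grow faster and faster. *)
Inductive exp_closed : (('I_d -> R) -> R) -> Prop :=
| exp_closed_exp c s : exp_closed (fun x => c * expR (\sum_j s j * x j))
| exp_closed_add f g : exp_closed f -> exp_closed g ->
    exp_closed (fun x => f x + g x)
| exp_closed_lim f W (g : nat -> ('I_d -> R) -> R) :
    exp_closed W -> (forall n, exp_closed (g n)) ->
    (forall n x, `|f x - g n x| <= n.+1%:R^-1 * W x) -> exp_closed f.

Lemma exp_closed_eq f g : f =1 g -> exp_closed f -> exp_closed g.
Proof. by move=> /funext ->. Qed.

Lemma exp_closed_dominated f : exp_closed f ->
  exists2 W, exp_closed W & forall x, `|f x| <= W x.
Proof.
elim=> [c s|{}f g _ [V cV fV] _ [W cW gW]|{}f W g cW _ cg IH fg].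
- exists (fun x => `|c| * expR (\sum_j s j * x j)); first exact: exp_closed_exp.
  by move=> x; rewrite normrM (ger0_norm (expR_ge0 _)).
- exists (fun x => V x + W x); first exact: exp_closed_add.
  by move=> x; rewrite (le_trans (ler_normD _ _))// lerD.
- have [V cV gV] := IH 0.
  exists (fun x => V x + W x); first exact: exp_closed_add.
  move=> x; rewrite -(subrK (g 0 x) (f x)) addrC (le_trans (ler_normD _ _))//.
  by rewrite lerD// (le_trans (fg 0 x))// invr1 mul1r.
Qed.

Lemma exp_closed_scale_exp f c s : exp_closed f ->
  exp_closed (fun x => f x * (c * expR (\sum_j s j * x j))).
Proof.
move=> cf; elim: cf c => [b u|{}f g _ IHf _ IHg|{}f W g cW IHW cg IHg fg] c.
- apply: exp_closed_eq (exp_closed_exp (b * c) (fun j => u j + s j)) => x.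
  rewrite mulrACA -expRD -big_split/=; congr (_ * expR _).
  by apply: eq_bigr => j _; rewrite mulrDl.
- by apply: exp_closed_eq (exp_closed_add (IHf c) (IHg c)) => x; rewrite mulrDl.
- apply: (exp_closed_lim (IHW `|c|) (fun n => IHg n c)) => n x.
  rewrite -mulrBl normrM [X in _ * X]normrM (ger0_norm (expR_ge0 _)) [leRHS]mulrA.
  by apply: ler_wpM2r => //; rewrite mulr_ge0 ?expR_ge0.
Qed.

(** A limit times a function dominated by [V] is a limit with weight [V * W]. *)
Lemma exp_closed_mul f g : exp_closed f -> exp_closed g ->
  exp_closed (fun x => f x * g x).
Proof.
move=> cf cg; elim: cg f cf => [c s|{}g h _ IHg _ IHh|{}g W h cW IHW ch IHh gh] f cf.
- exact: exp_closed_scale_exp.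
- by apply: exp_closed_eq (exp_closed_add (IHg _ cf) (IHh _ cf)) => x; rewrite mulrDr.
- have [V cV fV] := exp_closed_dominated cf.
  apply: (exp_closed_lim (IHW _ cV) (fun n => IHh n _ cf)) => n x.
  by rewrite -mulrBr normrM mulrCA ler_pM.
Qed.

Lemma exp_closed_cst c : exp_closed (fun=> c).
Proof.
apply: exp_closed_eq (exp_closed_exp c (fun=> 0)) => x.
by rewrite big1 ?expR0 ?mulr1// => j _; rewrite mul0r.
Qed.

Lemma exp_closed_exp1 (c s : R) i : exp_closed (fun x => c * expR (s * x i)).
Proof.
apply: exp_closed_eq (exp_closed_exp c (fun j => (j == i)%:R * s)) => x.
rewrite (bigD1 i)//= eqxx mul1r big1 ?addr0// => j /negPf ->.
by rewrite !mul0r.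
Qed.

Lemma exp_closed_sum (I : Type) (r : seq I) (F : I -> ('I_d -> R) -> R) :
  (forall i, exp_closed (F i)) -> exp_closed (fun x => \sum_(i <- r) F i x).
Proof.
move=> cF; elim: r => [|i r IH].
  by apply: exp_closed_eq (exp_closed_cst 0) => x; rewrite big_nil.
by apply: exp_closed_eq (exp_closed_add (cF i) IH) => x; rewrite big_cons.
Qed.

Lemma exp_closed_expn f n : exp_closed f -> exp_closed (fun x => f x ^+ n).
Proof.
move=> cf; elim: n => [|n IH].
  by apply: exp_closed_eq (exp_closed_cst 1) => x; rewrite expr0.
by apply: exp_closed_eq (exp_closed_mul cf IH) => x; rewrite exprS.
Qed.

Lemma expR_abs_le (y : R) : expR `|y| <= expR y + expR (- y).
Proof.
by have [_|_] := ger0P y; rewrite ?lerDl ?lerDr expR_ge0.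
Qed.

Lemma expR_sub_affine (y : R) : 0 <= expR y - 1 - y <= y ^+ 2 * expR `|y|.
Proof.
have h1 := expR_ge1Dx y; have h2 := expR_ge1Dx (- y).
rewrite subr_ge0 lerBrDl h1/=; have e0 := expR_gt0 y.
have e1 : expR y * expR (- y) = 1 by rewrite -expRD subrr expR0.
have h3 : expR y - 1 <= y * expR y.
  have := ler_wpM2l (ltW e0) h2; rewrite e1; lra.
have [y0|y0] := ger0P y.
  have := ler_wpM2l y0 h3; rewrite expr2; lra.
have h4 : 1 <= expR (- y) by lra.
have y0' : 0 <= - y by lra.
have := ler_wpM2l y0' h1; have := ler_wpM2l (sqr_ge0 y) h4; rewrite expr2; lra.
Qed.

Lemma sqr_le_expR (y : R) : y ^+ 2 <= 2 * expR `|y|.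
Proof.
rewrite -[y ^+ 2]real_normK ?num_real//; set z := `|y|.
have z0 : 0 <= z by exact: normr_ge0.
have := exp_partial_le 3 z0; rewrite !big_ord_recl big_ord0 !factS fact0 /=.
rewrite /bump/= expr0 expr1 !muln1 !addn0 add1n invr1 => h.
have : 2^-1 * z ^+ 2 <= expR z by lra.
by lra.
Qed.

(** [x] is the limit of [(expR (x / n) - 1) * n], with error at most [1 / n]
    times an exponential weight. *)
Lemma exp_closed_coord i : exp_closed (fun x => x i).
Proof.
apply: (@exp_closed_lim _ (fun x => 2 * (expR (2 * x i) + expR ((-2) * x i)))
  (fun n x => n.+1%:R * (expR (n.+1%:R^-1 * x i) - 1))).
- apply: exp_closed_eq (exp_closed_add (exp_closed_exp1 2 2 i) (exp_closed_exp1 2 (-2) i)) => x.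
  by rewrite mulrDr.
- move=> n; apply: exp_closed_eq (exp_closed_add (exp_closed_exp1 n.+1%:R n.+1%:R^-1 i)
    (exp_closed_cst (- n.+1%:R))) => x.
  by rewrite mulrBr mulr1.
move=> n x; set m : R := n.+1%:R; have m1 : 1 <= m by rewrite ler1n.
have m0 : m != 0 by rewrite pnatr_eq0.
have /andP[h1 h2] := expR_sub_affine (m^-1 * x i).
have -> : x i - m * (expR (m^-1 * x i) - 1) = - (m * (expR (m^-1 * x i) - 1 - m^-1 * x i)).
  by rewrite [in RHS]mulrBr mulVKf// opprB.
rewrite normrN ger0_norm; last by rewrite mulr_ge0 //; lra.
rewrite ler_pdivlMl ?(lt_le_trans ltr01)//.
apply: le_trans (_ : x i ^+ 2 * expR `|m^-1 * x i| <= _).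
  rewrite [leRHS](_ : _ = m * (m * ((m^-1 * x i) ^+ 2 * expR `|m^-1 * x i|))).
    by rewrite ler_wpM2l ?ler_wpM2l//; lra.
  by field.
have le1 : expR `|m^-1 * x i| <= expR `|x i|.
  rewrite ler_expR normrM ger0_norm ?invr_ge0; last by lra.
  by rewrite ler_piMl// invf_le1; lra.
have le2 := sqr_le_expR (x i); have := expR_abs_le (2 * x i).
have -> : expR `|2 * x i| = expR `|x i| * expR `|x i|.
  rewrite -expRD normrM (gtr0_norm (ltr0Sn _ _)); congr expR.
  by move: `|x i| => z; ring.
have -> : (-2) * x i = - (2 * x i) by move: (x i) => z; ring.
move=> le3.
have e0 := expR_ge0 `|m^-1 * x i|; have e1 := expR_ge0 `|x i|.
apply: le_trans (_ : 2 * expR `|x i| * expR `|x i| <= _); last by lra.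
by apply: ler_pM => //; exact: sqr_ge0.
Qed.

(** Since [|y|^k <= 2^-m (2 |y|)^k] for [k >= m], the tail of the series is at
    most [2^-m] times the exponential of [2 |y|]: one weight serves for all the
    partial sums. *)
Lemma sin_partial_sum (y : R) m :
  `|sin y - series (sin_coeff y) m| <= 2^-1 ^+ m * expR (2 * `|y|).
Proof.
have coef k : `|sin_coeff y k| <= k`!%:R^-1 * `|y| ^+ k.
  rewrite /sin_coeff/= !normrM !normrX normrN1 expr1n mulr1 normfV normr_nat mulrC.
  rewrite (@ger0_norm _ (k`!%:R)) ?ler0n// mulrC [leRHS]mulrC ler_wpM2r ?invr_ge0//.
  by rewrite ler_piMl ?exprn_ge0//; case: (odd k).
apply/ler_addgt0Pr => e e0.
have /cvgrPdist_le/(_ e e0)[K _ HK] := @is_cvg_series_sin_coeff R y.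
have /= h := HK (K + m)%N (leq_addr _ _).
have {}h : `|sin y - series (sin_coeff y) (K + m)%N| <= e by rewrite unlock.
have mK : (m <= K + m)%N by exact: leq_addl.
have tail : `|series (sin_coeff y) (K + m)%N - series (sin_coeff y) m| <=
    2^-1 ^+ m * expR (2 * `|y|).
  rewrite sub_series_geq// (le_trans (ler_norm_sum _ _ _))//.
  apply: le_trans (_ : \sum_(m <= k < K + m) 2^-1 ^+ m * (k`!%:R^-1 * (2 * `|y|) ^+ k) <= _).
    rewrite big_nat [leRHS]big_nat; apply: ler_sum => k /andP[mk _].
    rewrite (le_trans (coef k))// exprMn mulrCA ler_wpM2l ?invr_ge0//.
    rewrite mulrA ler_peMl ?exprn_ge0// -(subnK mk) addnC exprD mulrA -exprMn.
    by rewrite mulVf// expr1n mul1r exprn_ege1// ler1n.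
  rewrite -mulr_sumr ler_wpM2l ?exprn_ge0//.
  have y0 : 0 <= 2 * `|y| by rewrite mulr_ge0.
  apply: le_trans (exp_partial_le (K + m) y0).
  rewrite -(big_mkord xpredT (fun n => n`!%:R^-1 * (2 * `|y|) ^+ n)).
  rewrite [leRHS](big_cat_nat (leq0n m) mK)/= lerDr.
  by rewrite sumr_ge0// => k _; rewrite mulr_ge0// exprn_ge0.
have -> : sin y - series (sin_coeff y) m = (sin y - series (sin_coeff y) (K + m)%N) +
  (series (sin_coeff y) (K + m)%N - series (sin_coeff y) m) by rewrite addrA subrK.
by rewrite (le_trans (ler_normD _ _))// addrC lerD.
Qed.

Lemma exp_closed_sin (sg : R) i : exp_closed (fun x => sin (sg * x i)).
Proof.
apply: (@exp_closed_lim _ (fun x => 1 * expR ((2 * sg) * x i) + 1 * expR (- (2 * sg) * x i))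
  (fun n x => \sum_(k < n) ((odd k)%:R * (-1) ^+ k.-1./2 * sg ^+ k / k`!%:R) * x i ^+ k)).
- exact: exp_closed_add (exp_closed_exp1 _ _ _) (exp_closed_exp1 _ _ _).
- move=> n; apply: exp_closed_sum => k.
  exact: exp_closed_mul (exp_closed_cst _) (exp_closed_expn _ (exp_closed_coord _)).
move=> n x; have -> : \sum_(k < n) ((odd k)%:R * (-1) ^+ k.-1./2 * sg ^+ k / k`!%:R) * x i ^+ k
    = series (sin_coeff (sg * x i)) n.
  rewrite /series/= big_mkord; apply: eq_bigr => k _; rewrite /sin_coeff/= exprMn.
  by rewrite -!mulrA; congr (_ * (_ * (_ * _))); rewrite mulrC.
rewrite (le_trans (sin_partial_sum _ _))// !mul1r mulNr -mulrA.
apply: ler_pM; rewrite ?exprn_ge0 ?expR_ge0//.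
  rewrite exprVn lef_pV2 ?posrE ?exprn_gt0// -natrX ler_nat.
  exact: ltn_expl.
have -> : 2 * `|sg * x i| = `|2 * (sg * x i)| by rewrite [in RHS]normrM gtr0_norm.
exact: expR_abs_le.
Qed.

End exponential_closure.

(** * Convergence of expectations *)

Section expectations.
Context {dO : measure_display} {O : measurableType dO} {R : realType}.
Variable P : probability O R.
Implicit Types f g h : O -> R.

Lemma integrable_dominated f g : measurable_fun setT f ->
  P.-integrable setT (EFin \o g) -> (forall w, `|f w| <= g w) ->
  P.-integrable setT (EFin \o f).
Proof.
move=> mf ig fg; apply: le_integrable ig => //; first exact/measurable_EFinP.
by move=> w _ /=; rewrite lee_fin (le_trans (fg w))// ler_norm.
Qed.

Lemma integrable_add f g : P.-integrable setT (EFin \o f) ->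
  P.-integrable setT (EFin \o g) ->
  P.-integrable setT (EFin \o (fun w => f w + g w)).
Proof.
move=> if' ig; rewrite (_ : _ \o _ = ((EFin \o f) \+ (EFin \o g))%E)//.
exact: integrableD.
Qed.

Lemma integrable_scale c f : P.-integrable setT (EFin \o f) ->
  P.-integrable setT (EFin \o (fun w => c * f w)).
Proof.
move=> if'; rewrite (_ : _ \o _ = (fun w => c%:E * (EFin \o f) w)%E)//.
exact: integrableZl.
Qed.

Lemma Rintegral_dist_le f g h : P.-integrable setT (EFin \o f) ->
  P.-integrable setT (EFin \o g) -> P.-integrable setT (EFin \o h) ->
  (forall w, `|f w - g w| <= h w) ->
  `|\int[P]_w f w - \int[P]_w g w| <= \int[P]_w h w.
Proof.
move=> if' ig ih fgh.
have ifg : P.-integrable setT (EFin \o (fun w => f w - g w)).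
  rewrite (_ : _ \o _ = ((EFin \o f) \- (EFin \o g))%E)//.
  exact: integrableB.
rewrite -RintegralB// (le_trans (le_normr_Rintegral _ ifg))//.
by apply: le_Rintegral => //; exact: (integrable_norm ifg).
Qed.

End expectations.

Lemma cvg_harmonic_bound {R : realType} (u : nat -> R) (l C : R) :
  (forall n, `|l - u n| <= n.+1%:R^-1 * C) -> u @ \oo --> l.
Proof.
move=> h; apply/cvgrPdist_le => e e0.
have : (fun n => n.+1%:R^-1 * C) @ \oo --> (0 : R).
  by rewrite -[X in _ --> X](mul0r C); apply: cvgM; [exact: cvg_harmonic|exact: cvg_cst].
move=> /cvgrPdist_le/(_ e e0); apply: filterS => n /=; rewrite sub0r normrN => hn.
by rewrite (le_trans (h n))// (le_trans (ler_norm _)).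
Qed.

Section random_vector.
Context {dO : measure_display} {O : measurableType dO} {R : realType}.
Variables (P : probability O R) (d : nat) (Z : O -> 'I_d -> R).
Hypothesis mZ : forall i, measurable_fun setT (fun w => Z w i).

Lemma measurable_exp_closed (f : ('I_d -> R) -> R) : exp_closed f ->
  measurable_fun setT (fun w => f (Z w)).
Proof.
elim=> [c s|{}f g _ mf _ mg|{}f W g _ _ _ mg fg].
- apply: measurable_funM => //; apply: measurableT_comp; first exact: measurable_expR.
  by apply: measurable_sum => j; exact: measurable_funM.
- exact: measurable_funD.
- apply: (measurable_fun_cvg (h := fun n w => g n (Z w))) => [n|w _]; first exact: mg.
  exact: cvg_harmonic_bound (fun n => fg n (Z w)).
Qed.

Hypothesis iZ : forall s : 'I_d -> R,
  P.-integrable setT (EFin \o (fun w => expR (\sum_j s j * Z w j))).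

Lemma integrable_exp_closed (f : ('I_d -> R) -> R) : exp_closed f ->
  P.-integrable setT (EFin \o (fun w => f (Z w))).
Proof.
move=> cf; elim: cf (measurable_exp_closed cf) => [c s|{}f g cf IHf cg IHg|{}f W g cW IHW cg IHg fg] mf.
- exact: integrable_scale.
- exact: integrable_add (IHf (measurable_exp_closed cf)) (IHg (measurable_exp_closed cg)).
- have iW := IHW (measurable_exp_closed cW).
  have ig := IHg 0%N (measurable_exp_closed (cg 0%N)).
  apply: (integrable_dominated mf (integrable_add (integrable_norm ig) iW)) => w /=.
  rewrite -{1}[f (Z w)](subrK (g 0%N (Z w))) addrC (le_trans (ler_normD _ _))//.
  by rewrite lerD2l (le_trans (fg 0%N (Z w)))// invr1 mul1r.
Qed.

End random_vector.

Section convergence.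
Context {dO dT : measure_display} {O : measurableType dO} {T : measurableType dT}.
Context {R : realType} {I : Type} (F : set_system I) {FF : ProperFilter F}.
Variables (P : probability O R) (Q : probability T R) (d : nat).
Variables (Y : I -> O -> 'I_d -> R) (G : T -> 'I_d -> R).
Hypothesis mY : forall N i, measurable_fun setT (fun w => Y N w i).
Hypothesis mG : forall i, measurable_fun setT (fun w => G w i).
Hypothesis iY : \forall N \near F, forall s : 'I_d -> R,
  P.-integrable setT (EFin \o (fun w => expR (\sum_j s j * Y N w j))).
Hypothesis iG : forall s : 'I_d -> R,
  Q.-integrable setT (EFin \o (fun w => expR (\sum_j s j * G w j))).
Hypothesis cvgYG : forall s : 'I_d -> R,
  \int[P]_w expR (\sum_j s j * Y N w j) @[N --> F] --> \int[Q]_w expR (\sum_j s j * G w j).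

(** At a limit, the expectations of the weight [W] converge, hence are eventually
    bounded, and the approximation is uniform in [N]. *)
Lemma cvg_exp_closed (f : ('I_d -> R) -> R) : exp_closed f ->
  \int[P]_w f (Y N w) @[N --> F] --> \int[Q]_w f (G w).
Proof.
elim=> [c s|{}f g cf IHf cg IHg|{}f W g cW IHW cg IHg fg].
- rewrite RintegralZl//.
  have h : (c * \int[P]_w expR (\sum_j s j * Y N w j)) @[N --> F] -->
      c * \int[Q]_w expR (\sum_j s j * G w j).
    by apply: cvgM; [exact: cvg_cst|exact: cvgYG].
  apply: cvg_trans h; apply: near_eq_cvg.
  by apply: filterS iY => N iN; rewrite RintegralZl.
- rewrite RintegralD//; [|exact: integrable_exp_closed..].
  apply: cvg_trans (cvgD IHf IHg); apply: near_eq_cvg.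
  near=> N; have iN : forall s : 'I_d -> R,
    P.-integrable setT (EFin \o (fun w => expR (\sum_j s j * Y N w j))) by near: N.
  by rewrite /= RintegralD//; exact: integrable_exp_closed.
have cf := exp_closed_lim cW cg fg.
pose C := `|\int[Q]_w W (G w)| + 1; have C0 : 0 < C by rewrite ltr_wpDl.
have dist (d0 : measure_display) (O0 : measurableType d0) (P0 : probability O0 R)
    (Z : O0 -> 'I_d -> R) n (mZ : forall i, measurable_fun setT (fun w => Z w i))
    (iZ : forall s : 'I_d -> R, P0.-integrable setT (EFin \o (fun w => expR (\sum_j s j * Z w j)))) :
    `|\int[P0]_w W (Z w)| <= C ->
    `|\int[P0]_w f (Z w) - \int[P0]_w g n (Z w)| <= n.+1%:R^-1 * C.
  move=> WC; apply: le_trans (_ : n.+1%:R^-1 * \int[P0]_w W (Z w) <= _); last first.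
    by rewrite ler_wpM2l ?invr_ge0// (le_trans (ler_norm _)).
  rewrite -RintegralZl//; last exact: integrable_exp_closed.
  apply: Rintegral_dist_le => //; [exact: integrable_exp_closed..|].
  by apply: integrable_scale; exact: integrable_exp_closed.
apply/cvgrPdist_le => e e0.
pose n := Num.truncn (C / (e / 3)).
have nC : n.+1%:R^-1 * C <= e / 3.
  rewrite mulrC ler_pdivrMr// mulrC -ler_pdivrMr ?divr_gt0//.
  exact/ltW/truncnS_gt.
have /cvgrPdist_le/(_ (e / 3)) := IHg n; rewrite divr_gt0// => /(_ isT) gn.
have /cvgrPdist_le/(_ 1 ltr01) WN := IHW.
near=> N.
have iN : forall s : 'I_d -> R,
    P.-integrable setT (EFin \o (fun w => expR (\sum_j s j * Y N w j))) by near: N.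
have h1 : `|\int[Q]_w f (G w) - \int[Q]_w g n (G w)| <= n.+1%:R^-1 * C.
  by apply: dist => //; rewrite /C lerDl.
have h2 : `|\int[P]_w f (Y N w) - \int[P]_w g n (Y N w)| <= n.+1%:R^-1 * C.
  apply: dist => //; have : `|\int[Q]_w W (G w) - \int[P]_w W (Y N w)| <= 1 by near: N.
  rewrite /C distrC => h; rewrite -[X in `| X |](subrK (\int[Q]_w W (G w))).
  by rewrite (le_trans (ler_normD _ _))// addrC lerD2l.
have h3 : `|\int[Q]_w g n (G w) - \int[P]_w g n (Y N w)| <= e / 3 by near: N.
move: (le_trans h1 nC) (le_trans h2 nC) h3; rewrite !ler_norml => /andP[? ?] /andP[? ?] /andP[? ?].
by apply/andP; split; lra.
Unshelve. all: by end_near.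
Qed.

End convergence.

(** * Approximation by trigonometric polynomials *)

Section trigonometric_polynomials.
Variables (R : realType) (d : nat).
Implicit Types (p q : ('I_d -> R) -> R) (x y : 'I_d -> R).

(** These functions are at the same time bounded, Lipschitz, and limits of
    exponential sums: the first two properties absorb small perturbations of
    the argument, the last one gives convergence of expectations. *)
Inductive trig_poly : (('I_d -> R) -> R) -> Prop :=
| trig_poly_cst c : trig_poly (fun=> c)
| trig_poly_sin c i : trig_poly (fun x => sin (c * x i))
| trig_poly_add p q : trig_poly p -> trig_poly q -> trig_poly (fun x => p x + q x)
| trig_poly_mul p q : trig_poly p -> trig_poly q -> trig_poly (fun x => p x * q x).

Lemma trig_poly_eq p q : p =1 q -> trig_poly p -> trig_poly q.
Proof. by move=> /funext ->. Qed.

Lemma trig_poly_sum (I : Type) (r : seq I) (F : I -> ('I_d -> R) -> R) :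
  (forall i, trig_poly (F i)) -> trig_poly (fun x => \sum_(i <- r) F i x).
Proof.
move=> tF; elim: r => [|i r IH].
  by apply: trig_poly_eq (trig_poly_cst 0) => x; rewrite big_nil.
by apply: trig_poly_eq (trig_poly_add (tF i) IH) => x; rewrite big_cons.
Qed.

Lemma trig_poly_prod (I : Type) (r : seq I) (F : I -> ('I_d -> R) -> R) :
  (forall i, trig_poly (F i)) -> trig_poly (fun x => \prod_(i <- r) F i x).
Proof.
move=> tF; elim: r => [|i r IH].
  by apply: trig_poly_eq (trig_poly_cst 1) => x; rewrite big_nil.
by apply: trig_poly_eq (trig_poly_mul (tF i) IH) => x; rewrite big_cons.
Qed.

Lemma exp_closed_trig_poly p : trig_poly p -> exp_closed p.
Proof.
elim=> [c|c i|{}p q _ cp _ cq|{}p q _ cp _ cq].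
- exact: exp_closed_cst.
- exact: exp_closed_sin.
- exact: exp_closed_add.
- exact: exp_closed_mul.
Qed.

Lemma trig_poly_lipschitz p : trig_poly p -> exists2 C, 0 <= C &
  forall x y, `|p x| <= C /\ `|p x - p y| <= C * \sum_i `|x i - y i|.
Proof.
have S0 x y : 0 <= \sum_i `|x i - y i| by exact: sumr_ge0.
elim=> [c|c i|{}p q _ [C C0 pC] _ [D D0 qD]|{}p q _ [C C0 pC] _ [D D0 qD]].
- by exists `|c| => // x y; rewrite lexx subrr normr0 mulr_ge0.
- exists (1 + `|c|) => [|x y]; first by rewrite addr_ge0.
  split; first by rewrite (le_trans (_ : _ <= 1)) ?lerDl// ler_norml sin_geN1 sin_le1.
  rewrite (le_trans (sin_lipschitz _ _))// -mulrBr normrM ler_pM//; first by rewrite lerDr.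
  by rewrite (bigD1 i)//= lerDl sumr_ge0.
- exists (C + D) => [|x y]; first by rewrite addr_ge0.
  have [p1 p2] := pC x y; have [q1 q2] := qD x y.
  rewrite (le_trans (ler_normD _ _)) ?lerD//; split=> //.
  rewrite (_ : _ - _ = (p x - p y) + (q x - q y)); last by ring.
  by rewrite (le_trans (ler_normD _ _))// mulrDl lerD.
- exists (2 * C * D) => [|x y]; first by rewrite !mulr_ge0.
  have [p1 p2] := pC x y; have [q1 q2] := qD x y; have [p3 _] := pC y x.
  have CD0 : 0 <= C * D by rewrite mulr_ge0.
  split.
    by rewrite normrM (le_trans (ler_pM _ _ p1 q1))// -mulrA mulr_natl mulr2n lerDl.
  rewrite (_ : _ - _ = (p x - p y) * q x + p y * (q x - q y)); last by ring.
  rewrite (le_trans (ler_normD _ _))// !normrM.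
  rewrite (_ : _ * _ = C * (\sum_i `|x i - y i|) * D + C * (D * \sum_i `|x i - y i|));
    last by move: (\sum_i _) => S; ring.
  by rewrite lerD// ler_pM.
Qed.

End trigonometric_polynomials.

Section bernstein_weights.
Variable R : realType.

(** The law of the number of successes in [n] independent trials of success
    probability [u]; the recursion conditions on the first trial. *)
Fixpoint bernstein (n k : nat) (u : R) : R :=
  if n is n'.+1 then
    (1 - u) * bernstein n' k u + u * (if k is k'.+1 then bernstein n' k' u else 0)
  else (k == 0%N)%:R.

Lemma bernstein_ge0 n k u : 0 <= u <= 1 -> 0 <= bernstein n k u.
Proof.
move=> /andP[u0 u1]; elim: n k => [|n IH] k /=; first by rewrite ler0n.
by rewrite addr_ge0// mulr_ge0 ?subr_ge0//; case: k.
Qed.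

Lemma bernstein_gt n k u : (n < k)%N -> bernstein n k u = 0.
Proof.
elim: n k => [|n IH] [|k]//= nk.
by rewrite !IH ?mulr0 ?addr0// ltnW.
Qed.

Lemma sum_bernsteinS n (phi : nat -> R) u :
  \sum_(k < n.+2) phi k * bernstein n.+1 k u =
  (1 - u) * (\sum_(k < n.+1) phi k * bernstein n k u) +
  u * (\sum_(k < n.+1) phi k.+1 * bernstein n k u).
Proof.
under eq_bigr => k _ do rewrite /= mulrDr.
rewrite big_split/=; congr (_ + _).
  rewrite big_ord_recr/= bernstein_gt// !mulr0 addr0 mulr_sumr.
  by apply: eq_bigr => k _; rewrite mulrCA.
rewrite big_ord_recl/= !mulr0 add0r mulr_sumr.
by apply: eq_bigr => k _; rewrite mulrCA.
Qed.

Lemma sum_bernstein n u : \sum_(k < n.+1) bernstein n k u = 1.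
Proof.
elim: n => [|n IH]; first by rewrite big_ord1.
under eq_bigr do rewrite -[bernstein _ _ _]mul1r.
rewrite (sum_bernsteinS n (fun=> 1)); under eq_bigr do rewrite mul1r.
by rewrite IH; ring.
Qed.

(** The recursion adds the variance [u (1 - u)] of one more trial. *)
Lemma bernstein_variance n u :
  \sum_(k < n.+1) (k%:R - n%:R * u) ^+ 2 * bernstein n k u = n%:R * u * (1 - u).
Proof.
elim: n => [|n IH]; first by rewrite big_ord1 !mul0r subr0 expr0n mul0r.
rewrite (sum_bernsteinS n (fun k => (k%:R - n.+1%:R * u) ^+ 2)) !mulr_sumr -big_split/=.
rewrite (eq_bigr (fun k : 'I_n.+1 => (k%:R - n%:R * u) ^+ 2 * bernstein n k u +
    u * (1 - u) * bernstein n k u)); last first.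
  by move=> k _; rewrite -!natr1; ring.
by rewrite big_split/= IH -mulr_sumr sum_bernstein -natr1; ring.
Qed.

Variable d : nat.
Implicit Types (k : {ffun 'I_d -> nat}) (u : 'I_d -> R).

Lemma sum_prod_bernstein n u :
  \sum_(k : {ffun 'I_d -> 'I_n.+1}) \prod_i bernstein n (k i) (u i) = 1.
Proof.
rewrite -(bigA_distr_bigA (fun i (j : 'I_n.+1) => bernstein n j (u i))).
by rewrite big1// => i _; rewrite sum_bernstein.
Qed.

Lemma sum_prod_bernstein_variance n u i0 :
  \sum_(k : {ffun 'I_d -> 'I_n.+1})
    ((k i0)%:R - n%:R * u i0) ^+ 2 * \prod_i bernstein n (k i) (u i) =
  n%:R * u i0 * (1 - u i0).
Proof.
pose F i (j : 'I_n.+1) := (if i == i0 then (j%:R - n%:R * u i) ^+ 2 else 1) *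
  bernstein n j (u i).
transitivity (\sum_(k : {ffun 'I_d -> 'I_n.+1}) \prod_i F i (k i)).
  apply: eq_bigr => k _; rewrite [X in _ * X](bigD1 i0)//= [RHS](bigD1 i0)//= /F eqxx mulrA; congr (_ * _).
  by apply: eq_bigr => i /negPf->; rewrite mul1r.
rewrite -(bigA_distr_bigA F) (bigD1 i0)//= [X in _ * X]big1 => [|i /negPf ii0].
  by rewrite mulr1 -bernstein_variance; apply: eq_bigr => j _; rewrite /F eqxx.
rewrite -[RHS](sum_bernstein n (u i)); apply: eq_bigr => j _.
by rewrite /F ii0 mul1r.
Qed.

End bernstein_weights.

Section approximation.
Variables (R : realType) (d : nat).
Implicit Types (x y : 'I_d -> R).

(** [sin a - sin b = 2 cos m sin h] with [m] and [h] the half sum and the half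
    difference, and [cos m >= sin h] as [|m| + h <= pi / 2]. *)
Lemma sin_dist_ge (a b : R) : - (pi / 2) <= a <= pi / 2 -> - (pi / 2) <= b <= pi / 2 ->
  (a - b) ^+ 2 / 32 <= `|sin a - sin b|.
Proof.
wlog ba : a b / b <= a.
  move=> H aI bI; have [|/ltW] := leP b a => ab; first exact: H.
  by rewrite distrC -[a - b]opprB sqrrN; exact: H.
move=> /andP[a1 a2] /andP[b1 b2]; set m := (a + b) / 2; set h := (a - b) / 2.
have p2 := pihalf_lt2 R.
have h0 : 0 <= h by rewrite /h; lra.
have h1 : h <= pi / 2 by rewrite /h; lra.
have sh : h / 4 <= sin h.
  apply: le_trans (_ : sin (h / 2) <= _).
    have := @sin_ge_half R (h / 2); lra.
  have [->|hN] := eqVneq h 0; first by rewrite mul0r.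
  have hp : 0 < h by rewrite lt_neqAle eq_sym hN.
  by apply/ltW; rewrite ltr_sin ?in_itv/=; lra.
have cm : sin h <= cos m.
  have m1 : `|m| <= pi / 2 - h by rewrite ler_norml /m /h; apply/andP; split; lra.
  have -> : sin h = cos (pi / 2 - h) by rewrite -cosN opprB cosBpihalf.
  rewrite -(cos_norm m); have m0 : 0 <= `|m| by exact: normr_ge0.
  move: m1; rewrite le_eqVlt => /predU1P[->//|m1].
  by apply/ltW; rewrite ltr_cos ?in_itv/=; lra.
have -> : sin a - sin b = 2 * cos m * sin h.
  have -> : a = m + h by rewrite /m /h; lra.
  have -> : b = m - h by rewrite /m /h; lra.
  by rewrite sinD sinB; ring.
have s0 : 0 <= sin h by lra.
have c0 : 0 <= cos m by lra.
rewrite ger0_norm ?mulr_ge0//.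
have -> : (a - b) ^+ 2 / 32 = 2 * (h / 4) * (h / 4) by rewrite /h; field.
by apply: ler_pM => //; [lra..|apply: ler_pM; lra].
Qed.

Variables (f : d.-tuple R -> R) (M : R).
Hypothesis cf : continuous (f \o @tuple_of_row R d).
Hypothesis fM : forall v, `|f v| <= M.

Let fv x := f [tuple x i | i < d].

Let M0 : 0 <= M. Proof. exact: le_trans (normr_ge0 _) (fM [tuple 0 | _ < d]). Qed.

Let dist2M x y : `|fv x - fv y| <= 2 * M.
Proof.
have h1 : `|fv x| <= M by exact: fM.
have h2 : `|fv y| <= M by exact: fM.
by rewrite (le_trans (ler_normB _ _))//; lra.
Qed.

(** The Heine-Cantor theorem, through the covering formulation of compactness
    with the modulus of continuity as the parameter tending to zero. *)
Lemma unif_continuous_box (B e : R) : 0 < e -> exists2 del, 0 < del &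
  forall x y, (forall i, `|x i| <= B) -> (forall i, `|x i - y i| < del) ->
  `|fv x - fv y| <= e.
Proof.
move=> e0; pose K := [set v : 'rV[R]_d | forall i, `[- B, B]%classic (v ord0 i)].
have cK : compact K by apply: (@rV_compact R d (fun=> `[- B, B]%classic)) => i; exact: segment_compact.
pose row x : 'rV[R]_d := \row_i x i.
have fE x : fv x = (f \o @tuple_of_row R d) (row x).
  by rewrite /fv /=; congr f; apply: eq_from_tnth => i; rewrite !tnth_mktuple mxE.
have := cK; rewrite compact_near_coveringP => /(_ R (0 : R)^'+
  (fun del v => forall w : 'rV[R]_d, `|v - w| < del ->
     `|(f \o @tuple_of_row R d) v - (f \o @tuple_of_row R d) w| <= e) _) [|r /= r0 Hr].
  move=> v _; have e20 : 0 < e / 2 by rewrite divr_gt0.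
  have cv : (f \o @tuple_of_row R d) @ v --> (f \o @tuple_of_row R d) v by exact: cf.
  move/cvgrPdist_le : cv => /(_ _ e20).
  move=> /nbhs_normP[r /= r0 Hr].
  exists (ball v (r / 2), [set del | 0 < del < r / 2]) => /=.
    split; first by apply: nbhsx_ballx; rewrite divr_gt0.
    exists (r / 2) => /=; first by rewrite divr_gt0.
    by move=> del /=; rewrite sub0r normrN => + del0; rewrite gtr0_norm// del0 => ->.
  move=> [v' del]/= [vv' /andP[del0 dr]] w v'w.
  have h1 := Hr v'; have h2 := Hr w.
  move: vv'; rewrite -ball_normE/= => vv'.
  have := h1; rewrite /= => /(_ (lt_le_trans vv' _)) {}h1.
  have {}h1 := h1 ltac:(lra).
  have {}h2 : `|(f \o @tuple_of_row R d) v - (f \o @tuple_of_row R d) w| <= e / 2.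
    apply: h2 => /=; rewrite -(subrK v' v) -addrA (le_lt_trans (ler_normD _ _))//; lra.
  move: h1 h2; rewrite /= !ler_norml => /andP[? ?] /andP[? ?].
  by apply/andP; split; lra.
exists (r / 2); first by rewrite divr_gt0.
move=> x y xB xy; rewrite !fE; apply: (Hr (r / 2)) => /=.
- by rewrite sub0r normrN gtr0_norm ?divr_gt0//; lra.
- by rewrite divr_gt0.
- by move=> i; rewrite /= mxE in_itv/= -ler_norml.
- suff : ball (row x) (r / 2) (row y) by rewrite -ball_normE.
  split; first by rewrite divr_gt0.
  by move=> a i; rewrite -ball_normE /= !mxE.
Qed.

(** Nearby points are handled by uniform continuity; for the others some
    coordinates are apart, hence also their sines, and the quadratic term
    exceeds [2 M]. This is the form needed for Chebyshev's inequality in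
    Bernstein's proof. *)
Lemma sin_modulus (A e : R) : 0 < A -> 0 < e -> exists2 K, 0 <= K &
  forall x y, (forall i, `|x i| <= A * (pi / 2)) -> (forall i, `|y i| <= A * (pi / 2)) ->
  `|fv x - fv y| <= e + K * \sum_i (sin (A^-1 * x i) - sin (A^-1 * y i)) ^+ 2.
Proof.
move=> A0 e0; have [del del0 Hdel] := unif_continuous_box (A * (pi / 2)) e0.
pose c := (del / A) ^+ 2 / 32.
have c0 : 0 < c by rewrite divr_gt0// exprn_gt0// divr_gt0.
have M20 : 0 <= 2 * M by rewrite mulr_ge0.
have K0 : 0 <= 2 * M / c ^+ 2 by rewrite divr_ge0// sqr_ge0.
exists (2 * M / c ^+ 2) => // x y xA yA.
have S0 i : 0 <= (sin (A^-1 * x i) - sin (A^-1 * y i)) ^+ 2 by exact: sqr_ge0.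
have [close|] := boolP [forall i, `|x i - y i| < del].
  apply: ler_wpDr; first by apply: mulr_ge0 => //; apply: sumr_ge0.
  by apply: Hdel => // i; exact: (forallP close).
rewrite negb_forall => /existsP[i]; rewrite -leNgt => far.
have box z : `|z| <= A * (pi / 2) -> - (pi / 2) <= A^-1 * z <= pi / 2.
  by rewrite -ler_norml normrM gtr0_norm ?invr_gt0// ler_pdivrMl.
have := sin_dist_ge (box _ (xA i)) (box _ (yA i)); rewrite -mulrBr => hs.
have cs : c <= `|sin (A^-1 * x i) - sin (A^-1 * y i)|.
  apply: le_trans hs; rewrite /c ler_pM2r//.
  have dA : del / A <= `|A^-1 * (x i - y i)|.
    by rewrite normrM gtr0_norm ?invr_gt0// mulrC ler_pM2l ?invr_gt0.
  have dA0 : 0 <= del / A by rewrite divr_ge0// ltW.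
  by rewrite -[leRHS]real_normK ?num_real//; apply: lerXn2r; rewrite ?nnegrE.
have cs2 : c ^+ 2 <= (sin (A^-1 * x i) - sin (A^-1 * y i)) ^+ 2.
  by rewrite -[leRHS]real_normK ?num_real//; apply: lerXn2r; rewrite ?nnegrE// ltW.
apply: le_trans (_ : 2 * M <= _).
  exact: dist2M.
apply: ler_wpDl; first exact: ltW.
rewrite mulrAC ler_pdivlMr ?exprn_gt0// ler_wpM2l ?mulr_ge0//.
by rewrite (bigD1 i)//= (le_trans cs2)// lerDl sumr_ge0.
Qed.

(** Inside the box [|x i| <= A * pi / 2] the coordinates [sin (x i / A)] are
    faithful and this is Bernstein approximation in them; outside it one of the
    [|x i| / A] exceeds [1], and boundedness is enough. *)
Lemma trig_approximation (A e : R) : 1 <= A -> 0 < e -> exists2 p, trig_poly p &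
  forall x, `|fv x - p x| <= e + 2 * M / A * \sum_i `|x i|.
Proof.
move=> A1 e0; have A0 : 0 < A by lra.
have half (z : R) : 0 <= z -> z <= 1 -> -1 <= 2 * z - 1 <= 1.
  by move=> z0 z1; apply/andP; split; lra.
have e20 : 0 < e / 2 by rewrite divr_gt0.
have [K K0 HK] := sin_modulus A0 e20.
pose n := (Num.truncn (4 * K * d%:R / (e / 2))).+1.
have n0 : 0 < n%:R :> R by rewrite ltr0n.
have nK : 4 * K * d%:R / n%:R <= e / 2.
  by rewrite ler_pdivrMr// [leRHS]mulrC -ler_pdivrMr//; exact/ltW/truncnS_gt.
pose u x i : R := (1 + sin (A^-1 * x i)) / 2.
(* the points where [(1 + sin (x / A)) / 2] is a multiple of [1 / n] *)
pose node (k : {ffun 'I_d -> 'I_n.+1}) (i : 'I_d) : R := A * asin (2 * (k i)%:R / n%:R - 1).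
pose w (k : {ffun 'I_d -> 'I_n.+1}) x := \prod_i bernstein n (k i) (u x i).
have u01 x i : 0 <= u x i <= 1.
  by rewrite /u; have := sin_geN1 (A^-1 * x i); have := sin_le1 (A^-1 * x i); lra.
have w0 k x : 0 <= w k x by apply: prodr_ge0 => i _; exact: bernstein_ge0.
have w1 x : \sum_k w k x = 1 by exact: sum_prod_bernstein.
pose z (k : {ffun 'I_d -> 'I_n.+1}) (i : 'I_d) : R := 2 * (k i)%:R / n%:R - 1.
have arg k i : -1 <= z k i <= 1.
  have k0 : 0 <= (k i)%:R / n%:R :> R by rewrite divr_ge0.
  have k1 : (k i)%:R / n%:R <= 1 :> R by rewrite ler_pdivrMr// mul1r ler_nat -ltnS.
  by rewrite /z -mulrA; exact: half.
have node_box k i : `|node k i| <= A * (pi / 2).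
  rewrite normrM gtr0_norm// ler_pM2l// ler_norml.
  by rewrite -/(z k i) asin_geNpi2 ?asin_lepi2 ?arg.
have sin_node k i : sin (A^-1 * node k i) = z k i.
  by rewrite /node -/(z k i) mulKf ?gt_eqF// asinK// in_itv/= arg.
exists (fun x => \sum_k fv (node k) * w k x).
  apply: trig_poly_sum => k; apply: trig_poly_mul; first exact: trig_poly_cst.
  apply: trig_poly_prod => i.
  have tu : trig_poly (fun x => u x i).
    apply: trig_poly_eq (trig_poly_mul (trig_poly_add (trig_poly_cst _ 1)
      (trig_poly_sin A^-1 i)) (trig_poly_cst _ 2^-1)) => x //.
  have tu1 : trig_poly (fun x => 1 - u x i).
    apply: trig_poly_eq (trig_poly_add (trig_poly_cst _ 1)
      (trig_poly_mul (trig_poly_cst _ (-1)) tu)) => x.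
    by rewrite mulN1r.
  move: (nat_of_ord (k i)) => j {k}; move: (n) j => m; elim: m => [|m IH] j /=.
    exact: trig_poly_cst.
  apply: trig_poly_add; first exact: trig_poly_mul.
  by apply: trig_poly_mul => //; case: j => [|j] //; exact: trig_poly_cst.
move=> x; have diff : fv x - \sum_k fv (node k) * w k x = \sum_k (fv x - fv (node k)) * w k x.
  by under [in RHS]eq_bigr do rewrite mulrBl; rewrite sumrB -mulr_sumr w1 mulr1.
rewrite diff (le_trans (ler_norm_sum _ _ _))//.
under eq_bigr do rewrite normrM (ger0_norm (w0 _ _)).
have MA : 0 <= 2 * M / A by rewrite divr_ge0 ?mulr_ge0// ltW.
have [/forallP xA|] := boolP [forall i, `|x i| <= A * (pi / 2)].
  apply: le_trans (_ : e <= _); last by rewrite lerDl mulr_ge0 ?sumr_ge0.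
  pose D (k : {ffun 'I_d -> 'I_n.+1}) i := ((k i)%:R - n%:R * u x i) ^+ 2 * w k x.
  apply: le_trans (_ : \sum_k (e / 2 * w k x + \sum_i 4 * K / n%:R ^+ 2 * D k i) <= _).
    apply: ler_sum => k _; rewrite (le_trans (ler_wpM2r (w0 k x) (HK x _ xA (node_box k))))//.
    rewrite mulrDl lerD2l [leLHS]mulrAC mulr_sumr; apply: ler_sum => i _.
    rewrite sin_node /z /D /u le_eqVlt; apply/orP; left; apply/eqP.
    by field; rewrite gt_eqF.
  rewrite big_split/= -mulr_sumr w1 mulr1 exchange_big/=.
  rewrite [leRHS](_ : _ = e / 2 + e / 2); last by field.
  rewrite lerD2l (le_trans _ nK)//.
  apply: le_trans (_ : \sum_(i < d) 4 * K / n%:R <= _); last first.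
    by rewrite sumr_const card_ord -[leLHS]mulr_natr mulrAC.
  apply: ler_sum => i _; rewrite -mulr_sumr sum_prod_bernstein_variance.
  rewrite [leLHS](_ : _ = 4 * K / n%:R * (u x i * (1 - u x i))); last first.
    by field; rewrite gt_eqF.
  have /andP[ui0 ui1] := u01 x i.
  by rewrite ler_piMr ?divr_ge0 ?mulr_ge0 ?(ltW n0)//; nra.
rewrite negb_forall => /existsP[i]; rewrite -ltNge => xi.
apply: le_trans (_ : 2 * M <= _).
  have -> : 2 * M = \sum_k 2 * M * w k x by rewrite -mulr_sumr w1 mulr1.
  apply: ler_sum => k _.
  by apply: ler_wpM2r => //; exact: dist2M.
apply: ler_wpDl; first exact: ltW.
rewrite mulrAC ler_pdivlMr// ler_wpM2l ?mulr_ge0//.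
rewrite (bigD1 i)//= ler_wpDr ?sumr_ge0// (le_trans _ (ltW xi))//.
by rewrite ler_peMr ?(ltW A0)// pihalf_ge1.
Qed.

End approximation.

(** * From Laplace transforms to weak convergence *)

Section bounded_continuous.
Variables (R : realType) (d : nat) (f : d.-tuple R -> R) (M : R).
Hypothesis cf : continuous (f \o @tuple_of_row R d).
Hypothesis fM : forall v, `|f v| <= M.

(** The topology and the sigma-algebra live on different types, row vectors and
    tuples; a pointwise limit of trigonometric polynomials is measurable for the
    product sigma-algebra. *)
Lemma measurable_of_continuous_row : measurable_fun setT f.
Proof.
have M0 : 0 <= M by exact: le_trans (normr_ge0 _) (fM [tuple 0 | _ < d]).
have n0 n : 0 < n.+1%:R^-1 :> R by rewrite invr_gt0.
have n1 n : 1 <= n.+1%:R :> R by rewrite ler1n.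
have /boolp.choice[p Hp] : forall n : nat, exists p, trig_poly p /\ forall x : 'I_d -> R,
    `|f [tuple x i | i < d] - p x| <= n.+1%:R^-1 + 2 * M / n.+1%:R * \sum_i `|x i|.
  by move=> n; have [p tp pP] := trig_approximation cf fM (n1 n) (n0 n); exists p.
apply: (measurable_fun_cvg (h := fun n v => p n (tnth v))) => [n|v _].
  apply: measurable_exp_closed; last exact/exp_closed_trig_poly/(Hp n).1.
  by move=> i; exact: measurable_tnth.
apply: (@cvg_harmonic_bound _ _ _ (1 + 2 * M * \sum_i `|tnth v i|)) => n.
have := (Hp n).2 (tnth v).
rewrite (_ : [tuple _ | i < d] = v); last by apply: eq_from_tnth => i; rewrite tnth_mktuple.
move=> h; rewrite (le_trans h)// mulrDr mulr1 lerD2l.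
by rewrite mulrA [X in X * _ <= _]mulrC.
Qed.

Lemma integrable_bounded_continuous {dO : measure_display} {O : measurableType dO}
    (P : probability O R) (X : O -> 'I_d -> R) :
  (forall i, measurable_fun setT (fun w => X w i)) ->
  P.-integrable setT (EFin \o (fun w => f [tuple X w i | i < d])).
Proof.
move=> mX; apply: (@integrable_dominated _ _ _ _ _ (cst M)) => //.
- apply: (measurableT_comp measurable_of_continuous_row).
  apply/measurable_fun_tnthP => i; rewrite (_ : _ \o _ = fun w => X w i)//.
  by apply/funext => w /=; rewrite tnth_mktuple.
- exact: finite_measure_integrable_cst.
Qed.

End bounded_continuous.

Section l1_majorant.
Variables (R : realType) (d : nat).

(** A member of [exp_closed] above the l1 norm, so that first moments are bounded
    by Laplace transforms. *)
Definition l1_majorant (x : 'I_d -> R) : R := \sum_i (expR (x i) + expR (- x i)).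

Lemma exp_closed_l1_majorant : exp_closed l1_majorant.
Proof.
apply: exp_closed_sum => i.
apply: exp_closed_eq (exp_closed_add (exp_closed_exp1 1 1 i) (exp_closed_exp1 1 (-1) i)) => x.
by rewrite !mul1r mulN1r.
Qed.

Lemma le_l1_majorant x : \sum_i `|x i| <= l1_majorant x.
Proof.
apply: ler_sum => i _; apply: le_trans (expR_abs_le _).
by have := expR_ge1Dx `|x i|; lra.
Qed.

End l1_majorant.

Section weak_convergence.
Context {dO dT : measure_display} {O : measurableType dO} {T : measurableType dT}.
Context {R : realType} {I : Type} (F : set_system I) {FF : ProperFilter F}.
Variables (P : probability O R) (Q : probability T R) (d : nat).
Variables (X Y : I -> O -> 'I_d -> R) (G : T -> 'I_d -> R).
Hypothesis mX : forall N i, measurable_fun setT (fun w => X N w i).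
Hypothesis mY : forall N i, measurable_fun setT (fun w => Y N w i).
Hypothesis mG : forall i, measurable_fun setT (fun w => G w i).
Hypothesis iY : \forall N \near F, forall s : 'I_d -> R,
  P.-integrable setT (EFin \o (fun w => expR (\sum_j s j * Y N w j))).
Hypothesis iG : forall s : 'I_d -> R,
  Q.-integrable setT (EFin \o (fun w => expR (\sum_j s j * G w j))).
Hypothesis cvgYG : forall s : 'I_d -> R,
  \int[P]_w expR (\sum_j s j * Y N w j) @[N --> F] --> \int[Q]_w expR (\sum_j s j * G w j).
Hypothesis iXY : \forall N \near F,
  P.-integrable setT (EFin \o (fun w => \sum_i `|X N w i - Y N w i|)).
Hypothesis cvgXY : \int[P]_w (\sum_i `|X N w i - Y N w i|) @[N --> F] --> (0 : R).

(** Replace [f] by a trigonometric polynomial [p] within [e / 8 + 2 M / A |x|_1]: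
    expectations of the l1 norm are bounded, so [A] can be chosen first. For [p]
    the change from [X] to [Y] is Lipschitz, and the convergence along [Y] is
    [cvg_exp_closed]. *)
Lemma weak_cvg_of_laplace (f : d.-tuple R -> R) (M : R) :
  continuous (f \o @tuple_of_row R d) -> (forall v, `|f v| <= M) ->
  \int[P]_w f [tuple X N w i | i < d] @[N --> F] --> \int[Q]_w f [tuple G w i | i < d].
Proof.
move=> cf fM.
have M0 : 0 <= M by exact: le_trans (normr_ge0 _) (fM [tuple 0 | _ < d]).
pose V := @l1_majorant R d; have cV : exp_closed V by exact: exp_closed_l1_majorant.
have VG0 : 0 <= \int[Q]_w V (G w).
  by apply: Rintegral_ge0 => w _; rewrite sumr_ge0// => i _; rewrite addr_ge0 ?expR_ge0.
pose L := \int[Q]_w V (G w) + 2; have L0 : 0 < L by rewrite ltr_wpDl.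
apply/cvgrPdist_le => e e0; have e8 : 0 < e / 8 by rewrite divr_gt0.
(* [L] bounds the l1 norms in mean, so this makes [2 * M / A * L <= e / 8] *)
pose A := 1 + 2 * M * L / (e / 8).
have ML0 : 0 <= 2 * M * L by rewrite !mulr_ge0// ltW.
have A1 : 1 <= A by rewrite lerDl divr_ge0// ltW.
have A0 : 0 < A by rewrite (lt_le_trans ltr01).
have MA0 : 0 <= 2 * M / A by rewrite divr_ge0 ?mulr_ge0// ltW.
have MA : 2 * M / A * L <= e / 8.
  rewrite mulrAC ler_pdivrMr// [leRHS]mulrC -ler_pdivrMr//.
  by rewrite /A lerDr.
have [p tp pP] := trig_approximation cf fM A1 e8.
have [C C0 pC] := trig_poly_lipschitz tp; have cp := exp_closed_trig_poly tp.
have close (d0 : measure_display) (O0 : measurableType d0) (P0 : probability O0 R)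
    (Z : O0 -> 'I_d -> R) (h : O0 -> R) :
    (forall i, measurable_fun setT (fun w => Z w i)) ->
    P0.-integrable setT (EFin \o h) -> \int[P0]_w h w <= L ->
    (forall w, \sum_i `|Z w i| <= h w) ->
    `|\int[P0]_w f [tuple Z w i | i < d] - \int[P0]_w p (Z w)| <= e / 8 + e / 8.
  move=> mZ ih hL Zh.
  have ip : P0.-integrable setT (EFin \o (fun w => p (Z w))).
    apply: (@integrable_dominated _ _ _ _ _ (cst C)).
    - exact: measurable_exp_closed.
    - exact: finite_measure_integrable_cst.
    - by move=> w; exact: (pC _ (Z w)).1.
  apply: le_trans (_ : \int[P0]_w (cst (e / 8) w + 2 * M / A * h w) <= _).
    apply: Rintegral_dist_le => //.
    - exact: (integrable_bounded_continuous cf fM).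
    - apply: (integrable_add (f := cst (e / 8)) (g := fun w => 2 * M / A * h w)).
        exact: finite_measure_integrable_cst.
      exact: (integrable_scale (2 * M / A) ih).
    - move=> w; rewrite (le_trans (pP _))// lerD2l.
      by rewrite ler_wpM2l.
  rewrite RintegralD//; last 2 first.
  - exact: finite_measure_integrable_cst.
  - exact: (integrable_scale (2 * M / A) ih).
  have -> : \int[P0]_w cst (e / 8) w = e / 8.
    rewrite /cst (Rintegral_cst P0 measurableT) -[RHS]mulr1; congr (_ * _).
    exact: (congr1 fine (probability_setT P0)).
  rewrite RintegralZl//.
  by rewrite lerD2l (le_trans _ MA)// ler_wpM2l.
have hG : `|\int[Q]_w f [tuple G w i | i < d] - \int[Q]_w p (G w)| <= e / 8 + e / 8.
  apply: (close _ _ _ _ (fun w => V (G w))) => //.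
  - exact: integrable_exp_closed.
  - by rewrite lerDl.
  - by move=> w; exact: le_l1_majorant.
have pYG := cvg_exp_closed (FF := FF) mY mG iY iG cvgYG cp.
move/cvgrPdist_le : pYG => /(_ _ e8) pYG.
have VYG := cvg_exp_closed (FF := FF) mY mG iY iG cvgYG cV.
move/cvgrPdist_le : VYG => /(_ 1 ltr01) VYG.
have C10 : 0 < e / 8 / (C + 1) by rewrite divr_gt0// ltr_wpDl.
have /cvgrPdist_le/(_ _ C10) XY := cvgXY.
have /cvgrPdist_le/(_ 1 ltr01) XY1 := cvgXY.
near=> N.
have iN : forall s : 'I_d -> R,
    P.-integrable setT (EFin \o (fun w => expR (\sum_j s j * Y N w j))) by near: N.
have iD : P.-integrable setT (EFin \o (fun w => \sum_i `|X N w i - Y N w i|)) by near: N.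
have iV : P.-integrable setT (EFin \o (fun w => V (Y N w))) by exact: integrable_exp_closed.
have D1 : `|0 - \int[P]_w (\sum_i `|X N w i - Y N w i|)| <= 1 by near: N.
have De : `|0 - \int[P]_w (\sum_i `|X N w i - Y N w i|)| <= e / 8 / (C + 1) by near: N.
have V1 : `|\int[Q]_w V (G w) - \int[P]_w V (Y N w)| <= 1 by near: N.
have h1 : `|\int[P]_w f [tuple X N w i | i < d] - \int[P]_w p (X N w)| <= e / 8 + e / 8.
  apply: (close _ _ _ _ (fun w => \sum_i `|X N w i - Y N w i| + V (Y N w))) => //.
  - exact: integrable_add.
  - rewrite RintegralD//; move: D1 V1; rewrite /L !ler_norml => /andP[? ?] /andP[? ?]; lra.
  - move=> w; apply: le_trans (_ : \sum_i (`|X N w i - Y N w i| + `|Y N w i|) <= _).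
      by apply: ler_sum => i _; rewrite -{1}[X N w i](subrK (Y N w i)) ler_normD.
    by rewrite big_split/= lerD2l le_l1_majorant.
have ip Z (mZ : forall i, measurable_fun setT (fun w : O => Z w i)) :
    P.-integrable setT (EFin \o (fun w => p (Z w))).
  apply: (@integrable_dominated _ _ _ _ _ (cst C)).
  - exact: measurable_exp_closed.
  - exact: finite_measure_integrable_cst.
  - by move=> w; exact: (pC _ (Z w)).1.
have h2 : `|\int[P]_w p (X N w) - \int[P]_w p (Y N w)| <= e / 8.
  apply: le_trans (_ : \int[P]_w (C * \sum_i `|X N w i - Y N w i|) <= _).
    apply: Rintegral_dist_le; [exact: ip|exact: ip|exact: integrable_scale|].
    by move=> w; exact: (pC _ _).2.
  rewrite RintegralZl//; move: De; rewrite sub0r normrN.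
  rewrite ler_pdivlMr ?ltr_wpDl// => /(le_trans _); apply.
  rewrite mulrC; apply: ler_pM => //; last by rewrite lerDl.
    by apply: Rintegral_ge0 => w _; exact: sumr_ge0.
  exact: ler_norm.
have h3 : `|\int[Q]_w p (G w) - \int[P]_w p (Y N w)| <= e / 8 by near: N.
move: h1 h2 h3 hG; rewrite !ler_norml => /andP[? ?] /andP[? ?] /andP[? ?] /andP[? ?].
by apply/andP; split; lra.
Unshelve. all: by end_near.
Qed.

End weak_convergence.

(** * Rounding of the endpoints and the limit theorem *)

Section rounding_error.
Variables (R : realType) (P : probability (configs R) R).
Hypothesis hP : is_sine_process P.

Lemma npart_split (n L : nat) (x : R) (X : configs R) : n%:R <= x -> x < L%:R ->
  npartR `[0, x] X = npartR `[0, n%:R[ X + npartR `[n%:R, x] X.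
Proof.
move=> nx xL; have n0 : 0 <= n%:R :> R by [].
rewrite /npartR -natrD; congr (_%:R).
rewrite !(@npart_pts R L) -?big_split/=; last 3 first.
- by move=> y /=; rewrite !in_itv/= => /andP[ny yx]; apply/andP; split; lra.
- by move=> y /=; rewrite !in_itv/= => /andP[ny yx]; apply/andP; split; lra.
- by move=> y /=; rewrite !in_itv/= => /andP[ny yx]; apply/andP; split; lra.
apply: eq_bigr => y _; move: (val y) => {}y; rewrite /= !in_itv/= !asboolb.
case: (leP n%:R y) => ny /=; last by rewrite (le_trans (ltW ny) nx) addn0.
by rewrite andbF add0n (le_trans n0 ny).
Qed.

Lemma expect_npart_itv (n L : nat) (x : R) : n%:R <= x -> x < L%:R ->
  (\int[P]_X (npartR `[n%:R, x] X)%:E = ((x - n%:R) / pi)%:E)%E.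
Proof.
move=> nx xL; rewrite (expect_npart hP (L := L))//; last first.
  move=> y /=; rewrite !in_itv/= => /andP[ny yx].
  by rewrite (le_trans _ ny)//= (le_lt_trans yx).
rewrite lebesgue_measure_itv/= lte_fin; case: ltP => h.
  by rewrite -EFinD -EFinM mulrC.
by rewrite mule0 (_ : x - n%:R = 0) ?mul0r//; apply/eqP; rewrite subr_eq0 eq_le h nx.
Qed.

Lemma integrable_npartR (n : nat) (x : R) : n%:R <= x ->
  P.-integrable setT (EFin \o npartR `[n%:R, x]).
Proof.
move=> nx; apply/integrableP; split.
  apply/measurable_EFinP; apply: measurable_npartR => //.
  exists x => y /=; rewrite !in_itv/= => /andP[ny ->]; rewrite andbT.
  by rewrite (le_trans _ (le_trans (ler0n _ _) ny))// oppr_le0 (le_trans (ler0n _ _) nx).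
under eq_integral => X _ do rewrite /= ger0_norm ?ler0n//.
have xL : x < (Num.truncn x).+1%:R by exact: truncnS_gt.
by rewrite (expect_npart_itv nx xL) ltry.
Qed.

Variables (d : nat) (t : 'I_d -> R).
Hypothesis t0 : forall i, 0 <= t i.

Lemma measurable_lattice_xi N i : measurable_fun setT (lattice_xi t N i).
Proof.
apply: measurable_funM => //; apply: measurable_funB => //.
apply: measurable_npartR => //; exists (lattice_end t N i)%:R => x /=.
rewrite !in_itv/= => /andP[x0 /ltW ->]; rewrite andbT.
by rewrite (le_trans _ x0)// oppr_le0.
Qed.

(** Both the counts and their means add up over the fractional cell, so the
    rounding error is the centred count of an interval of length at most [1]. *)
Lemma xi_lattice_error N i X : 1 < N ->
  `|xi P N (t i) X - lattice_xi t N i X| <=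
  (npartR `[(lattice_end t N i)%:R, t i * N] X + pi^-1) * (scale N)^-1.
Proof.
move=> N1; have tN0 : 0 <= t i * N by rewrite mulr_ge0//; lra.
have /truncn_itv/andP[nx xn] := tN0; rewrite /lattice_xi /xi /lattice_end -/(scale N).
set n := Num.truncn _ in nx xn *.
have -> : fine 'E_P[npartR `[0, t i * N]] = t i * N / pi.
  have := @expect_npart_itv 0 n.+1 _ tN0 xn; rewrite subr0 => E.
  by rewrite unlock E.
have -> : npartR `[0, t i * N] X = npartR `[0, n%:R[ X + npartR `[n%:R, t i * N] X.
  exact: npart_split nx xn.
have s0 : 0 <= (scale N)^-1 by rewrite invr_ge0 mulr_ge0 ?invr_ge0 ?pi_ge0 ?sqrtr_ge0.
have p0 : 0 < pi^-1 :> R by rewrite invr_gt0 pi_gt0.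
rewrite -mulrBl normrM (ger0_norm s0) ler_wpM2r//.
have k0 : 0 <= npartR `[n%:R, t i * N] X by exact: ler0n.
have h1 : 0 <= (t i * N - n%:R) / pi by rewrite mulr_ge0 ?(ltW p0)// subr_ge0.
have h2 : (t i * N - n%:R) / pi <= pi^-1.
  by rewrite ler_piMl ?(ltW p0)//; rewrite -natr1 in xn; lra.
move: h1 h2; rewrite mulrBl ler_norml => h1 h2; apply/andP; split; lra.
Qed.

Lemma xi_lattice_error_L1 N : 1 < N ->
  P.-integrable setT (EFin \o (fun X => \sum_i `|xi P N (t i) X - lattice_xi t N i X|)) /\
  \int[P]_X (\sum_i `|xi P N (t i) X - lattice_xi t N i X|) <= d%:R * (2 / pi) * (scale N)^-1.
Proof.
move=> N1; have N0 : 0 < N by lra.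
pose k i X := npartR `[(lattice_end t N i)%:R, t i * N] X.
pose b X := \sum_i (k i X + pi^-1) * (scale N)^-1.
have tr i : (lattice_end t N i)%:R <= t i * N < (lattice_end t N i).+1%:R.
  by apply: truncn_itv; rewrite mulr_ge0// ltW.
have ik i : P.-integrable setT (EFin \o k i).
  by apply: integrable_npartR; have /andP[] := tr i.
have ikp i : P.-integrable setT (EFin \o (fun X => k i X + cst pi^-1 X)).
  by apply: integrable_add => //; exact: finite_measure_integrable_cst.
have iki i : P.-integrable setT (EFin \o (fun X => (scale N)^-1 * (k i X + cst pi^-1 X))).
  exact: integrable_scale.
have bE X : b X = \sum_i (scale N)^-1 * (k i X + cst pi^-1 X).
  by apply: eq_bigr => i _; rewrite mulrC.
have ib : P.-integrable setT (EFin \o b).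
  have := @integrable_sum _ _ _ P setT measurableT _ (enum 'I_d) xpredT
    (fun i => EFin \o (fun X => (scale N)^-1 * (k i X + cst pi^-1 X))) (fun i _ => iki i).
  apply: eq_integrable => // X _ /=; rewrite bE -sumEFin big_enum.
  by [].
have ier : P.-integrable setT
    (EFin \o (fun X => \sum_i `|xi P N (t i) X - lattice_xi t N i X|)).
  apply: (integrable_dominated _ ib).
    apply: measurable_sum => i; apply: measurableT_comp => //; apply: measurable_funB.
      exact: measurable_xi.
    exact: measurable_lattice_xi.
  move=> X; rewrite ger0_norm ?sumr_ge0//; apply: ler_sum => i _.
  exact: xi_lattice_error.
split=> //; apply: le_trans (_ : \int[P]_X b X <= _).
  apply: le_Rintegral => // X _; apply: ler_sum => i _; exact: xi_lattice_error.
have s0 : 0 <= (scale N)^-1 by rewrite invr_ge0 mulr_ge0 ?invr_ge0 ?pi_ge0 ?sqrtr_ge0.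
have p0 : 0 < pi^-1 :> R by rewrite invr_gt0 pi_gt0.
rewrite (_ : \int[P]_X b X = \sum_i \int[P]_X ((scale N)^-1 * (k i X + cst pi^-1 X))); last first.
  have EI h : P.-integrable setT (EFin \o h) ->
      ((\int[P]_X h X)%:E = \int[P]_X (h X)%:E)%E.
    by move=> ih; rewrite /Rintegral fineK//; exact: integrable_fin_num.
  apply: EFin_inj; rewrite EI// -sumEFin; under [RHS]eq_bigr => i _ do rewrite EI//.
  by rewrite -integral_sum//; apply: eq_integral => X _; rewrite bE -sumEFin.
rewrite -mulrA mulr_natl -[in leRHS](card_ord d) -sumr_const; apply: ler_sum => i _.
rewrite RintegralZl// mulrC ler_wpM2r// RintegralD//; last exact: finite_measure_integrable_cst.
have -> : \int[P]_X cst pi^-1 X = pi^-1.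
  rewrite /cst (Rintegral_cst P measurableT) -[RHS]mulr1; congr (_ * _).
  exact: (congr1 fine (probability_setT P)).
have /andP[nx xn] := tr i.
rewrite /Rintegral (expect_npart_itv nx xn)/=.
have : (t i * N - (lattice_end t N i)%:R) / pi <= pi^-1.
  by rewrite ler_piMl ?(ltW p0)//; rewrite -natr1 in xn; lra.
lra.
Qed.

Lemma cvg_xi_lattice_error :
  \int[P]_X (\sum_i `|xi P N (t i) X - lattice_xi t N i X|) @[N --> +oo] --> (0 : R).
Proof.
have h : d%:R * (2 / pi) * (scale N)^-1 @[N --> +oo] --> (0 : R).
  rewrite -[X in _ --> X](mulr0 (d%:R * (2 / pi))); by apply: cvgM; [exact: cvg_cst|exact: cvg_inv_scale].
apply: (squeeze_cvgr _ (cvg_cst 0) h); near=> N.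
have N1 : 1 < N.
  by apply: (@lt_le_trans _ _ 2); [rewrite ltr1n|near: N; exact: near_pinfty_ge].
rewrite (xi_lattice_error_L1 N1).2 andbT.
by apply: Rintegral_ge0 => X _; exact: sumr_ge0.
Unshelve. all: by end_near. Qed.

End rounding_error.

Theorem proposition1p3 (R : realType) (P : probability (configs R) R)
  (hP : is_sine_process P)
  (dT : measure_display) (T : measurableType dT) (Q : probability T R)
  (eta : R -> {RV Q >-> R})
  (eta_indep : mutually_independent `[0, 1] eta)
  (eta_gauss : forall t, 0 <= t <= 1 -> forall A : set R, measurable A ->
     distribution Q (eta t) A = normal_prob 0 (Num.sqrt (1 / 2)) A)
  (d : nat) (hd : (1 <= d)%N) (t : 'I_d -> R)
  (t_incr : forall i j : 'I_d, (i < j)%N -> t i < t j)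
  (t_range : forall i : 'I_d, 0 <= t i <= 1) :
  weak_cvg (fun N : R => distribution P (xi_vector P t N))
           (distribution Q (increment_vector eta t)).
Proof.
have t0 i : 0 <= t i by have /andP[] := t_range i.
move=> f cf [M fM].
have mf := measurable_of_continuous_row cf fM.
pose G w i := eta 0 w - eta (t i) w.
have mG i : measurable_fun setT (fun w => G w i) by exact: measurable_funB.
have lapG s : (\int[Q]_w (expR (\sum_j s j * G w j))%:E =
   (expR ((\sum_i \sum_j s i * s j * limit_cov t i j) / 2))%:E)%E.
  exact: laplace_increments.
have iG s : Q.-integrable setT (EFin \o (fun w => expR (\sum_j s j * G w j))).
  apply/integrableP; split.
    apply/measurable_EFinP; apply: measurableT_comp; first exact: measurable_expR.
    by apply: measurable_sum => j; exact: measurable_funM.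
  under eq_integral => w _ do rewrite /= ger0_norm ?expR_ge0//.
  by rewrite lapG ltry.
have N1 : \forall N \near (+oo : set_system R), 1 < N.
  by apply: nbhs_pinfty_gt; rewrite num_real.
have integralE (dO : measure_display) (O : measurableType dO) (mu : probability O R)
    (Y : {mfun O >-> d.-tuple R}) (Z : O -> 'I_d -> R) :
    (forall w, Y w = [tuple Z w i | i < d]) ->
    (forall i, measurable_fun setT (fun w => Z w i)) ->
    (\int[distribution mu Y]_x (f x)%:E = (\int[mu]_w f [tuple Z w i | i < d])%:E)%E.
  move=> YE mZ; have ifZ := integrable_bounded_continuous cf fM mu mZ.
  rewrite /Rintegral fineK; last exact: integrable_fin_num.
  rewrite integral_pushforward//.
  - by rewrite preimage_setT; apply: eq_integral => w _ /=; rewrite YE.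
  - exact/measurable_EFinP.
  - rewrite preimage_setT; apply: eq_integrable ifZ => // w _ /=; by rewrite YE.
rewrite (integralE _ _ Q _ G)//.
rewrite (_ : (fun N => _) = (fun N => (\int[P]_X f [tuple xi P N (t i) X | i < d])%:E)); last first.
  apply/funext => N; rewrite (integralE _ _ P _ (fun X i => xi P N (t i) X))//.
  by move=> i; exact: measurable_xi.
apply: cvg_EFin; first exact: nearW.
apply: (@weak_cvg_of_laplace _ _ _ _ R R (+oo : set_system R) _ P Q d
  (fun N X i => xi P N (t i) X) (fun N X i => lattice_xi t N i X) G _ _ mG _ iG _ _ _ f M) => //.
- by move=> N i; exact: measurable_xi.
- by move=> N i; exact: measurable_lattice_xi.
- apply: filterS N1 => N N1 s; exact: (laplace_lattice_xi hP t0 s).1.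
- move=> s; rewrite /Rintegral lapG; exact: (laplace_lattice_xi hP t0 s).2.
- apply: filterS N1 => N N1; exact: (xi_lattice_error_L1 hP t0 N1).1.
- exact: cvg_xi_lattice_error.
Qed.
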